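(* Let $n,m\in\mathbb N$, let $\Omega\subset\mathbb R^n$ be open, let $A$ be a Young function satisfying conditions (C1), (C2), (C3), let $\varphi$ be a gauge function and let $\psi$ be the associated gauge function defined below. (i) Let $u\in V^{1,A}(\Omega,\mathbb R^m)$. For every $\varepsilon>0$ there exists $\delta>0$ such that, for every set $E\subset\Omega$, if $\mathscr H^{\varphi}(E)<\delta$ then $\mathscr H^{\psi}(u(E))<\varepsilon$. (ii) Let $u\in V^{1,A}(\mathbb R^n,\mathbb R^m)$. For every $\varepsilon>0$ there exists $\delta>0$ such that, for every set $E\subset\mathbb R^n$, if $\mathscr H^{\varphi}_\infty(E)<\delta$ then $\mathscr H^{\psi}_\infty(u(E))<\varepsilon$.
   Context: A gauge function is a function $\varphi\colon[0,\infty)\to[0,\infty)$ that is increasing, continuous and vanishes only at $0$; throughout, gauge functions are additionally assumed to be such that $r\mapsto\varphi(r)/r^n$ is non-increasing on $(0,\infty)$. For a gauge function $\varphi$, $\sigma\in(0,\infty]$ and $E\subset\mathbb R^k$, $\mathscr H^\varphi_\sigma(E)=\inf\{\sum_{i}\varphi(d(E_i)): d(E_i)\le\sigma,\ E\subset\bigcup_i E_i\}$ ($d$ = diameter); the Hausdorff measure is $\mathscr H^\varphi(E)=\lim_{\sigma\to0^+}\mathscr H^\varphi_\sigma(E)$ and the Hausdorff content is $\mathscr H^\varphi_\infty$. A Young function is a non-trivial convex function $A\colon[0,\infty)\to[0,\infty]$ with $A(0)=0$; its Young conjugate is $\widetilde A(t)=\sup_{\tau\ge0}(\tau t-A(\tau))$.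 The Orlicz space $L^A(\Omega)$ consists of measurable $f$ with finite Luxemburg norm $\|f\|_{L^A(\Omega)}=\inf\{\lambda>0:\int_\Omega A(|f|/\lambda)\,dx\le1\}$. $V^{1,A}(\Omega,\mathbb R^m)=\{u\in L^1_{\rm loc}(\Omega,\mathbb R^m): u$ weakly differentiable, $|\nabla u|\in L^A(\Omega)\}$, and $V^{1,A}_{\rm loc}$ is its local version. Conditions: (C1) if $n=1$, $\lim_{t\to\infty}t/A(t)=0$; if $n\ge2$, $\int^\infty (t/A(t))^{1/(n-1)}dt<\infty$. (C2) $0<A(t)<\infty$ for $t>0$. (C3) if $n=1$, $\lim_{t\to0^+}t/A(t)=\infty$; if $n\ge2$, $\int_0(t/A(t))^{1/(n-1)}dt=\infty$. Under (C1), every map in $V^{1,A}_{\rm loc}$ has a continuous representative, which is always the one used. Define $B=A$ if $n=1$, and for $n\ge2$ let $B$ be the Young conjugate of $t\mapsto t^{n'}\int_t^\infty \widetilde A(s)s^{-1-n'}ds$, with $n'=n/(n-1)$. Define $J(0)=0$, $J(s)=s\,B^{-1}(\varphi(s)/s^n)$ for $s>0$ (bijective increasing), and $\psi(r)=\varphi(J^{-1}(r))$. *)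

(* Defs.v *)
From HB Require Import structures.
From mathcomp Require Import all_boot all_order all_algebra.
From mathcomp Require Import all_classical all_reals all_analysis.

Set Implicit Arguments.
Unset Strict Implicit.
Unset Printing Implicit Defensive.
Import Order.TTheory GRing.Theory Num.Theory.
Import numFieldNormedType.Exports.

Local Open Scope classical_set_scope.
Local Open Scope ring_scope.

Definition enorm (R : realType) (k : nat) (x : 'rV[R]_k) : R :=
  Num.sqrt (\sum_(i < k) x ord0 i ^+ 2).

(** Euclidean diameter, with d(set0) = 0. *)
Definition diam (R : realType) (k : nat) (E : set 'rV[R]_k) : \bar R :=
  ereal_sup ([set 0%E] `|` [set (enorm (x - y))%:E | x in E & y in E]).

Definition gauge (R : realType) (n : nat) (phi : R -> R) : Prop :=
  [/\ phi 0 = 0,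
      (forall r : R, 0 < r -> 0 < phi r),
      (forall r s : R, 0 <= r -> r <= s -> phi r <= phi s),
      {within `[0, +oo[, continuous phi} &
      (forall r s : R, 0 < r -> r <= s -> phi s / s ^+ n <= phi r / r ^+ n)].

Definition Hsigma (R : realType) (k : nat) (phi : R -> R) (sigma : \bar R)
    (E : set 'rV[R]_k) : \bar R :=
  ereal_inf [set (\sum_(i <oo) (phi (fine (diam (F i))))%:E)%E
            | F in [set F : (set 'rV[R]_k)^nat |
                     (forall i, (diam (F i) < +oo)%E /\ (diam (F i) <= sigma)%E)
                     /\ E `<=` \bigcup_i F i]].

Definition Hmeasure (R : realType) (k : nat) (phi : R -> R)
    (E : set 'rV[R]_k) : \bar R :=
  lim (Hsigma phi s%:E E @[s --> 0^'+]).

Definition Hcontent (R : realType) (k : nat) (phi : R -> R)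
    (E : set 'rV[R]_k) : \bar R :=
  Hsigma phi +oo%E E.

(** Young function A : [0,oo) -> [0,oo] (only values on [0,oo) matter). *)
Definition young (R : realType) (A : R -> \bar R) : Prop :=
  [/\ A 0 = 0%E,
      (forall t, 0 <= t -> (0 <= A t)%E),
      (forall x y l : R, 0 <= x -> 0 <= y -> 0 <= l <= 1 ->
          (A (l * x + (1 - l) * y)%R <= l%:E * A x + (1 - l)%R%:E * A y)%E),
      (exists t, 0 < t /\ A t <> 0%E) &
      (exists t, 0 < t /\ A t <> +oo%E)].

Definition young_conj (R : realType) (A : R -> \bar R) : R -> \bar R :=
  fun t => ereal_sup [set ((tau * t)%:E - A tau)%E | tau in [set tau : R | 0 <= tau]].

(** t / A(t) (under (C2) A(t) is finite and positive for t > 0). *)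
Definition ratioA (R : realType) (A : R -> \bar R) (t : R) : R := t / fine (A t).

Definition C1 (R : realType) (n : nat) (A : R -> \bar R) : Prop :=
  (n = 1%N -> ratioA A t @[t --> +oo] --> 0) /\
  ((2 <= n)%N -> exists T : R, 0 < T /\
     (\int[lebesgue_measure]_(t in [set t : R | (T <= t)%R])
         ((ratioA A t) `^ (n.-1%:R)^-1)%R%:E < +oo)%E).

Definition C2 (R : realType) (A : R -> \bar R) : Prop :=
  forall t, 0 < t -> (0%E < A t)%E /\ (A t < +oo)%E.

Definition C3 (R : realType) (n : nat) (A : R -> \bar R) : Prop :=
  (n = 1%N -> ratioA A t @[t --> 0^'+] --> +oo) /\
  ((2 <= n)%N -> exists T : R, 0 < T /\
     (\int[lebesgue_measure]_(t in [set t : R | (0 < t <= T)%R])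
         ((ratioA A t) `^ (n.-1%:R)^-1)%R%:E = +oo)%E).

Definition nprime (R : realType) (n : nat) : R := n%:R / (n%:R - 1).

Definition Efun (R : realType) (n : nat) (A : R -> \bar R) (t : R) : \bar R :=
  ((t `^ nprime R n)%:E *
   \int[lebesgue_measure]_(s in [set s : R | (t < s)%R])
      (young_conj A s * (s `^ (- 1 - nprime R n))%R%:E))%E.

Definition Bfun (R : realType) (n : nat) (A : R -> \bar R) : R -> \bar R :=
  if n == 1%N then A else young_conj (Efun n A).

Definition Binv (R : realType) (n : nat) (A : R -> \bar R) (x : R) : R :=
  sup [set tau : R | 0 <= tau /\ (Bfun n A tau <= x%:E)%E].

(** J(s) = s B^{-1}(phi(s)/s^n)  (so that J(0) = 0). *)
Definition Jfun (R : realType) (n : nat) (A : R -> \bar R) (phi : R -> R)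
    (s : R) : R :=
  s * Binv n A (phi s / s ^+ n).

(** inverse of the increasing bijection J. *)
Definition Jinv (R : realType) (n : nat) (A : R -> \bar R) (phi : R -> R)
    (r : R) : R :=
  inf [set s : R | 0 <= s /\ r <= Jfun n A phi s].

Definition psi (R : realType) (n : nat) (A : R -> \bar R) (phi : R -> R)
    (r : R) : R :=
  phi (Jinv n A phi r).

(* Lebesgue measure on R^n: Caratheodory restriction of the Lebesgue   *)
(* outer measure  E |-> inf { sum_k vol(Q_k) : E <= U_k Q_k,           *)
(* Q_k closed boxes }.                                                 *)

Definition rvall (R : realType) (n : nat) : Type := 'rV[R]_n.
HB.instance Definition _ (R : realType) (n : nat) :=
  Pointed.on (rvall R n).
HB.instance Definition _ (R : realType) (n : nat) :=
  @isMeasurable.Build default_measure_display (rvall R n)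
    discrete_measurable discrete_measurable0
    discrete_measurableC discrete_measurableU.

Definition cbox (R : realType) (n : nat) (a b : 'rV[R]_n) : set 'rV[R]_n :=
  [set x | forall i, a ord0 i <= x ord0 i <= b ord0 i].

Definition box_content (R : realType) (n : nat) (S : set (rvall R n)) : \bar R :=
  if pselect (S = set0) then 0%E else
  ereal_inf [set (\prod_(i < n) (ab.2 ord0 i - ab.1 ord0 i))%:E
            | ab in [set ab : 'rV[R]_n * 'rV[R]_n |
                     (forall i, ab.1 ord0 i <= ab.2 ord0 i) /\
                     S `<=` cbox ab.1 ab.2]].

Lemma box_content0 (R : realType) (n : nat) : box_content (@set0 (rvall R n)) = 0%E.
Proof. rewrite /box_content; by destruct (pselect _). Qed.

Lemma box_content_ge0 (R : realType) (n : nat) (S : set (rvall R n)) :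
  (0 <= box_content S)%E.
Proof.
rewrite /box_content; destruct (pselect _) as [H|H]; first by [].
apply: le_ereal_inf_tmp => _ [ab [Hab _] <-]; rewrite lee_fin.
by apply: prodr_ge0 => i _; rewrite subr_ge0.
Qed.

Definition leb_outer (R : realType) (n : nat) : set (rvall R n) -> \bar R :=
  mu_ext (@box_content R n).

HB.instance Definition _ (R : realType) (n : nat) :=
  isOuterMeasure.Build R (rvall R n) (@leb_outer R n)
    (mu_ext0 (@box_content0 R n) (@box_content_ge0 R n))
    (mu_ext_ge0 (@box_content_ge0 R n))
    (le_mu_ext (@box_content R n))
    (mu_ext_sigma_subadditive (@box_content_ge0 R n)).

Definition Leb (R : realType) (n : nat) := caratheodory_type (@leb_outer R n).

Definition lebesgue_n (R : realType) (n : nat) : set (Leb R n) -> \bar R :=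
  @leb_outer R n.

HB.instance Definition _ (R : realType) (n : nat) :=
  isMeasure.Build _ (Leb R n) R (@lebesgue_n R n)
    (@caratheodory_measure0 R (rvall R n) (@leb_outer R n))
    (@caratheodory_measure_ge0 R (rvall R n) (@leb_outer R n))
    (@caratheodory_measure_sigma_additive R (rvall R n) (@leb_outer R n)).

Definition lint (R : realType) (n : nat) (D : set 'rV[R]_n)
    (f : 'rV[R]_n -> \bar R) : \bar R :=
  \int[@lebesgue_n R n]_(x in (D : set (Leb R n))) f x.

Definition lmeasurable_fun (R : realType) (n : nat) (D : set 'rV[R]_n)
    (f : 'rV[R]_n -> R) : Prop :=
  @measurable_fun _ _ (Leb R n) R (D : set (Leb R n)) f.

Definition locint (R : realType) (n : nat) (D : set 'rV[R]_n)
    (f : 'rV[R]_n -> R) : Prop :=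
  lmeasurable_fun D f /\
  forall K : set 'rV[R]_n, compact K -> K `<=` D ->
    (lint K (fun x => (`|f x|)%:E) < +oo)%E.

Definition evec (R : realType) (n : nat) (j : 'I_n) : 'rV[R]_n := delta_mx 0 j.

Fixpoint iterD (R : realType) (n : nat) (js : seq 'I_n)
    (f : 'rV[R]_n -> R) : 'rV[R]_n -> R :=
  match js with
  | [::] => f
  | j :: js' => 'D_(evec R j) (iterD js' f)
  end.

Definition smooth (R : realType) (n : nat) (f : 'rV[R]_n -> R) : Prop :=
  forall (js : seq 'I_n) (x : 'rV[R]_n), differentiable (iterD js f) x.

Definition testfun (R : realType) (n : nat) (D : set 'rV[R]_n)
    (f : 'rV[R]_n -> R) : Prop :=
  smooth f /\
  exists K : set 'rV[R]_n, [/\ compact K, K `<=` D & forall x, ~ K x -> f x = 0].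

Definition weak_grad (R : realType) (n m : nat) (D : set 'rV[R]_n)
    (u : 'rV[R]_n -> 'rV[R]_m) (g : 'I_m -> 'I_n -> 'rV[R]_n -> R) : Prop :=
  (forall i j, locint D (g i j)) /\
  forall f, testfun D f -> forall i j,
    lint D (fun x => (u x ord0 i * 'D_(evec R j) f x)%:E) =
    (- lint D (fun x => (g i j x * f x)%:E))%E.

Definition lux_norm (R : realType) (n : nat) (A : R -> \bar R)
    (D : set 'rV[R]_n) (f : 'rV[R]_n -> R) : \bar R :=
  ereal_inf [set l%:E | l in [set l : R | 0 < l /\
                 (lint D (fun x => A (`|f x| / l)%R) <= 1)%E]].

Definition orlicz (R : realType) (n : nat) (A : R -> \bar R)
    (D : set 'rV[R]_n) (f : 'rV[R]_n -> R) : Prop :=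
  lmeasurable_fun D f /\ (lux_norm A D f < +oo)%E.

Definition V1A (R : realType) (n m : nat) (A : R -> \bar R)
    (D : set 'rV[R]_n) (u : 'rV[R]_n -> 'rV[R]_m) : Prop :=
  (forall i, locint D (fun x => u x ord0 i)) /\
  exists g : 'I_m -> 'I_n -> 'rV[R]_n -> R,
    weak_grad D u g /\
    orlicz A D (fun x => Num.sqrt (\sum_(i < m) \sum_(j < n) g i j x ^+ 2)).

(* Main.v *)
(** Let Q be a closed cube of side r in the domain and M the integral of A(|grad u| / l) over Q.
   For x in Q the averages of u against smooth bumps on the cubes x + 2^-k (Q - x) converge to
   u(x).  The difference of two consecutive bumps is the divergence of a smooth field supported in
   the larger cube, so the weak gradient controls the difference of the averages; summing over k
   with Young's inequality gives B(c osc_Q u / r) <= M / r^n.  Since J(s) / phi(s)^(1/n) is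
   nondecreasing, this turns into psi(diam u(Q)) <= C (phi(r) + M).

   A set of small content is covered by dyadic cubes with small total phi(r).  The maximal ones
   are disjoint, and their union has small Lebesgue measure because r^n <= phi(r) / phi(1) for
   r <= 1, so the sum of the M is small by absolute continuity of the integral; this gives the
   statement for contents.  For measures and a general open set, the domain is split into the
   layers of points whose first dyadic cube contained in the domain has level k.  A dyadic cube of
   level at least k lies in the k-th layer or misses it, so dyadic contents are superadditive over
   the layers, and all of E can be covered by arbitrarily fine cubes inside the domain with small
   total phi(r). *)
Require Import Defs.
From HB Require Import structures.
From mathcomp Require Import all_boot all_order all_algebra.
From mathcomp Require Import all_classical all_reals all_analysis.
From mathcomp Require Import measurable_realfun.
From mathcomp Require Import ring lra.
Set Implicit Arguments.
Unset Strict Implicit.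
Unset Printing Implicit Defensive.
Import Order.TTheory GRing.Theory Num.Theory.
Import numFieldNormedType.Exports.
Local Open Scope classical_set_scope.
Local Open Scope ring_scope.

(** * Lebesgue outer measure of boxes *)

(** The weak gradient is tested only against smooth compactly supported functions. Averages against
    bumps fit this without mollification, because the interpolating field between two bumps is
    itself a test function. One factor of each component of that field is a difference of
    primitives, bounded by [1], so on a cube of side [s] the field has size [s^-(n-1)] instead of
    [s^-n].

    At step [k] a weight of order [2^(k(n-1))] then acts on a volume of order [2^(-kn)]. Young's
    inequality produces the sum of [2^(-kn) young_conj A (t 2^(k(n-1)))], which is a Riemann sum for
    [Efun] on the geometric grid of ratio [q = 2^(n-1)], since [q^n' = 2^n]. Taking the conjugate in
    [t] gives [Bfun].

    The gauge is compared at the scale [s >= r] with [phi s = max (phi r) M], where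
    [r B^-1(M / r^n) <= J s].

    For measures, no single scale keeps all cubes inside the domain. The [k]-th layer is covered at
    levels at least [k], while each partial sum over the layers is controlled at one common
    level. *)

Lemma box_content_le (R : realType) (n : nat) (S : set (rvall R n)) (a b : 'rV[R]_n) :
  (forall i, a ord0 i <= b ord0 i) -> S `<=` cbox a b ->
  (box_content S <= (\prod_(i < n) (b ord0 i - a ord0 i))%:E)%E.
Proof.
move=> ab Sab; rewrite /box_content; case: pselect => [?|?].
  by rewrite lee_fin; apply: prodr_ge0 => i _; rewrite subr_ge0.
by apply: ereal_inf_lbound; exists (a, b).
Qed.

(** When both pieces are nonempty, [c] lies in the [j]-th side of every box containing [S], so
    cutting the box at [c] gives two boxes whose volumes add up. This is what makes half-spaces
    Caratheodory measurable. *)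
Lemma box_content_split (R : realType) (n : nat) (S : set (rvall R n)) (j : 'I_n) (c : R) :
  (box_content (S `&` [set x | ((x : 'rV[R]_n) ord0 j <= c)%R]) +
   box_content (S `&` ~` [set x | ((x : 'rV[R]_n) ord0 j <= c)%R]) <= box_content S)%E.
Proof.
set H := [set x : rvall R n | _].
have [->|S0] := eqVneq S set0; first by rewrite !set0I !box_content0 adde0.
have [SH|SH] := eqVneq (S `&` H) set0.
  by rewrite SH box_content0 add0e; move/disjoints_subset/setIidPl : SH => ->.
have [SC|SC] := eqVneq (S `&` ~` H) set0.
  rewrite SC box_content0 adde0.
  suff -> : S `&` H = S by [].
  by apply/setIidPl; move/disjoints_subset : SC; rewrite setCK.
rewrite [leRHS]/box_content; case: pselect => [S00|?]; first by rewrite S00 eqxx in S0.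
apply: le_ereal_inf_tmp => _ [[a b] [/= ab Sab] <-].
move/set0P: SH => [x [Sx Hx]]; move/set0P: SC => [y [Sy /negP Hy]].
rewrite -ltNge in Hy.
have ajc : a ord0 j <= c by apply: le_trans Hx; have /andP[] := Sab _ Sx j.
have cbj : c <= b ord0 j by apply: (le_trans (ltW Hy)); have /andP[] := Sab _ Sy j.
pose b' : 'rV[R]_n := \row_i (if i == j then c else b ord0 i).
pose a' : 'rV[R]_n := \row_i (if i == j then c else a ord0 i).
have -> : ((\prod_(i < n) (b ord0 i - a ord0 i))%:E =
  (\prod_(i < n) (b' ord0 i - a ord0 i))%:E + (\prod_(i < n) (b ord0 i - a' ord0 i))%:E)%E.
  rewrite -EFinD; congr EFin.
  rewrite (bigD1 j)//= [in RHS](bigD1 j)//= [X in _ = _ + X](bigD1 j)//=.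
  rewrite !mxE eqxx.
  have -> : \prod_(i < n | i != j) (b' ord0 i - a ord0 i) =
            \prod_(i < n | i != j) (b ord0 i - a ord0 i).
    by apply: eq_bigr => i /negbTE ij; rewrite mxE ij.
  have -> : \prod_(i < n | i != j) (b ord0 i - a' ord0 i) =
            \prod_(i < n | i != j) (b ord0 i - a ord0 i).
    by apply: eq_bigr => i /negbTE ij; rewrite mxE ij.
  by rewrite -mulrDl; congr (_ * _); ring.
apply: leeD; apply: box_content_le.
- by move=> i; rewrite mxE; case: eqP => [->|].
- move=> z [Sz Hz] i; have /andP[h1 h2] := Sab _ Sz i.
  by rewrite mxE h1; case: eqP => [->|].
- by move=> i; rewrite mxE; case: eqP => [->|].
- move=> z [Sz /negP Hz] i; have /andP[h1 h2] := Sab _ Sz i.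
  by rewrite mxE h2 andbT; case: eqP => [->|//]; rewrite ltW// ltNge.
Qed.

Lemma leb_outer_lt_cover {R : realType} {n : nat} (F : (set (rvall R n))^nat) (X : set (rvall R n)) :
  X `<=` \bigcup_k F k -> (leb_outer X <= \sum_(k <oo) box_content (F k))%E.
Proof. by move=> XF; apply: ereal_inf_lbound; exists F. Qed.

Lemma measurable_halfspace (R : realType) (n : nat) (j : 'I_n) (c : R) :
  @measurable _ (Leb R n) [set x : 'rV[R]_n | x ord0 j <= c].
Proof.
suff : (@leb_outer R n).-caratheodory [set x : 'rV[R]_n | x ord0 j <= c] by [].
apply: le_caratheodory_measurable => X.
apply: le_ereal_inf_tmp => _ [F [_ XF] <-].
set H := [set x : rvall R n | _].
apply: (@le_trans _ _ (\sum_(k <oo) (box_content (F k `&` H) + box_content (F k `&` ~` H)))%E).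
  rewrite nneseriesD; [|by move=> *; exact: box_content_ge0..].
  apply: leeD; apply: leb_outer_lt_cover; rewrite -setI_bigcupl; exact: setSI.
apply: lee_nneseries => k *; last exact: box_content_split.
by apply: adde_ge0; exact: box_content_ge0.
Qed.

Lemma leb_outer_cbox_le {R : realType} {n : nat} (a b : 'rV[R]_n) :
  (forall i, a ord0 i <= b ord0 i) ->
  (leb_outer (cbox a b : set (rvall R n)) <= (\prod_(i < n) (b ord0 i - a ord0 i))%:E)%E.
Proof.
move=> ab.
have := @leb_outer_lt_cover R n (fun k => if k is 0%N then cbox a b else set0) (cbox a b).
have h : cbox a b `<=` \bigcup_k (if k is 0%N then cbox a b else set0) by move=> x xab; exists 0%N.
move=> /(_ h)/le_trans; apply.
rewrite nneseries_recl//; last by move=> [|k] _; exact: box_content_ge0.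
rewrite [X in (_ + X)%E](_ : _ = 0)%E ?adde0; first exact: box_content_le.
by rewrite eseries_cond/= eseries0// => -[|k]// _ _; exact: box_content0.
Qed.

Lemma le_prod_pred (R : realType) (n j : nat) (hj : (j < n)%N) (F G : 'I_n -> R) :
  \prod_(i < n) (if (i < j.+1)%N then F i else G i) =
  F (Ordinal hj) * \prod_(i < n | i != Ordinal hj) (if (i < j)%N then F i else G i).
Proof.
rewrite (bigD1 (Ordinal hj))//= ltnSn; congr (_ * _); apply: eq_bigr => i ij.
rewrite ltnS leq_eqVlt; case: eqP => //= eij; exfalso; move/eqP: ij; apply.
exact: val_inj.
Qed.

(* The Lebesgue integral over [0, 1] is applied to one coordinate of the cover at a time, which
   replaces the indicator of each side of a box by its length and needs no compactness. *)
Lemma unit_cover_prod (R : realType) (n : nat) (a b : nat -> 'rV[R]_n) :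
  (forall k i, a k ord0 i <= b k ord0 i) ->
  cbox (const_mx 0) (const_mx 1) `<=` \bigcup_k cbox (a k) (b k) ->
  (1 <= \sum_(k <oo) (\prod_(i < n) (b k ord0 i - a k ord0 i))%:E)%E.
Proof.
move=> ab cov.
pose ind k i (t : R) : R := \1_(`[a k ord0 i, b k ord0 i]%classic) t.
have ind0 k i t : 0 <= ind k i t by rewrite /ind indicE ler0n.
(* [g j k] interpolates between the indicator of the [k]-th box ([j = 0]) and its volume
   ([j = n]). *)
pose g j k (x : 'rV[R]_n) : R :=
  \prod_(i < n) (if (i < j)%N then b k ord0 i - a k ord0 i else ind k i (x ord0 i)).
have g0 j k x : 0 <= g j k x.
  by apply: prodr_ge0 => i _; case: ifP => _ //; rewrite subr_ge0.
have step j x : (j <= n)%N -> cbox (const_mx 0) (const_mx 1) x -> (1 <= \sum_(k <oo) (g j k x)%:E)%E.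
  elim: j x => [x _ xu|j IH x jn xu].
    have [k _ xk] := cov _ xu.
    rewrite (nneseriesD1 (n := k))//; last by move=> *; rewrite lee_fin.
    have -> : g 0%N k x = 1.
      rewrite /g big1// => i _; rewrite /= /ind indicE mem_set//=.
      by have := xk i; rewrite in_itv.
    by rewrite leeDl//; apply: nneseries_ge0 => *; rewrite lee_fin.
  pose J := Ordinal jn.
  pose y (t : R) : 'rV[R]_n := \row_i (if i == J then t else x ord0 i).
  pose c k : R := \prod_(i < n | i != J) (if (i < j)%N then b k ord0 i - a k ord0 i else ind k i (x ord0 i)).
  have c0 k : 0 <= c k.
    by apply: prodr_ge0 => i _; case: ifP => _ //; rewrite subr_ge0.
  have gy k t : g j k (y t) = ind k J t * c k.
    rewrite /g (bigD1 J)//= ltnn mxE eqxx; congr (_ * _); apply: eq_bigr => i /negbTE iJ.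
    by rewrite mxE iJ.
  have gx k : g j.+1 k x = (b k ord0 J - a k ord0 J) * c k by rewrite /g (le_prod_pred jn).
  have mg k : measurable_fun (`[0, 1]%classic : set R) (fun t : R => g j k (y t)).
    rewrite [X in measurable_fun _ X](_ : _ = fun t => ind k J t * c k); last first.
      by apply/funext => t; rewrite gy.
    by apply: measurable_funM => //; exact: measurable_indic.
  have int1 : (\int[lebesgue_measure]_(t in `[0%R, 1%R]%classic) (1%:E : \bar R) = 1)%E.
    by rewrite integral_cst//= mul1e lebesgue_measure_itv/= lte_fin ltr01 oppr0 adde0.
  (* The bound for [j] holds at every point of the unit cube, so it may be integrated in the [j]-th
     coordinate alone. *)
  rewrite -[leLHS]int1.
  apply: (@le_trans _ _ (\int[lebesgue_measure]_(t in `[0%R, 1%R]%classic) (\sum_(k <oo) (g j k (y t))%:E))%E).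
    apply: ge0_le_integral => //=.
    - apply: ge0_emeasurable_sum => [k t _ _|k _]; first by rewrite lee_fin.
      by apply/measurable_EFinP; exact: mg.
    - move=> t t01; apply: IH; first exact: ltnW.
      move=> i; rewrite !mxE; case: eqP => _; first by move: t01; rewrite in_itv.
      by have := xu i; rewrite !mxE.
  rewrite integral_nneseries//=; last 2 first.
  - by move=> k; apply/measurable_EFinP; exact: mg.
  - by move=> k t _; rewrite lee_fin.
  apply: lee_nneseries => [k _ _|k _]; first by apply: integral_ge0 => t _; rewrite lee_fin.
  under eq_integral do rewrite gy EFinM muleC.
  rewrite ge0_integralZl//=; last 3 first.
  - by apply/measurable_EFinP; exact: measurable_indic.
  - by move=> t _; rewrite lee_fin.
  - by rewrite lee_fin.
  rewrite gx mulrC EFinM; apply: lee_wpmul2l; first by rewrite lee_fin.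
  rewrite integral_indic//=.
  apply: (@le_trans _ _ (lebesgue_measure (`[a k ord0 J, b k ord0 J]%classic : set R))).
    by apply: le_measure; rewrite ?inE//; exact: measurableI.
  rewrite lebesgue_measure_itv/= lte_fin; case: ifP => //= _.
  by rewrite lee_fin subr_ge0.
have /step := leqnn n.
move=> /(_ (const_mx 0)) /(_ _)/le_trans; apply.
  by move=> i; rewrite !mxE lexx ler01.
apply: lee_nneseries => [k _ _|k _]; rewrite lee_fin//.
by rewrite le_eqVlt; apply/orP; left; apply/eqP; apply: eq_bigr => i _; rewrite ltn_ord.
Qed.

(** Near-optimal closed boxes around the sets of a cover reduce this to [unit_cover_prod], up to
    errors [e / 2^(k+1)] whose sum is at most [e]. *)
Lemma leb_outer_unit_ge1 (R : realType) (n : nat) : (0 < n)%N ->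
  (1 <= leb_outer (cbox (const_mx 0%R : 'rV[R]_n) (const_mx 1%R) : set (rvall R n)))%E.
Proof.
move=> n0; apply: le_ereal_inf_tmp => _ [F [_ XF] <-].
apply/lee_addgt0Pr => /= e e0.
have [->|S0] := eqVneq (\sum_(k <oo) box_content (F k))%E +oo%E; first by rewrite leey.
have Ffin k : (box_content (F k) < +oo)%E.
  rewrite ltNge; apply/negP; rewrite leye_eq => /eqP Fk.
  move/eqP: S0; apply.
  rewrite (nneseriesD1 (n := k))//; last by move=> *; exact: box_content_ge0.
  rewrite Fk addye// gt_eqF//.
  apply: lt_le_trans (nneseries_ge0 _); first by rewrite ltNy0.
  by move=> *; exact: box_content_ge0.
pose P k (p : 'rV[R]_n * 'rV[R]_n) :=
    [/\ forall i, p.1 ord0 i <= p.2 ord0 i, F k `<=` cbox p.1 p.2 &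
    ((\prod_(i < n) (p.2 ord0 i - p.1 ord0 i))%:E <= box_content (F k) + (e / (2 ^ k.+1)%:R)%:E)%E].
have [ab Hab] : {ab : nat -> 'rV[R]_n * 'rV[R]_n & forall k, P k (ab k)}.
  apply: (@choice _ _ P) => k.
  have ek : 0 < e / (2 ^ k.+1)%:R by rewrite divr_gt0// ltr0n expn_gt0.
  have [F0|F0] := eqVneq (F k) set0.
    (* An empty set gets a one-point box, of volume [0] because the product has at least one
       factor. *)
    exists (const_mx 0, const_mx 0); split => //=; first by move=> i; rewrite F0.
    rewrite F0 box_content0 add0e lee_fin (bigD1 (Ordinal n0))//= subrr mul0r; exact: ltW.
  pose S := [set (\prod_(i < n) (p.2 ord0 i - p.1 ord0 i))%:E
    | p in [set p : 'rV[R]_n * 'rV[R]_n | (forall i, p.1 ord0 i <= p.2 ord0 i) /\ F k `<=` cbox p.1 p.2]].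
  have Fk : box_content (F k) = ereal_inf S.
    by rewrite /box_content; case: pselect => [h|?//]; rewrite h eqxx in F0.
  have Sfn : ereal_inf S \is a fin_num by rewrite -Fk ge0_fin_numE// box_content_ge0.
  have [_ [[a b] [/= ab' Fab] <-] /ltW h] := lb_ereal_inf_adherent ek Sfn.
  by exists (a, b); split => //; rewrite Fk.
have := @unit_cover_prod R n (fun k => (ab k).1) (fun k => (ab k).2).
move=> /(_ _ _)/le_trans; apply.
- by move=> k; case: (Hab k).
- by apply: (subset_trans XF) => x [k _ Fx]; exists k => //; case: (Hab k) => _ + _; exact.
apply: (@le_trans _ _ (\sum_(k <oo) (box_content (F k) + (e / (2 ^ k.+1)%:R)%:E))%E).
  apply: lee_nneseries => [k _ _|k _]; last by case: (Hab k).
  by rewrite lee_fin; apply: prodr_ge0 => i _; rewrite subr_ge0; case: (Hab k).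
apply: epsilon_trick; last exact: ltW.
by move=> k; exact: box_content_ge0.
Qed.


Lemma measurable_halfspace_ge (R : realType) (n : nat) (j : 'I_n) (c : R) :
  @measurable _ (Leb R n) [set x : 'rV[R]_n | c <= x ord0 j].
Proof.
rewrite (_ : [set x : 'rV[R]_n | _] =
  ~` \bigcup_k [set x : 'rV[R]_n | x ord0 j <= c - k.+1%:R^-1]).
  apply: (@measurableC _ (Leb R n)); apply: (@bigcupT_measurable _ (Leb R n)) => k.
  exact: measurable_halfspace.
apply/seteqP; split => x /=.
  move=> cx [k _ /= xk]; have : c <= c - k.+1%:R^-1 by exact: le_trans xk.
  by rewrite lerBrDr gerDl leNgt invr_gt0 ltr0Sn.
move=> h; rewrite leNgt; apply/negP => xc; apply: h.
have [k kc] := ltr_add_invr xc.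
by exists k => //=; rewrite lerBrDr ltW.
Qed.

(** * Dyadic cubes and affine maps *)

Lemma measurable_forall_ord (R : realType) (n m : nat) (F : 'I_m -> set 'rV[R]_n) :
  (forall i, @measurable _ (Leb R n) (F i)) ->
  @measurable _ (Leb R n) [set x | forall i, F i x].
Proof.
move=> mF; rewrite (_ : [set x | _] = ~` \bigcup_i ~` F i).
  apply: (@measurableC _ (Leb R n)).
  apply: (@countable_bigcupT_measurable _ (Leb R n)); first exact: countableP.
  by move=> i; apply: (@measurableC _ (Leb R n)).
apply/seteqP; split => x /=; first by move=> h [i _]; apply; exact: h.
by move=> h i; apply: contrapT => nF; apply: h; exists i.
Qed.

Lemma measurable_cbox (R : realType) (n : nat) (a b : 'rV[R]_n) :
  @measurable _ (Leb R n) (cbox a b).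
Proof.
apply: (@measurable_forall_ord _ _ _ (fun i => [set x : 'rV[R]_n | a ord0 i <= x ord0 i <= b ord0 i])) => i.
rewrite (_ : [set _ | _] = [set x : 'rV[R]_n | a ord0 i <= x ord0 i] `&` [set x : 'rV[R]_n | x ord0 i <= b ord0 i]).
  by apply: (@measurableI _ (Leb R n)); [exact: measurable_halfspace_ge|exact: measurable_halfspace].
by apply/seteqP; split => x /=; [move=> /andP|move=> [-> ->]].
Qed.

(** Encoding half-open cubes by floors makes each level a partition of the space, reduces nestedness
    to arithmetic of floors, and indexes all cubes by a countable type. *)
Definition dcube (R : realType) (n : nat) (q : nat * 'rV[int]_n) : set 'rV[R]_n :=
  [set x | forall i, Num.floor (x ord0 i * 2 ^+ q.1) = q.2 ord0 i].

Definition dindex (R : realType) (n : nat) (l : nat) (x : 'rV[R]_n) : nat * 'rV[int]_n :=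
  (l, \row_i Num.floor (x ord0 i * 2 ^+ l)).

Definition dcorner (R : realType) (n : nat) (q : nat * 'rV[int]_n) : 'rV[R]_n :=
  \row_i ((q.2 ord0 i)%:~R / 2 ^+ q.1).

Definition dside (R : realType) (n : nat) (q : nat * 'rV[int]_n) : R := (2 ^+ q.1)^-1.

Definition cube (R : realType) (n : nat) (a : 'rV[R]_n) (r : R) : set 'rV[R]_n :=
  cbox a (\row_i (a ord0 i + r)).

Lemma cubeP (R : realType) (n : nat) (a : 'rV[R]_n) (r : R) x :
  cube a r x <-> forall i, a ord0 i <= x ord0 i <= a ord0 i + r.
Proof. by split => h i; have := h i; rewrite mxE. Qed.

Lemma dside_gt0 (R : realType) (n : nat) q : 0 < @dside R n q.
Proof. by rewrite invr_gt0 exprn_gt0. Qed.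

Lemma dcube_dindex (R : realType) (n : nat) l (x : 'rV[R]_n) : dcube (dindex l x) x.
Proof. by move=> i; rewrite mxE. Qed.

Lemma dcubeP (R : realType) (n : nat) q (x : 'rV[R]_n) :
  dcube q x <-> forall i, dcorner R q ord0 i <= x ord0 i < dcorner R q ord0 i + dside R q.
Proof.
have p0 : (0 : R) < 2 ^+ q.1 by rewrite exprn_gt0.
have e i : dcorner R q ord0 i + dside R q = ((q.2 ord0 i)%:~R + 1) / 2 ^+ q.1.
  by rewrite mxE /dside mulrDl mul1r.
split => h i; have := h i; rewrite e mxE.
  by move=> <-; rewrite ler_pdivrMr// ltr_pdivlMr// -intrD1 floor_itv.
by rewrite ler_pdivrMr// ltr_pdivlMr// -intrD1 => /floor_def.
Qed.

Lemma dcube_sub_cube (R : realType) (n : nat) q :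
  @dcube R n q `<=` cube (dcorner R q) (dside R q).
Proof. by move=> x /dcubeP h; apply/cubeP => i; have /andP[-> /ltW->] := h i. Qed.

Lemma measurable_dcube (R : realType) (n : nat) q : @measurable _ (Leb R n) (dcube q).
Proof.
rewrite (_ : dcube q = [set x | forall i, [set x : 'rV[R]_n | dcorner R q ord0 i <= x ord0 i < dcorner R q ord0 i + dside R q] x]).
  apply: measurable_forall_ord => i.
  rewrite (_ : [set _ | _] = [set x : 'rV[R]_n | dcorner R q ord0 i <= x ord0 i] `\`
     [set x : 'rV[R]_n | dcorner R q ord0 i + dside R q <= x ord0 i]).
    by apply: (@measurableD _ (Leb R n)); exact: measurable_halfspace_ge.
  apply/seteqP; split => x /=; first by move=> /andP[h1 h2]; split => //; apply/negP; rewrite -ltNge.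
  by move=> [-> /negP]; rewrite -ltNge.
by apply/seteqP; split => x /dcubeP.
Qed.

Lemma floor_half (R : realType) (x y : R) : Num.floor (x * 2) = Num.floor (y * 2) -> Num.floor x = Num.floor y.
Proof.
move=> h; apply/esym; apply: floor_def.
have /andP[h4 h3] := floor_itv (y * 2); have /andP[h6 h5] := floor_itv (x * 2).
have /andP[h2 h1] := floor_itv x; rewrite -h in h3 h4.
set a := Num.floor (x * 2) in h3 h4 h5 h6; set b := Num.floor x in h1 h2 *.
rewrite !intrD1 in h1 h3 h5 *.
have h7 : (b * 2 < a + 1)%R by rewrite -(ltr_int R) !intrD rmorphM/=; lra.
have h8 : (a < b * 2 + 2)%R by rewrite -(ltr_int R) !intrD rmorphM/=; lra.
rewrite ltzD1 -(ler_int R) rmorphM/= in h7.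
have {}h8 : (a + 1 <= b * 2 + 2)%R by rewrite lezD1.
rewrite -(ler_int R) !intrD rmorphM/= in h8.
by apply/andP; split; lra.
Qed.

Lemma floor_dyadic (R : realType) (x y : R) (k l : nat) : (k <= l)%N ->
  Num.floor (x * 2 ^+ l) = Num.floor (y * 2 ^+ l) -> Num.floor (x * 2 ^+ k) = Num.floor (y * 2 ^+ k).
Proof.
move=> /subnK <-; elim: (l - k)%N => [//|d IH].
by rewrite addSn exprSr !mulrA => /floor_half.
Qed.

(** The floor at a finer level determines the floor at every coarser one, so dyadic cubes with a
    common point are nested. *)
Lemma dcube_nested (R : realType) (n : nat) (q q' : nat * 'rV[int]_n) (x : 'rV[R]_n) :
  (q.1 <= q'.1)%N -> dcube q x -> dcube q' x -> dcube q' `<=` @dcube R n q.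
Proof.
move=> qq' qx q'x y q'y i; rewrite -(qx i); apply: (floor_dyadic qq').
by rewrite (q'x i) (q'y i).
Qed.

(** The topology of row vectors comes from the sup norm, so balls are coordinatewise conditions. *)
Lemma open_coord (R : realType) (n : nat) (U : set 'rV[R]_n) x : open U -> U x ->
  exists2 e : R, 0 < e & forall y : 'rV[R]_n, (forall i, `|x ord0 i - y ord0 i| < e) -> U y.
Proof.
move=> oU Ux; have /nbhs_ballP[e /= e0 eU] : nbhs x U by exact: open_nbhs_nbhs.
by exists e => // y xy; apply: eU; split => // i j; rewrite (ord1 i); exact: xy.
Qed.

Lemma dside_small (R : realType) (e : R) : 0 < e -> exists l : nat, (2 ^+ l)^-1 < e.
Proof.
move=> e0; have [k] := ltr_add_invr e0; rewrite add0r => ke; exists k.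
apply: le_lt_trans ke; rewrite lef_pV2 ?posrE ?exprn_gt0//.
by rewrite -natrX ler_nat; elim: k => // k IH; rewrite expnS mul2n -addnn; apply: (@leq_trans (2 ^ k + 1)); rewrite ?addn1// -addn1 leq_add2l expn_gt0.
Qed.

Lemma dcube_dist (R : realType) (n : nat) q (x y : 'rV[R]_n) : dcube q x -> dcube q y ->
  forall i, `|x ord0 i - y ord0 i| < dside R q.
Proof.
move=> /dcubeP hx /dcubeP hy i; have /andP[h1 h2] := hx i; have /andP[h3 h4] := hy i.
by rewrite ltr_norml; apply/andP; split; lra.
Qed.

Lemma open_dcubes (R : realType) (n : nat) (U : set 'rV[R]_n) : open U ->
  U = \bigcup_(q in [set q | dcube q `<=` U]) dcube q.
Proof.
move=> oU; apply/seteqP; split => x; last by move=> [q /= qU /qU].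
move=> Ux; have [e e0 eU] := open_coord oU Ux.
have [l le] := dside_small e0.
exists (dindex l x); last exact: dcube_dindex.
move=> y xy; apply: eU => i; apply: (lt_trans _ le).
exact: (dcube_dist (dcube_dindex l x) xy).
Qed.

Lemma measurable_open (R : realType) (n : nat) (U : set 'rV[R]_n) : open U -> @measurable _ (Leb R n) U.
Proof.
move=> oU; rewrite (open_dcubes oU) bigcup_mkcond.
apply: (@countable_bigcupT_measurable _ (Leb R n)); first exact: countableP.
by move=> q; case: ifP => _; [exact: measurable_dcube|exact: (@measurable0 _ (Leb R n))].
Qed.

Lemma measurable_continuous (R : realType) (n : nat) (f : 'rV[R]_n -> R) (D : set 'rV[R]_n) :
  continuous f -> lmeasurable_fun D f.
Proof.
move=> cf; apply: (@measurable_funTS _ _ (Leb R n)).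
apply: (measurability _ (RGenOInfty.measurableE R)).
move=> _ [_ [a ->] <-]; rewrite setTI.
apply: measurable_open; move/continuousP: cf; apply.
exact: interval_open.
Qed.

(** * Scaling of the outer measure and of integrals under affine maps *)

Definition affmap (R : realType) (n : nat) (a : R) (b x : 'rV[R]_n) : 'rV[R]_n := a *: x + b.

Lemma box_content_scale_le (R : realType) (n : nat) (a : R) (b : 'rV[R]_n) (S : set (rvall R n)) :
  0 < a -> (box_content (affmap a b @^-1` (S : set 'rV[R]_n)) <= ((a^-1) ^+ n)%:E * box_content S)%E.
Proof.
move=> a0; have c0 : 0 < a^-1 ^+ n by rewrite exprn_gt0 ?invr_gt0.
have [->|S0] := eqVneq S set0.
  by rewrite preimage_set0 box_content0 mule0.
rewrite -lee_pdivrMl// [leRHS]/box_content.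
case: pselect => [h|?]; first by rewrite h eqxx in S0.
apply: le_ereal_inf_tmp => _ [[p r] [/= pr Spr] <-].
rewrite lee_pdivrMl//.
pose p' : 'rV[R]_n := a^-1 *: (p - b); pose r' : 'rV[R]_n := a^-1 *: (r - b).
have -> : (((a^-1 ^+ n)%:E * (\prod_(i < n) (r ord0 i - p ord0 i))%:E)%E =
  (\prod_(i < n) (r' ord0 i - p' ord0 i))%:E).
  rewrite -EFinM; congr EFin.
  rewrite -[n in a^-1 ^+ n]card_ord -prodr_const -big_split/=; apply: eq_bigr => i _.
  by rewrite !mxE; ring.
apply: box_content_le.
  by move=> i; rewrite !mxE ler_pM2l ?invr_gt0// lerD2r.
move=> x /= Sx i; have := Spr _ Sx i; rewrite !mxE ler_pdivrMl// ler_pdivlMl//.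
by rewrite lerBlDr lerBrDr.
Qed.

Lemma leb_outer_scale_le (R : realType) (n : nat) (a : R) (b : 'rV[R]_n) (E : set (rvall R n)) :
  0 < a -> (leb_outer (affmap a b @^-1` (E : set 'rV[R]_n)) <= ((a^-1) ^+ n)%:E * leb_outer E)%E.
Proof.
move=> a0; have c0 : 0 < a^-1 ^+ n by rewrite exprn_gt0 ?invr_gt0.
rewrite -lee_pdivrMl//; apply: le_ereal_inf_tmp => _ [F [_ EF] <-].
rewrite lee_pdivrMl// -nneseriesZl; last by move=> *; exact: box_content_ge0.
apply: (@le_trans _ _ (\sum_(k <oo) box_content (affmap a b @^-1` (F k : set 'rV[R]_n)))%E).
  by apply: leb_outer_lt_cover => x /EF[k _ Fk]; exists k.
by apply: lee_nneseries => *; [exact: box_content_ge0|exact: box_content_scale_le].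
Qed.

(** The reverse inequality is [leb_outer_scale_le] for the inverse map. *)
Lemma leb_outer_scale (R : realType) (n : nat) (a : R) (b : 'rV[R]_n) (E : set (rvall R n)) :
  0 < a -> (leb_outer (affmap a b @^-1` (E : set 'rV[R]_n)) = ((a^-1) ^+ n)%:E * leb_outer E)%E.
Proof.
move=> a0; apply/eqP; rewrite eq_le leb_outer_scale_le//=.
rewrite -lee_pdivlMl ?exprn_gt0 ?invr_gt0//.
have a'0 : 0 < a^-1 by rewrite invr_gt0.
have := leb_outer_scale_le (- (a^-1 *: b)) (affmap a b @^-1` (E : set 'rV[R]_n)) a'0.
rewrite invrK exprVn invrK (_ : _ @^-1` _ = E)//.
apply/seteqP; split => x; rewrite /preimage/= /affmap scalerDr scalerN !scalerA divff ?gt_eqF// !scale1r subrK//.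
Qed.

(** Every test set is the preimage of a set [Y], so the Caratheodory identity for the preimage of
    [E] is the one for [E] tested on [Y], multiplied by the scaling factor. *)
Lemma measurable_affine (R : realType) (n : nat) (a : R) (b : 'rV[R]_n) :
  0 < a -> @measurable_fun _ _ (Leb R n) (Leb R n) setT (affmap a b).
Proof.
move=> a0 _ E mE; rewrite setTI.
suff : (@leb_outer R n).-caratheodory (affmap a b @^-1` (E : set 'rV[R]_n)) by [].
move=> X.
have {}mE : (@leb_outer R n).-caratheodory E := mE.
have a'0 : 0 < a^-1 by rewrite invr_gt0.
pose Y : set (rvall R n) := affmap a^-1 (- (a^-1 *: b)) @^-1` (X : set 'rV[R]_n).
have e (Z : set (rvall R n)) : X `&` (affmap a b @^-1` (Z : set 'rV[R]_n)) =
   affmap a b @^-1` (Y `&` Z : set 'rV[R]_n).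
  apply/seteqP; split => x /=; rewrite /Y/= /affmap scalerDr !scalerA mulVf ?gt_eqF// !scale1r addrK//.
have -> : X = affmap a b @^-1` (Y : set 'rV[R]_n).
  by rewrite -[in RHS](setIT Y) -e preimage_setT setIT.
clearbody Y.
have := leb_outer_scale b Y a0.
have := leb_outer_scale b (Y `&` E) a0.
have := leb_outer_scale b (Y `&` ~` E) a0.
rewrite (mE Y) => h1 h2 h3.
have g0 (Z : set (rvall R n)) : (0 <= leb_outer Z)%E by exact: (outer_measure_ge0 (@leb_outer R n)).
have h4 := ge0_muleDr (a^-1 ^+ n)%:E (g0 (Y `&` E)) (g0 (Y `&` ~` E)).
by apply: (eq_trans h3); rewrite h4 -h1 -h2.
Qed.

(** The pushforward of Lebesgue measure under the map is Lebesgue measure multiplied by [a^-n]. *)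
Lemma integral_affine (R : realType) (n : nat) (a : R) (b : 'rV[R]_n) (f : 'rV[R]_n -> R) :
  0 < a -> lmeasurable_fun setT f -> (forall x, 0 <= f x) ->
  lint setT (fun x => (f (affmap a b x))%:E) = (((a^-1) ^+ n)%:E * lint setT (fun x => (f x)%:E))%E.
Proof.
move=> a0 mf f0.
have mT := measurable_affine b a0.
have c0 : 0 <= a^-1 ^+ n by rewrite exprn_ge0// invr_ge0 ltW.
have mf' : @measurable_fun _ _ (Leb R n) _ setT (EFin \o f) by apply/measurable_EFinP.
transitivity (\int[pushforward (@lebesgue_n R n) (affmap a b : Leb R n -> Leb R n)]_(x in (setT : set (Leb R n))) (f x)%:E)%E.
  by rewrite (ge0_integral_pushforward mT)//= => y _; rewrite lee_fin.
transitivity (\int[mscale (NngNum c0) (@lebesgue_n R n)]_(x in (setT : set (Leb R n))) (f x)%:E)%E.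
  by apply: eq_measure_integral => A mA _; rewrite /pushforward/= /mscale/=; exact: leb_outer_scale.
by rewrite ge0_integral_mscale//= => x _; rewrite lee_fin.
Qed.

(** * Smooth steps and tensor products *)

(** All test functions below are products of functions of one coordinate, so smoothness in several
    variables is reduced to this one-variable notion. *)
Fixpoint Cdiff (R : realType) (k : nat) (f : R -> R) : Prop :=
  if k is k'.+1 then (forall x, derivable f x 1) /\ Cdiff k' (derive1 f) else True.

Definition smooth1 (R : realType) (f : R -> R) : Prop := forall k, Cdiff k f.

Section smooth1.
Context {R : realType}.
Implicit Types (f g : R -> R) (k : nat).

Lemma CdiffS k f f' : (forall x : R, is_derive x 1 f (f' x)) -> Cdiff k f' -> Cdiff k.+1 f.
Proof.
move=> ff' kf'; split => [x|]; first by have [] := ff' x.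
by rewrite (_ : (derive1 f) = f')//; apply/funext => x; rewrite derive1E; have [] := ff' x.
Qed.

Lemma Cdiff_derive k f : Cdiff k.+1 f -> forall x : R, is_derive x 1 f ((derive1 f) x).
Proof. by move=> [df _] x; rewrite derive1E; exact: derivableP. Qed.

Lemma CdiffW k f : Cdiff k.+1 f -> Cdiff k f.
Proof. by elim: k f => [//|k IH] f [df kf]; split => //; exact: IH. Qed.

Lemma Cdiff_cst k (c : R) : Cdiff k (fun=> c).
Proof.
elim: k c => [//|k IH] c; apply: (@CdiffS _ _ (fun=> 0)); last exact: IH.
Qed.

Lemma CdiffD k f g : Cdiff k f -> Cdiff k g -> Cdiff k (fun x => f x + g x).
Proof.
elim: k f g => [//|k IH] f g kf kg.
apply: (@CdiffS _ _ (fun x => (derive1 f) x + (derive1 g) x)) => [x|].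
  exact: is_deriveD (Cdiff_derive kf x) (Cdiff_derive kg x).
by apply: IH; [case: kf|case: kg].
Qed.

Lemma CdiffM k f g : Cdiff k f -> Cdiff k g -> Cdiff k (fun x => f x * g x).
Proof.
elim: k f g => [//|k IH] f g kf kg.
apply: (@CdiffS _ _ (fun x => f x * (derive1 g) x + g x * (derive1 f) x)) => [x|].
  exact: is_deriveM (Cdiff_derive kf x) (Cdiff_derive kg x).
by apply: CdiffD; apply: IH; (try exact: CdiffW); [case: kg|case: kf].
Qed.

Lemma Cdiff_affine k f (c d : R) : Cdiff k f -> Cdiff k (fun x => f (c * x + d)).
Proof.
elim: k f => [//|k IH] f kf.
apply: (@CdiffS _ _ (fun x => c * (derive1 f) (c * x + d))) => [x|].
  have h : is_derive (c * x + d) 1 f ((derive1 f) (c * x + d)) by exact: (Cdiff_derive kf).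
  have h2 : is_derive x 1 (fun x => c * x + d) c.
    apply: (is_derive_eq (is_deriveD (is_deriveZ c (is_derive_id x 1)) (is_derive_cst d x 1))).
    by rewrite addr0 /GRing.scale/= mulr1.
  by rewrite mulrC; exact: (@is_derive1_comp _ f (fun x => c * x + d) x _ _ h h2).
by apply: CdiffM; [exact: Cdiff_cst|apply: IH; case: kf].
Qed.

Lemma CdiffV k f : (forall x, f x != 0) -> Cdiff k f -> Cdiff k (fun x => (f x)^-1).
Proof.
move=> f0; elim: k => [//|k IH] kf.
apply: (@CdiffS _ _ (fun x => - 1 * (f x)^-1 * (f x)^-1 * (derive1 f) x)) => [x|].
  have h := Cdiff_derive kf x.
  apply: (is_derive_eq (is_deriveV (f0 x) h)).
  by rewrite /GRing.scale/= -exprVn expr2; ring.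
apply: CdiffM; last by case: kf.
by apply: CdiffM; [apply: CdiffM; [exact: Cdiff_cst|]|]; apply: IH; exact: CdiffW.
Qed.

Lemma smooth1D f g : smooth1 f -> smooth1 g -> smooth1 (fun x => f x + g x).
Proof. by move=> sf sg k; exact: CdiffD. Qed.

Lemma smooth1M f g : smooth1 f -> smooth1 g -> smooth1 (fun x => f x * g x).
Proof. by move=> sf sg k; exact: CdiffM. Qed.

Lemma smooth1_derive f : smooth1 f -> smooth1 (derive1 f).
Proof. by move=> sf k; have [] := sf k.+1. Qed.

Lemma smooth1_is_derive f : smooth1 f -> forall x : R, is_derive x 1 f ((derive1 f) x).
Proof. by move=> sf; exact: Cdiff_derive (sf 1%N). Qed.

Lemma smooth1_continuous f : smooth1 f -> continuous f.
Proof.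
move=> sf x; apply: differentiable_continuous; apply/derivable1_diffP.
by have [] := sf 1%N.
Qed.

Lemma expR_poly_bounded (p : {poly R}) : exists2 C : R, 0 <= C &
  forall y : R, 0 <= y -> `|p.[y] * expR (- y)| <= C.
Proof.
have mono k : exists2 C : R, 0 <= C & forall y : R, 0 <= y -> y ^+ k * expR (- y) <= C.
  case: k => [|k].
    exists 1 => // y y0; rewrite expr0 mul1r -expR0 ler_expR; lra.
  (* The constant comes from [y / (k+1) <= exp (y / (k+1))], raised to the power [k+1]. *)
  exists (k.+1%:R ^+ k.+1); first by rewrite exprn_ge0.
  move=> y y0; have k0 : (0 : R) < k.+1%:R by [].
  have -> : expR (- y) = expR (- (y / k.+1%:R)) ^+ k.+1.
    by rewrite -expRM_natl; congr expR; rewrite mulrN mulrCA divff ?mulr1// gt_eqF.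
  rewrite -exprMn; apply: lerXn2r; rewrite ?nnegrE ?mulr_ge0 ?expR_ge0//.
  rewrite expRN -ler_pdivlMr ?invr_gt0 ?expR_gt0// invrK.
  rewrite -ler_pdivrMl// mulrC; apply: le_trans (expR_ge1Dx _); exact: ltW (ltr_pwDl ltr01 (lexx _)).
have /choice[C CP] : forall k, exists C : R, 0 <= C /\ forall y : R, 0 <= y -> y ^+ k * expR (- y) <= C.
  by move=> k; have [C C0 h] := mono k; exists C.
exists (\sum_(i < size p) `|p`_i| * C i).
  by apply: sumr_ge0 => i _; rewrite mulr_ge0//; case: (CP i).
move=> y y0; rewrite horner_coef mulr_suml; apply: (le_trans (ler_norm_sum _ _ _)).
apply: ler_sum => i _; rewrite -mulrA normrM ler_wpM2l//.
by rewrite ger0_norm ?mulr_ge0 ?exprn_ge0 ?expR_ge0//; case: (CP i) => _; exact.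
Qed.

(** The functions [p(1/x) exp(-1/x)], extended by [0]. The polynomial parameter makes the family
    closed under differentiation, so smoothness follows by induction. *)
Definition flat (p : {poly R}) (x : R) : R := if 0 < x then p.[x^-1] * expR (- x^-1) else 0.

Lemma flat_le0 p x : x <= 0 -> flat p x = 0.
Proof. by rewrite /flat leNgt => /negbTE ->. Qed.

Lemma is_derive_flat (p : {poly R}) (x : R) : is_derive x 1 (flat p) (flat ('X^2 * (p - p^`())) x).
Proof.
have [x0|x0|x0] := ltrgt0P x.
- have h : is_derive x 1 (fun x : R => p.[x^-1] * expR (- x^-1)) (flat ('X^2 * (p - p^`())) x).
    have hV : is_derive x 1 (fun x : R => x^-1) (- x ^- 2).
      apply: (is_derive_eq (is_deriveV (lt0r_neq0 x0) (is_derive_id x 1))).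
      by rewrite /GRing.scale/= mulr1.
    have h1 : is_derive x 1 (fun x : R => p.[x^-1]) (p^`().[x^-1] * - x ^- 2).
      exact: (@is_derive1_comp _ _ _ _ _ _ (is_derive_poly p x^-1) hV).
    have h2 : is_derive x 1 (fun x : R => expR (- x^-1)) (expR (- x^-1) * x ^- 2).
      have hN : is_derive x 1 (fun x : R => - x^-1) (x ^- 2).
        by apply: (is_derive_eq (is_deriveN hV)); rewrite opprK.
      exact: (@is_derive1_comp _ _ _ _ _ _ (is_derive_expR _) hN).
    apply: (is_derive_eq (is_deriveM h1 h2)).
    by rewrite /flat x0 !hornerE /GRing.scale/= -exprVn; ring.
  apply: near_eq_is_derive h; near=> y; rewrite /flat.
  by have -> : 0 < y by near: y; exact: lt_nbhsr.
- rewrite flat_le0 ?ltW//; have h := is_derive_cst (0 : R) x (1 : R).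
  apply: near_eq_is_derive h; near=> y; rewrite /flat /cst.
  have : y < 0 by near: y; exact: lt_nbhsl.
  by move=> /ltW; rewrite leNgt => /negbTE ->.
rewrite x0 flat_le0//.
(* At [0] the difference quotient equals [h] times the bounded quantity [('X^2 * p)(1/h) exp(-1/h)],
   hence tends to [0]. *)
have [C C0 hC] := expR_poly_bounded ('X^2 * p).
suff H : (fun h : R => h^-1 *: ((flat p \o shift 0) (h *: (1 : R)) - flat p 0)) @ 0^' --> (0 : R).
  by apply: DeriveDef; [apply/cvg_ex; exists 0|exact/cvg_lim].
apply/cvgr0Pnorm_le => e e0.
near=> h; rewrite /= [flat p 0]flat_le0// subr0 addr0 /GRing.scale/= mulr1 /flat.
case: ifPn => h0; last by rewrite mulr0 normr0 ltW.
have -> : h^-1 * (p.[h^-1] * expR (- h^-1)) = h * (('X^2 * p).[h^-1] * expR (- h^-1)).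
  rewrite hornerM hornerXn !mulrA; congr (_ * _ * _).
  by rewrite divff ?mul1r// gt_eqF.
rewrite normrM; apply: (@le_trans _ _ (`|h| * (C + 1))).
  by rewrite ler_wpM2l//; apply: (le_trans (hC _ _)); [rewrite invr_ge0 ltW|rewrite lerDl].
rewrite -ler_pdivlMr; last by rewrite ltr_pwDr.
near: h; apply: dnbhs0_le; by rewrite divr_gt0// ltr_pwDr.
Unshelve. all: by end_near. Qed.

Lemma smooth1_flat p : smooth1 (flat p).
Proof.
move=> k; elim: k p => [//|k IH] p.
exact: CdiffS (is_derive_flat p) (IH _).
Qed.

Definition stepden (x : R) : R := flat 1 x + flat 1 (1 - x).

(** The standard smooth transition from [0] on the negative axis to [1] beyond [1]; its derivative
    [stepH] is the one-variable bump on [[0, 1]]. *)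
Definition stepP (x : R) : R := flat 1 x * (stepden x)^-1.

Definition stepH (x : R) : R := derive1 stepP x.

Lemma flat1_gt0 x : 0 < x -> 0 < flat 1 x.
Proof. by move=> x0; rewrite /flat x0 hornerE mul1r expR_gt0. Qed.

Lemma flat1_ge0 x : 0 <= flat 1 x.
Proof. by have [/flat1_gt0/ltW//|x0] := ltP 0 x; rewrite flat_le0. Qed.

Lemma flatX2_ge0 x : 0 <= flat ('X^2 * (1 - 1^`())) x.
Proof.
rewrite /flat; case: ifP => // x0; rewrite -polyC1 derivC subr0 polyC1 mulr1 hornerXn.
by rewrite mulr_ge0 ?expR_ge0 ?exprn_ge0// invr_ge0 ltW.
Qed.

Lemma stepden_gt0 x : 0 < stepden x.
Proof.
have [x0|x0] := ltP 0 x; first by rewrite ltr_pwDl ?flat1_gt0 ?flat1_ge0.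
by rewrite ltr_wpDl ?flat1_gt0 ?flat1_ge0// subr_gt0 (le_lt_trans x0).
Qed.

Lemma smooth1_stepP : smooth1 stepP.
Proof.
apply: smooth1M; first exact: smooth1_flat.
move=> k; apply: CdiffV; first by move=> x; rewrite gt_eqF// stepden_gt0.
apply: CdiffD; first exact: smooth1_flat.
rewrite (_ : (fun x => _) = (fun x => flat 1 (-1 * x + 1))); first by apply: Cdiff_affine; exact: smooth1_flat.
by apply/funext => x; rewrite mulN1r addrC.
Qed.

Lemma stepP_le0 x : x <= 0 -> stepP x = 0.
Proof. by move=> x0; rewrite /stepP flat_le0// mul0r. Qed.

Lemma stepP_ge1 x : 1 <= x -> stepP x = 1.
Proof.
move=> x1; rewrite /stepP /stepden [X in _ + X]flat_le0 ?subr_le0// addr0 divff// gt_eqF//.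
by apply: flat1_gt0; exact: lt_le_trans x1.
Qed.

Lemma stepP_itv x : 0 <= stepP x <= 1.
Proof.
have /ltW d0 := stepden_gt0 x; rewrite /stepP mulr_ge0 ?flat1_ge0 ?invr_ge0//=.
by rewrite ler_pdivrMr ?stepden_gt0// mul1r lerDl flat1_ge0.
Qed.

Lemma is_derive_stepP (x : R) : is_derive x 1 stepP (stepH x).
Proof. exact: smooth1_is_derive smooth1_stepP x. Qed.

Lemma stepHE x : stepH x =
  (flat ('X^2 * (1 - 1^`())) x * flat 1 (1 - x) + flat 1 x * flat ('X^2 * (1 - 1^`())) (1 - x)) / stepden x ^+ 2.
Proof.
have h1 := is_derive_flat 1 x.
have hB : is_derive x 1 (fun x : R => 1 - x) (-1).
  by have := is_deriveB (is_derive_cst (1 : R) x 1) (is_derive_id x (1 : R)); rewrite sub0r.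
have h2 := @is_derive1_comp _ _ (fun x => 1 - x) x _ _ (is_derive_flat 1 (1 - x)) hB.
have h3 := is_deriveD h1 h2.
have d0 : (flat 1 + (flat 1 \o (fun x : R => 1 - x))) x != 0 by rewrite gt_eqF// stepden_gt0.
have h4 := is_deriveM h1 (is_deriveV d0 h3).
rewrite /stepH derive1E.
transitivity ('D_1 (flat 1 * (fun y => ((flat 1 + (flat 1 \o (fun x : R => 1 - x))) y)^-1)) x); first by [].
rewrite (derive_val (is_derive := h4)) /GRing.scale/= /stepden /= .
have := stepden_gt0 x; rewrite /stepden => /lt0r_neq0 dx.
rewrite !fctE/= in d0 *; field; exact: dx.
Qed.

Lemma stepH_ge0 x : 0 <= stepH x.
Proof.
have /ltW d0 := stepden_gt0 x; rewrite stepHE mulr_ge0 ?invr_ge0 ?exprn_ge0//.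
by rewrite addr_ge0// mulr_ge0 ?flat1_ge0 ?flatX2_ge0.
Qed.

Lemma stepH_half : 0 < stepH (2^-1).
Proof.
rewrite stepHE mulr_gt0 ?invr_gt0 ?exprn_gt0 ?stepden_gt0//.
have h : 0 < 2^-1 :> R by rewrite invr_gt0.
have -> : 1 - 2^-1 = 2^-1 :> R by lra.
have fx : 0 < flat ('X^2 * (1 - 1^`())) (2^-1 : R).
  rewrite /flat h -polyC1 derivC subr0 polyC1 mulr1 hornerXn.
  by rewrite mulr_gt0 ?expR_gt0// exprn_gt0// invr_gt0.
by rewrite addr_gt0// mulr_gt0// flat1_gt0.
Qed.

Lemma stepH_out x : ~~ (0 <= x <= 1) -> stepH x = 0.
Proof.
rewrite stepHE; have [x0|x0 /=] := ltP x 0.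
  by move: x0 => /ltW x0 _; rewrite !(@flat_le0 _ x)// !mul0r addr0 mul0r.
rewrite -ltNge => x1; have h : 1 - x <= 0 by rewrite subr_le0 ltW.
by rewrite !(@flat_le0 _ (1 - x))// !mulr0 addr0 mul0r.
Qed.

Lemma smooth1_stepH : smooth1 stepH.
Proof. exact: smooth1_derive smooth1_stepP. Qed.

Lemma stepH_bounded : exists2 H : R, 1 <= H & forall x, stepH x <= H.
Proof.
have cH : {within `[0, 1]%classic, continuous stepH}.
  by apply: continuous_subspaceT; exact: smooth1_continuous smooth1_stepH.
have [c _ hc] := EVT_max ler01 cH.
exists (1 + stepH c); first by rewrite lerDl stepH_ge0.
move=> x; have [x01|x01] := boolP (0 <= x <= 1).
  by apply: (le_trans (hc x _)); rewrite ?in_itv// lerDr.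
by rewrite stepH_out// addr_ge0// stepH_ge0.
Qed.
Lemma smooth1_affine f (c d : R) : smooth1 f -> smooth1 (fun x => f (c * x + d)).
Proof. by move=> sf k; exact: Cdiff_affine. Qed.

Lemma smooth1_cst (c : R) : smooth1 (fun=> c).
Proof. by move=> k; exact: Cdiff_cst. Qed.
End smooth1.

Definition tens (R : realType) (n : nat) (p : 'I_n -> R -> R) (z : 'rV[R]_n) : R :=
  \prod_(i < n) p i (z ord0 i).

Lemma differentiable_tens (R : realType) (n : nat) (p : 'I_n -> R -> R) :
  (forall i, smooth1 (p i)) -> forall z, differentiable (tens p) z.
Proof.
move=> sp z; rewrite /tens; elim: (index_enum _) => [|i s IH].
  rewrite (_ : (fun _ => _) = cst 1); first exact: differentiable_cst.
  by apply/funext => y; rewrite big_nil.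
rewrite (_ : (fun _ => _) = (fun y : 'rV[R]_n => p i (y ord0 i)) * (fun y : 'rV[R]_n => \prod_(j <- s) p j (y ord0 j))).
  apply: differentiableM => //.
  apply: (@differentiable_comp _ _ _ _ (fun y : 'rV[R]_n => y ord0 i) (p i)).
    exact: differentiable_coord.
  by apply/derivable1_diffP; have [] := sp i 1%N.
by apply/funext => y; rewrite big_cons.
Qed.

(** Along the [j]-th axis every factor but the [j]-th is constant. *)
Lemma derive_tens (R : realType) (n : nat) (p : 'I_n -> R -> R) j :
  (forall i, smooth1 (p i)) ->
  'D_(evec R j) (tens p) = tens (fun i => if i == j then derive1 (p i) else p i).
Proof.
move=> sp; apply/funext => z.
pose c := \prod_(i < n | i != j) p i (z ord0 i).
transitivity ('D_1 (fun t => c * p j t) (z ord0 j)).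
  have e t : tens p (t *: evec R j + z) = c * p j (t + z ord0 j).
    rewrite /tens (bigD1 j)//= mulrC; congr (_ * _).
      by apply: eq_bigr => i /negbTE ij; rewrite !mxE ij andbF mulr0 add0r.
    by rewrite !mxE !eqxx mulr1.
  have e0 : tens p z = c * p j (z ord0 j) by have := e 0; rewrite scale0r !add0r.
  rewrite /derive; set F := (fun h : R => _); set G := (fun h : R => _ *: (((fun t : R => _) \o _) _ - _)).
  suff -> : F = G by [].
  by apply/funext => h; rewrite /F /G/= e e0 /GRing.scale/= mulr1.
have h := is_deriveZ c (smooth1_is_derive (sp j) (z ord0 j)).
rewrite (derive_val (is_derive := h)) /GRing.scale/= /tens [RHS](bigD1 j)//= eqxx mulrC; congr (_ * _).
by apply: eq_bigr => i /negbTE ->.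
Qed.

(** Partial derivatives of tensor products are again tensor products of smooth factors, so induction
    on the list of directions applies. *)
Lemma smooth_tens (R : realType) (n : nat) (p : 'I_n -> R -> R) :
  (forall i, smooth1 (p i)) -> smooth (tens p).
Proof.
move=> sp js.
suff [p' sp' ->] : exists2 p' : 'I_n -> R -> R, forall i, smooth1 (p' i) & Defs.iterD js (tens p) = tens p'.
  by move=> z; exact: differentiable_tens.
elim: js => [|j js [p' sp' IH]]; first by exists p.
rewrite /= IH derive_tens//.
exists (fun i => if i == j then derive1 (p' i) else p' i) => // i.
by case: eqP => // _; exact: smooth1_derive.
Qed.

(** * Bumps whose difference is a divergence *)

Section bump.
Context {R : realType} {n : nat}.
Implicit Types (a : 'rV[R]_n) (r : R).

(** The primitive of [cutH] that is [0] before the [l]-th side of the cube and [1] after it. Two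
    such primitives agree outside both sides, so their difference has compact support. *)
Definition cutP a r (l : 'I_n) (t : R) : R := stepP (r^-1 * t + - (r^-1 * a ord0 l)).

Definition cutH a r (l : 'I_n) (t : R) : R := r^-1 * stepH (r^-1 * t + - (r^-1 * a ord0 l)).

Definition tbump a r : 'rV[R]_n -> R := tens (cutH a r).

Lemma smooth1_cutP a r l : smooth1 (cutP a r l).
Proof. by apply: smooth1_affine; exact: smooth1_stepP. Qed.

Lemma smooth1_cutH a r l : smooth1 (cutH a r l).
Proof.
apply: smooth1M; first exact: smooth1_cst.
by apply: smooth1_affine; exact: smooth1_stepH.
Qed.

Lemma derive_cutP a r l : derive1 (cutP a r l) = cutH a r l.
Proof.
apply/funext => t; rewrite derive1E.
have h1 : is_derive t 1 (fun t : R => r^-1 * t + - (r^-1 * a ord0 l)) r^-1.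
  have := is_deriveD (is_deriveZ r^-1 (is_derive_id t (1 : R))) (is_derive_cst (- (r^-1 * a ord0 l)) t 1).
  by rewrite addr0 /GRing.scale/= mulr1.
have h := @is_derive1_comp _ _ (fun t => r^-1 * t + - (r^-1 * a ord0 l)) t _ _ (is_derive_stepP _) h1.
by rewrite (derive_val (is_derive := h)) mulrC.
Qed.

Lemma cut_argE a r l t : r^-1 * t + - (r^-1 * a ord0 l) = (t - a ord0 l) / r.
Proof. by rewrite -mulrBr mulrC. Qed.

Lemma cutH_ge0 a r l t : 0 < r -> 0 <= cutH a r l t.
Proof. by move=> r0; rewrite mulr_ge0 ?stepH_ge0// invr_ge0 ltW. Qed.

Lemma cutH_out a r l t : 0 < r -> ~~ (a ord0 l <= t <= a ord0 l + r) -> cutH a r l t = 0.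
Proof.
move=> r0 h; rewrite /cutH stepH_out ?mulr0// cut_argE; apply: contra h.
by rewrite ler_pdivlMr// mul0r ler_pdivrMr// mul1r subr_ge0 lerBlDl.
Qed.

Lemma cutP_le a r l t : 0 < r -> t <= a ord0 l -> cutP a r l t = 0.
Proof. by move=> r0 h; rewrite /cutP stepP_le0// cut_argE ler_pdivrMr// mul0r subr_le0. Qed.

Lemma cutP_ge a r l t : 0 < r -> a ord0 l + r <= t -> cutP a r l t = 1.
Proof. by move=> r0 h; rewrite /cutP stepP_ge1// cut_argE ler_pdivlMr// mul1r lerBrDl. Qed.

Lemma cutP_itv a r l t : 0 <= cutP a r l t <= 1.
Proof. exact: stepP_itv. Qed.

Lemma tens_out (p : 'I_n -> R -> R) (z : 'rV[R]_n) l : p l (z ord0 l) = 0 -> tens p z = 0.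
Proof. by move=> pl; rewrite /tens (bigD1 l)//= pl mul0r. Qed.

Lemma tbump_out a r z : 0 < r -> ~ cube a r z -> tbump a r z = 0.
Proof.
move=> r0 /cubeP/existsNP[l /negP h].
by apply: (@tens_out _ _ l); exact: cutH_out.
Qed.

Lemma tbump_ge0 a r z : 0 < r -> 0 <= tbump a r z.
Proof. by move=> r0; apply: prodr_ge0 => i _; exact: cutH_ge0. Qed.

Lemma tbump_scale a r z : 0 < r ->
  tbump a r z = r^-1 ^+ n * tbump 0 1 (affmap r^-1 (- (r^-1 *: a)) z).
Proof.
move=> r0; rewrite /tbump /tens -[n in r^-1 ^+ n]card_ord -prodr_const -big_split/=.
apply: eq_bigr => i _; rewrite /cutH /affmap !mxE invr1 !mul1r oppr0 addr0//.
Qed.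

(* Interpolating one coordinate at a time from the tbump on (a, r) to the tbump on (b, s): the
   divergence of this field telescopes to the difference of the two bumps. *)
Definition vfield a r b (s : R) (j : 'I_n) : 'rV[R]_n -> R :=
  tens (fun l => if (l < j)%N then cutH b s l
                 else if l == j then (fun t => cutP b s l t + - 1 * cutP a r l t) else cutH a r l).

Lemma smooth1_vfield a r b (s : R) (j l : 'I_n) :
  smooth1 (if (l < j)%N then cutH b s l
                 else if l == j then (fun t => cutP b s l t + - 1 * cutP a r l t) else cutH a r l).
Proof.
case: ifP => _; first exact: smooth1_cutH.
case: eqP => _; last exact: smooth1_cutH.
apply: smooth1D; first exact: smooth1_cutP.
by apply: smooth1M; [exact: smooth1_cst|exact: smooth1_cutP].
Qed.

Lemma derive_vfield a r b (s : R) (j : 'I_n) :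
  'D_(evec R j) (vfield a r b s j) =
  tens (fun i => if i == j then derive1 (if (i < j)%N then cutH b s i
                 else if i == j then (fun t => cutP b s i t + - 1 * cutP a r i t) else cutH a r i)
    else (if (i < j)%N then cutH b s i
                 else if i == j then (fun t => cutP b s i t + - 1 * cutP a r i t) else cutH a r i)).
Proof. by apply: derive_tens => l; exact: smooth1_vfield. Qed.

Lemma div_vfield a r b (s : R) z :
  \sum_(j < n) 'D_(evec R j) (vfield a r b s j) z = tbump b s z - tbump a r z.
Proof.
(* [T j] uses the bump on [(b, s)] in the first [j] coordinates and the bump on [(a, r)] in the
   others; the [j]-th partial derivative equals [T (j+1) - T j]. *)
pose T j := \prod_(l < n) (if (l < j)%N then cutH b s l (z ord0 l) else cutH a r l (z ord0 l)).
have -> : tbump b s z - tbump a r z = T n - T 0%N.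
  by congr (_ - _); apply: eq_bigr => l _; rewrite ?ltn_ord.
rewrite -(telescope_sumr T (leq0n n)) big_mkord; apply: eq_bigr => j _.
have -> := congr1 (fun F => F z) (derive_vfield a r b s j).
rewrite /tens (bigD1 j)//= ltnn eqxx.
have -> : derive1 (fun t => cutP b s j t + -1 * cutP a r j t) (z ord0 j) =
  cutH b s j (z ord0 j) - cutH a r j (z ord0 j).
  rewrite derive1E.
  have h1 := smooth1_is_derive (smooth1_cutP b s j) (z ord0 j).
  have h2 := smooth1_is_derive (smooth1_cutP a r j) (z ord0 j).
  have h := is_deriveD h1 (is_deriveZ (-1) h2).
  by rewrite (derive_val (is_derive := h)) !derive_cutP /GRing.scale/= mulN1r.
have jn := ltn_ord j.
rewrite [T j.+1](bigD1 j)//= ltnSn [T j](bigD1 j)//= ltnn mulrBl; congr (_ * _ - _ * _); apply: eq_bigr => l lj.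
  have -> : (l < j.+1)%N = (l < j)%N.
    by rewrite ltnS leq_eqVlt; case: eqP => // /val_inj h; rewrite h eqxx in lj.
  by rewrite (negbTE lj); case: ifP.
by rewrite (negbTE lj); case: ifP.
Qed.

Lemma vfield_out a r b (s : R) j z : 0 < r -> 0 < s -> cube b s `<=` cube a r ->
  ~ cube a r z -> vfield a r b s j z = 0.
Proof.
move=> r0 s0 sub /cubeP/existsNP[l /negP h].
have {}sub i : a ord0 i <= b ord0 i /\ b ord0 i + s <= a ord0 i + r.
  split.
    have /sub/cubeP/(_ i)/andP[]// : cube b s b.
    by apply/cubeP => k; rewrite lexx lerDl ltW.
  have /sub/cubeP/(_ i)/andP[_] : cube b s (\row_k (b ord0 k + s)).
    by apply/cubeP => k; rewrite mxE lexx andbT lerDl ltW.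
  by rewrite mxE.
have [h1 h2] := sub l.
apply: (@tens_out _ _ l); case: ifP => _.
  by apply: cutH_out => //; apply: contra h => /andP[h3 h4]; apply/andP; split; lra.
case: eqP => _; last exact: cutH_out.
(* In the coordinate of the primitives, both are [0] below the large cube and both are [1] above
   it. *)
move: h; rewrite negb_and -!ltNge => /orP[h|h].
  by rewrite !cutP_le ?mulr0 ?addr0// ?ltW// (lt_le_trans h).
by rewrite !cutP_ge ?mulr1 ?subrr// ltW// (le_lt_trans h2).
Qed.

(** The [j]-th factor is a difference of two values in [[0, 1]], so only the other [n-1] factors
    cost [H / s]. The exponent [n-1] here is the one that later matches (C1). *)
Lemma vfield_bound (H : R) a r b (s : R) j z : 1 <= H -> (forall x : R, stepH x <= H) ->
  0 < s -> s <= r -> `|vfield a r b s j z| <= (H / s) ^+ n.-1.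
Proof.
move=> H1 hH s0 sr; have r0 : 0 < r by exact: lt_le_trans sr.
rewrite /vfield /tens normr_prod (bigD1 j)//= ltnn eqxx.
apply: (@le_trans _ _ (1 * \prod_(i < n | i != j) (H / s))).
  apply: ler_pM => //; first exact: prodr_ge0.
    rewrite mulN1r; have /andP[? ?] := cutP_itv b s j (z ord0 j); have /andP[? ?] := cutP_itv a r j (z ord0 j).
    by rewrite ler_norml; apply/andP; split; lra.
  apply: ler_prod => i /negbTE ->; rewrite normr_ge0/=.
  have cH c (t : R) : 0 < t -> s <= t -> `|cutH c t i (z ord0 i)| <= H / s.
    move=> t0 st; rewrite ger0_norm ?cutH_ge0// /cutH mulrC; apply: ler_pM; rewrite ?stepH_ge0 ?hH//.
      by rewrite invr_ge0 ltW.
    by rewrite lef_pV2 ?posrE.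
  by case: ifP => _; exact: cH.
by rewrite mul1r prodr_const cardC1 card_ord.
Qed.

Lemma tbump_bound (H : R) a r z : (forall x : R, stepH x <= H) -> 0 < r -> tbump a r z <= (H / r) ^+ n.
Proof.
move=> hH r0; rewrite -[n in X in _ <= X]card_ord -prodr_const; apply: ler_prod => i _.
by rewrite cutH_ge0//= /cutH mulrC ler_wpM2r// invr_ge0 ltW.
Qed.

Lemma cube_is_compact a r : compact (cube a r).
Proof.
rewrite (_ : cube a r = [set v : 'rV[R]_n | forall i, `[a ord0 i, a ord0 i + r]%classic (v ord0 i)]).
  by apply: (@rV_compact _ n (fun i => `[a ord0 i, a ord0 i + r]%classic)) => i; exact: segment_compact.
by apply/seteqP; split => x /=; [move/cubeP => h i; rewrite /= in_itv/=|move=> h; apply/cubeP => i; have := h i; rewrite /= in_itv/=].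
Qed.

Lemma testfun_vfield (D : set 'rV[R]_n) a r b (s : R) j : 0 < r -> 0 < s -> cube b s `<=` cube a r ->
  cube a r `<=` D -> testfun D (vfield a r b s j).
Proof.
move=> r0 s0 sub aD; split; first by apply: smooth_tens => l; exact: smooth1_vfield.
exists (cube a r); split => //; first exact: cube_is_compact.
by move=> x; exact: vfield_out.
Qed.

Lemma continuous_tens (p : 'I_n -> R -> R) : (forall i, smooth1 (p i)) -> continuous (tens p).
Proof. by move=> sp z; apply: differentiable_continuous; exact: differentiable_tens. Qed.

Lemma measurable_tens (p : 'I_n -> R -> R) D : (forall i, smooth1 (p i)) -> lmeasurable_fun D (tens p).
Proof. by move=> sp; apply: measurable_continuous; exact: continuous_tens. Qed.

Lemma leb_outer_cube_ge a r : (0 < n)%N -> 0 < r -> ((r ^+ n)%:E <= leb_outer (cube a r : set (rvall R n)))%E.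
Proof.
move=> n0 r0; have r1 : 0 < r^-1 ^+ n by rewrite exprn_gt0// invr_gt0.
have := leb_outer_scale a (cube a r) r0.
rewrite (_ : affmap r a @^-1` cube a r = cbox (const_mx 0) (const_mx 1)).
  move=> h; have := leb_outer_unit_ge1 R n0; rewrite h.
  by rewrite -lee_pdivrMl// mule1 exprVn invrK.
apply/seteqP; split => x; rewrite /preimage/=.
  by move=> /cubeP h i; have := h i; rewrite !mxE lerDr [a ord0 i + r]addrC lerD2r pmulr_rge0// ger_pMr.
by move=> h; apply/cubeP => i; have := h i; rewrite !mxE lerDr [a ord0 i + r]addrC lerD2r pmulr_rge0// ger_pMr.
Qed.

Lemma leb_cube_le a r : 0 <= r -> ((@lebesgue_n R n) (cube a r) <= (r ^+ n)%:E)%E.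
Proof.
move=> r0; apply: (le_trans (leb_outer_cbox_le _)); first by move=> i; rewrite mxE lerDl.
rewrite lee_fin -[n in X in _ <= X]card_ord -prodr_const.
by rewrite le_eqVlt; apply/orP; left; apply/eqP; apply: eq_bigr => i _; rewrite mxE addrAC subrr add0r.
Qed.
End bump.

(** * Averages against bumps *)

Section average.
Context {R : realType} {n : nat}.
Local Notation mu := (@lebesgue_n R n).
Implicit Types (D : set 'rV[R]_n) (v f : 'rV[R]_n -> R) (a b : 'rV[R]_n) (r s : R).

Lemma integrable_lint D (F : 'rV[R]_n -> \bar R) : @measurable _ (Leb R n) D ->
  mu.-integrable (D : set (Leb R n)) F -> lint D F \is a fin_num.
Proof. by move=> mD iF; exact: integrable_fin_num. Qed.

(** The product vanishes off a compact cube and is dominated there by [C |v|]. *)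
Lemma integrable_locintM D v f a r (C : R) : open D -> locint D v -> cube a r `<=` D ->
  lmeasurable_fun D f -> (forall z, `|f z| <= C) -> (forall z, ~ cube a r z -> f z = 0) ->
  mu.-integrable (D : set (Leb R n)) (fun z => (v z * f z)%:E).
Proof.
move=> oD [mv iv] aD mf fC f0.
have mD := measurable_open oD.
have mK : @measurable _ (Leb R n) (cube a r) by exact: measurable_cbox.
have e : (fun z => (v z * f z)%:E) = (fun z : Leb R n => (v z * f z)%:E) \_ (cube a r : set (Leb R n)).
  apply/funext => z; rewrite patchE; case: ifPn => // /negP h.
  by rewrite f0 ?mulr0// => hz; apply: h; rewrite inE.
rewrite e; apply/(integrable_restrict mu mK mD); rewrite (_ : D `&` _ = cube a r); last first.
  by apply/seteqP; split => [z []//|z kz]; split => //; exact: aD.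
have mvK : @measurable_fun _ _ (Leb R n) R (cube a r) v by exact: (@measurable_funS _ _ (Leb R n)) mv.
have mfK : @measurable_fun _ _ (Leb R n) R (cube a r) f by exact: (@measurable_funS _ _ (Leb R n)) mf.
have iK : mu.-integrable (cube a r : set (Leb R n)) (fun z => (C * v z)%:E).
  under eq_fun do rewrite EFinM; apply: integrableZl => //.
  apply/integrableP; split; first exact/measurable_EFinP.
  by have := iv _ (@cube_is_compact _ _ a r) aD.
apply: (le_integrable mK _ _ iK).
  by apply/measurable_EFinP; exact: measurable_funM.
move=> z _; rewrite /= lee_fin !normrM mulrC ler_wpM2r//.
by apply: (le_trans (fC z)); exact: ler_norm.
Qed.

Lemma derive_vfieldE a r b (s : R) (j : 'I_n) z : 'D_(evec R j) (vfield a r b s j) z =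
  tens (fun i t => if (i < j)%N then cutH b s i t
        else if i == j then cutH b s i t - cutH a r i t else cutH a r i t) z.
Proof.
have -> := congr1 (fun F => F z) (derive_vfield a r b s j).
apply: eq_bigr => i _; case: (eqVneq i j) => [->|ij]; last by case: ifP.
rewrite ltnn derive1E.
have h1 := smooth1_is_derive (smooth1_cutP b s j) (z ord0 j).
have h2 := smooth1_is_derive (smooth1_cutP a r j) (z ord0 j).
have h := is_deriveD h1 (is_deriveZ (-1) h2).
by rewrite (derive_val (is_derive := h)) !derive_cutP /GRing.scale/= mulN1r.
Qed.

Lemma measurable_derive_vfield D a r b (s : R) (j : 'I_n) :
  lmeasurable_fun D (fun z => 'D_(evec R j) (vfield a r b s j) z).
Proof.
rewrite (_ : (fun z => _) = 'D_(evec R j) (vfield a r b s j))//.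
rewrite derive_vfield; apply: measurable_tens => i.
have h := smooth1_vfield a r b s j i.
by case: ifP => // _; exact: smooth1_derive.
Qed.

Lemma cube_sub a r b (s : R) : 0 < s -> cube b s `<=` cube a r ->
  forall i, a ord0 i <= b ord0 i /\ b ord0 i + s <= a ord0 i + r.
Proof.
move=> s0 sub i; split.
  have /sub/cubeP/(_ i)/andP[]// : cube b s b.
  by apply/cubeP => k; rewrite lexx lerDl ltW.
have /sub/cubeP/(_ i)/andP[_] : cube b s (\row_k (b ord0 k + s)).
  by apply/cubeP => k; rewrite mxE lexx andbT lerDl ltW.
by rewrite mxE.
Qed.

Lemma derive_vfield_out a r b (s : R) j z : 0 < r -> 0 < s -> cube b s `<=` cube a r ->
  ~ cube a r z -> 'D_(evec R j) (vfield a r b s j) z = 0.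
Proof.
move=> r0 s0 sub /cubeP/existsNP[l /negP h]; rewrite derive_vfieldE.
have [h1 h2] := cube_sub s0 sub l.
have Hb : cutH b s l (z ord0 l) = 0.
  by apply: cutH_out => //; apply: contra h => /andP[h3 h4]; apply/andP; split; lra.
have Ha : cutH a r l (z ord0 l) = 0 by exact: cutH_out.
by apply: (@tens_out _ _ _ _ l); rewrite Ha Hb subrr; case: ifP => // _; case: ifP.
Qed.

(** A cruder bound, with exponent [n], that serves to make [v] times these derivatives
    integrable. *)
Lemma derive_vfield_bound (H : R) a r b (s : R) j z : (forall x : R, stepH x <= H) ->
  0 < s -> s <= r -> `|'D_(evec R j) (vfield a r b s j) z| <= (H / s) ^+ n.
Proof.
move=> hH s0 sr; have r0 : 0 < r by exact: lt_le_trans sr.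
rewrite derive_vfieldE /tens normr_prod -[n in X in _ <= X]card_ord -prodr_const.
apply: ler_prod => i _; rewrite normr_ge0/=.
have H0 : 0 <= H by apply: le_trans (hH 0); exact: stepH_ge0.
have cH c (t : R) : 0 < t -> s <= t -> 0 <= cutH c t i (z ord0 i) <= H / s.
  move=> t0 st; rewrite cutH_ge0//= /cutH mulrC; apply: ler_pM; rewrite ?stepH_ge0 ?hH//.
    by rewrite invr_ge0 ltW.
  by rewrite lef_pV2 ?posrE.
have /andP[h1 h2] := cH b s s0 (lexx s); have /andP[h3 h4] := cH a r r0 sr.
case: ifP => _; first by rewrite (ger0_norm h1); exact: h2.
case: ifP => _; last by rewrite (ger0_norm h3); exact: h4.
rewrite ler_norml lerBrDr lerBlDr; apply/andP; split; last exact: (ler_wpDr h3 h2).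
by apply: le_trans h1; rewrite addrC subr_le0.
Qed.

Definition weak1 D v (g : 'I_n -> 'rV[R]_n -> R) : Prop :=
  [/\ locint D v, (forall j, locint D (g j)) &
  forall f, testfun D f -> forall j,
    lint D (fun x => (v x * 'D_(evec R j) f x)%:E) = (- lint D (fun x => (g j x * f x)%:E))%E].

(** An average up to the constant factor [bmass], which is the same for all cubes inside [D]. *)
Definition bavg D v a r : \bar R := lint D (fun z => (v z * tbump a r z)%:E).

Lemma integrable_bump D v a r : open D -> locint D v -> cube a r `<=` D -> 0 < r ->
  mu.-integrable (D : set (Leb R n)) (fun z => (v z * tbump a r z)%:E).
Proof.
move=> oD lv aD r0; have [H H1 hH] := stepH_bounded (R := R).
apply: (@integrable_locintM _ _ _ a r ((H / r) ^+ n)) => //.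
- by apply: measurable_tens => i; exact: smooth1_cutH.
- by move=> z; rewrite ger0_norm ?tbump_ge0//; exact: tbump_bound.
- by move=> z; exact: tbump_out.
Qed.

(** The difference of the bumps is the divergence of [vfield], a test function in each component.
    Integration by parts moves the derivative onto the weak gradient, and [vfield_bound] estimates
    the result. *)
Lemma bavg_step D v g a r b (s H : R) : open D -> weak1 D v g ->
  1 <= H -> (forall x : R, stepH x <= H) ->
  0 < s -> s <= r -> cube b s `<=` cube a r -> cube a r `<=` D ->
  (`| bavg D v b s - bavg D v a r | <=
   lint D (fun z => ((H / s) ^+ n.-1 * \1_(cube a r) z * \sum_(j < n) `|g j z|)%:E))%E.
Proof.
move=> oD [lv lg wf] H1 hH s0 sr sub aD.
have mD := measurable_open oD.
have r0 : 0 < r by exact: lt_le_trans sr.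
have ia := integrable_bump oD lv aD r0.
have ib := integrable_bump oD lv (subset_trans sub aD) s0.
have iD j : mu.-integrable (D : set (Leb R n)) (fun z => (v z * 'D_(evec R j) (vfield a r b s j) z)%:E).
  apply: (@integrable_locintM _ _ _ a r ((H / s) ^+ n)) => //.
  - exact: measurable_derive_vfield.
  - by move=> z; exact: derive_vfield_bound.
  - by move=> z; exact: derive_vfield_out.
have iV j : mu.-integrable (D : set (Leb R n)) (fun z => (g j z * vfield a r b s j z)%:E).
  apply: (@integrable_locintM _ _ _ a r ((H / s) ^+ n.-1)) => //.
  - by apply: measurable_tens => i; exact: smooth1_vfield.
  - by move=> z; exact: vfield_bound.
  - by move=> z; exact: vfield_out.
have -> : (bavg D v b s - bavg D v a r = - lint D (fun z => \sum_(j < n) (g j z * vfield a r b s j z)%:E))%E.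
  rewrite /bavg /lint -(integralB mD ib ia).
  transitivity (\int[mu]_(z in (D : set (Leb R n))) \sum_(j < n) (v z * 'D_(evec R j) (vfield a r b s j) z)%:E)%E.
    apply: eq_integral => z _; rewrite /= -EFinB -mulrBr -div_vfield mulr_sumr sumEFin//.
  rewrite integral_sum// integral_sum// -sumeN; last first.
    by move=> i j _ _; rewrite fin_num_adde_defr//; exact: integrable_fin_num.
  by apply: eq_bigr => j _; apply: (wf _ (testfun_vfield _ r0 s0 sub aD)).
rewrite abseN; apply: (le_trans (le_abse_integral _ mD _)).
  by apply: emeasurable_sum => j; case/integrableP : (iV j).
have mg j : @measurable_fun _ _ (Leb R n) R D (g j) by case: (lg j).
apply: (ge0_le_integral _ mD).
- by move=> z _; exact: abse_ge0.
- by apply: (measurableT_comp (@abse_measurable R setT)); apply: emeasurable_sum => j; case/integrableP : (iV j).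
- apply/measurable_EFinP; apply: measurable_funM; last first.
    by apply: measurable_sum => j; exact: measurableT_comp.
  by apply: measurable_funM => //; apply: measurable_indic; exact: measurable_cbox.
- move=> z Dz; rewrite sumEFin lee_fin.
  apply: (le_trans (ler_norm_sum _ _ _)); rewrite mulr_sumr; apply: ler_sum => j _.
  rewrite normrM mulrC ler_wpM2r// indicE.
  have [az|naz] := pselect (cube a r z); first by rewrite mem_set// mulr1; exact: vfield_bound.
  by rewrite vfield_out// normr0 mulr_ge0// exprn_ge0// divr_ge0 ?ltW// (lt_le_trans ltr01).
Qed.

(** The value is never computed: finiteness, positivity and independence of the cube are enough. *)
Definition bmass : R := fine (lint setT (fun z : 'rV[R]_n => (tbump 0 1 z)%:E)).

Lemma measurable_tbump D a r : lmeasurable_fun D (tbump a r).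
Proof. by apply: measurable_tens => i; exact: smooth1_cutH. Qed.

Lemma lint_bump_le D a r (H : R) : @measurable _ (Leb R n) D -> (forall x : R, stepH x <= H) -> 0 < r ->
  (lint D (fun z => (tbump a r z)%:E) <= (H ^+ n)%:E)%E.
Proof.
move=> mD hH r0; have mK : @measurable _ (Leb R n) (cube a r) by exact: measurable_cbox.
have H0 : 0 <= H by apply: le_trans (hH 0); exact: stepH_ge0.
apply: (@le_trans _ _ (\int[mu]_(z in (cube a r : set (Leb R n))) ((H / r) ^+ n)%:E)%E).
  rewrite /lint integral_mkcond [leRHS]integral_mkcond.
  apply: (ge0_le_integral _ (@measurableT _ (Leb R n))).
  - by move=> z _; rewrite patchE; case: ifP => // _; rewrite lee_fin tbump_ge0.
  - by apply/(measurable_restrictT _ mD); apply/measurable_EFinP; exact: measurable_tbump.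
  - by apply/(measurable_restrictT _ mK); exact: measurable_cst.
  - move=> z _; rewrite !patchE.
    have h0 : 0 <= (H / r) ^+ n by rewrite exprn_ge0// divr_ge0// ltW.
    case: ifPn => _; last by case: ifP => _//; rewrite lee_fin.
    case: ifPn => zK; first by rewrite lee_fin; exact: tbump_bound.
    by rewrite tbump_out// => h; move/negP: zK; apply; rewrite inE.
rewrite integral_cst// exprMn exprVn.
apply: (@le_trans _ _ ((H ^+ n / r ^+ n)%:E * (r ^+ n)%:E)%E).
  apply: lee_wpmul2l; last by apply: leb_cube_le; exact: ltW.
  by rewrite lee_fin divr_ge0// exprn_ge0// ltW.
by rewrite -EFinM divfK// expf_eq0 gt_eqF// andbF.
Qed.

Lemma bmassE : lint setT (fun z : 'rV[R]_n => (tbump 0 1 z)%:E) = bmass%:E.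
Proof.
have [H H1 hH] := stepH_bounded (R := R).
rewrite /bmass fineK// ge0_fin_numE; last by apply: integral_ge0 => z _; rewrite lee_fin tbump_ge0.
apply: le_lt_trans (lint_bump_le 0 _ hH ltr01) _; [exact: (@measurableT _ (Leb R n))|exact: ltry].
Qed.

Lemma lint_tbump D a r : open D -> cube a r `<=` D -> 0 < r ->
  lint D (fun z => (tbump a r z)%:E) = bmass%:E.
Proof.
move=> oD aD r0; have mD := measurable_open oD.
have r1 : 0 < r^-1 by rewrite invr_gt0.
transitivity (lint setT (fun z => (tbump a r z)%:E)).
  rewrite /lint integral_mkcond; apply: eq_integral => z _; rewrite patchE.
  case: ifPn => // zD; rewrite tbump_out// => az.
  by move/negP: zD; apply; rewrite inE; exact: aD.
have -> : (fun z : 'rV[R]_n => (tbump a r z)%:E) =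
   (fun z : 'rV[R]_n => ((r^-1 ^+ n)%:E * (tbump 0 1 (affmap r^-1 (- (r^-1 *: a)) z))%:E)%E).
  by apply/funext => z; rewrite tbump_scale// EFinM.
have t0 (z : 'rV[R]_n) : 0 <= tbump 0 1 z :> R by rewrite tbump_ge0.
rewrite /lint ge0_integralZl_EFin; first last.
- by rewrite exprn_ge0// ltW.
- apply/measurable_EFinP.
  have ma := measurable_affine (- (r^-1 *: a)) r1.
  have mt : @measurable_fun _ _ (Leb R n) R setT (tbump 0 1) := @measurable_tbump setT 0 1.
  by have := measurableT_comp mt ma.
- by move=> z _; rewrite lee_fin.
- exact: (@measurableT _ (Leb R n)).
rewrite -/(lint setT _) integral_affine//; last exact: measurable_tbump.
by rewrite bmassE -!EFinM mulrA -exprMn mulfV ?gt_eqF// expr1n mul1r.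
Qed.

(** By continuity [stepH] is at least half of its value at [1/2] on an interval of length [2d], so
    the unit bump is bounded below on a cube of side [2d]. That cube has positive measure by the
    lower bound for the unit cube. *)
Lemma bmass_gt0 : (0 < n)%N -> 0 < bmass.
Proof.
move=> n0.
have h0 : 0 < stepH (2^-1 : R) / 2 by rewrite divr_gt0// stepH_half.
have cH : {for (2^-1 : R), continuous (@stepH R)} by exact: smooth1_continuous smooth1_stepH _.
have [d d0 hd] : exists2 d : R, 0 < d & forall t : R, `|2^-1 - t| <= d -> stepH (2^-1 : R) / 2 <= stepH t.
  move/cvgrPdist_lt : cH => /(_ _ h0)/nbhs_ballP[d /= d0 dP]; exists (d / 2); first by rewrite divr_gt0.
  move=> t td; have := dP t; rewrite /ball/= => /(_ _)/wrap[].
    by apply: (le_lt_trans td); rewrite ltr_pdivrMr// ltr_pMr// ltr1n.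
  rewrite ltr_norml => /andP[_]; rewrite ltrBlDl -ltrBlDr {1}(splitr (stepH _)) addrK.
  exact: ltW.
pose b : 'rV[R]_n := const_mx (2^-1 - d).
have mK : @measurable _ (Leb R n) (cube b (d *+ 2)) by exact: measurable_cbox.
have d20 : 0 < d *+ 2 by rewrite pmulrn_lgt0.
rewrite -lte_fin -bmassE.
apply: (@lt_le_trans _ _ (((stepH (2^-1 : R) / 2) ^+ n)%:E * ((d *+ 2) ^+ n)%:E)%E).
  by rewrite -EFinM lte_fin mulr_gt0// exprn_gt0.
apply: (@le_trans _ _ (\int[mu]_(z in (cube b (d *+ 2) : set (Leb R n))) ((stepH (2^-1 : R) / 2) ^+ n)%:E)%E).
  rewrite integral_cst//; apply: lee_wpmul2l; last exact: leb_outer_cube_ge.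
  by rewrite lee_fin exprn_ge0// ltW.
apply: (@le_trans _ _ (lint (cube b (d *+ 2)) (fun z : 'rV[R]_n => (tbump 0 1 z)%:E))).
  apply: (ge0_le_integral _ mK).
  - by move=> z _; rewrite lee_fin exprn_ge0// ltW.
  - exact: measurable_cst.
  - by apply/measurable_EFinP; exact: measurable_tbump.
  - move=> z /cubeP bz; rewrite lee_fin -[n in X in X <= _]card_ord -prodr_const; apply: ler_prod => i _.
    rewrite ltW//= /cutH invr1 !mul1r mxE oppr0 addr0; apply: hd.
    by have := bz i; rewrite mxE => /andP[h1 h2]; rewrite ler_norml; apply/andP; split; lra.
apply: (ge0_subset_integral mu mK (@measurableT _ (Leb R n))).
- by apply/measurable_EFinP; exact: measurable_tbump.
- by move=> z _; rewrite lee_fin tbump_ge0.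
- exact: subsetT.
Qed.

Lemma bavg_close D v a r x (e : R) : open D -> locint D v -> cube a r `<=` D -> 0 < r ->
  (forall z, cube a r z -> `|v z - v x| <= e) ->
  (`| bavg D v a r - (bmass * v x)%:E | <= (e * bmass)%:E)%E.
Proof.
move=> oD lv aD r0 ve; have mD := measurable_open oD.
have mv : @measurable_fun _ _ (Leb R n) R D v by case: lv.
have ia := integrable_bump oD lv aD r0.
have i1 : mu.-integrable (D : set (Leb R n)) (fun z => (tbump a r z)%:E).
  apply/integrableP; split; first by apply/measurable_EFinP; exact: measurable_tbump.
  rewrite (_ : (\int[mu]_(x in _) _)%E = bmass%:E) ?ltry// -(lint_tbump oD aD r0).
  by apply: eq_integral => z _; rewrite /= ger0_norm// tbump_ge0.
have ix : mu.-integrable (D : set (Leb R n)) (fun z => ((v x)%:E * (tbump a r z)%:E)%E) by exact: integrableZl.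
have -> : ((bmass * v x)%:E = \int[mu]_(z in (D : set (Leb R n))) ((v x)%:E * (tbump a r z)%:E))%E.
  by rewrite (integralZl mD i1) -[X in (_ * X)%E]/(lint D _) (lint_tbump oD aD r0) mulrC EFinM.
rewrite /bavg /lint -(integralB mD ia ix).
apply: (le_trans (le_abse_integral _ mD _)).
  by apply: emeasurable_funB; [case/integrableP : ia|case/integrableP : ix].
rewrite EFinM -(lint_tbump oD aD r0) /lint -(integralZl mD i1).
apply: (ge0_le_integral _ mD).
- by move=> z _; exact: abse_ge0.
- apply: (measurableT_comp (@abse_measurable R setT)).
  by apply: emeasurable_funB; [case/integrableP : ia|case/integrableP : ix].
- apply: emeasurable_funM; first exact: measurable_cst.
  by apply/measurable_EFinP; exact: measurable_tbump.
- move=> z Dz; rewrite -EFinM -EFinB -EFinM lee_fin -mulrBl normrM [X in _ * X <= _]ger0_norm ?tbump_ge0//.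
  have [az|naz] := pselect (cube a r z); first by rewrite ler_wpM2r ?tbump_ge0// ve.
  by rewrite tbump_out// !mulr0.
Qed.
End average.

(** * The gauge psi *)

(* The three properties of B through which the Young function enters the construction of psi. *)
Definition good_B (R : realType) (n : nat) (A : R -> \bar R) : Prop :=
  [/\ (forall c t : R, 0 < c -> c <= 1 -> 0 <= t -> (Bfun n A (c * t)%R <= (c ^+ n)%:E * Bfun n A t)%E),
      (forall y : R, has_ubound [set t : R | 0 <= t /\ (Bfun n A t <= y%:E)%E]) &
      (forall y : R, 0 < y -> exists2 t : R, 0 < t & (Bfun n A t <= y%:E)%E)].

Section gauge_theory.
Context {R : realType} {n : nat} {A : R -> \bar R} {phi : R -> R}.
Hypotheses (n0 : (0 < n)%N) (gB : good_B n A) (gphi : gauge n phi).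

Lemma Binv_ge (t y : R) : 0 <= t -> (Bfun n A t <= y%:E)%E -> t <= Binv n A y.
Proof.
move=> t0 ty; have [_ ub _] := gB.
apply: ub_le_sup; [exact: ub|by split].
Qed.

Lemma Binv_gt0 (y : R) : 0 < y -> 0 < Binv n A y.
Proof.
move=> y0; have [_ _ /(_ _ y0)[t t0 ty]] := gB.
by apply: (lt_le_trans t0); apply: Binv_ge => //; exact: ltW.
Qed.

Lemma Binv_le_sup (y z : R) : 0 < y ->
  (forall t : R, 0 <= t -> (Bfun n A t <= y%:E)%E -> t <= z) -> Binv n A y <= z.
Proof.
move=> y0 h; have [_ _ /(_ _ y0)[t t0 ty]] := gB.
apply: ge_sup; first by exists t; split => //; exact: ltW.
by move=> s [s0 sy]; exact: h.
Qed.

(** This is [B (c t) <= c^n B t] with [c = r / s], read through the inverse. *)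
Lemma Binv_scale (r s z : R) : 0 < z -> 0 < r -> r <= s ->
  r * Binv n A (z / r ^+ n) <= s * Binv n A (z / s ^+ n).
Proof.
move=> z0 r0 rs; have s0 : 0 < s by exact: lt_le_trans rs.
rewrite -ler_pdivlMl//; apply: Binv_le_sup; first by rewrite divr_gt0// exprn_gt0.
move=> t t0 tz; rewrite ler_pdivlMl// -ler_pdivrMl// mulrA.
have c0 : 0 < s^-1 * r by rewrite mulr_gt0// invr_gt0.
have c1 : s^-1 * r <= 1 by rewrite mulrC ler_pdivrMr// mul1r.
apply: Binv_ge; first by rewrite mulr_ge0// ltW.
have [B1 _ _] := gB; apply: (le_trans (B1 _ _ c0 c1 t0)).
apply: (@le_trans _ _ (((s^-1 * r) ^+ n)%:E * (z / r ^+ n)%:E)%E).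
  by apply: lee_wpmul2l => //; rewrite lee_fin exprn_ge0// ltW.
rewrite -EFinM lee_fin exprMn exprVn le_eqVlt; apply/orP; left; apply/eqP.
by field; rewrite !gt_eqF ?exprn_gt0.
Qed.

Lemma phi_gt0 (r : R) : 0 < r -> 0 < phi r. Proof. by case: gphi => _ h _ _ _; exact: h. Qed.

Lemma phi0 : phi 0 = 0. Proof. by case: gphi. Qed.

Lemma phi_le (r s : R) : 0 <= r -> r <= s -> phi r <= phi s. Proof. by case: gphi => _ _ h _ _; exact: h. Qed.

Lemma phi_ge0 (r : R) : 0 <= r -> 0 <= phi r. Proof. by move=> r0; rewrite -phi0; exact: phi_le. Qed.

Lemma phi_div (r s : R) : 0 < r -> r <= s -> phi s / s ^+ n <= phi r / r ^+ n.
Proof. by case: gphi => _ _ _ _ h; exact: h. Qed.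

Lemma phi_scale (c r : R) : 1 <= c -> 0 <= r -> phi (c * r) <= c ^+ n * phi r.
Proof.
move=> c1; have c0 : 0 < c by exact: lt_le_trans c1.
rewrite le_eqVlt => /orP[/eqP <-|r0]; first by rewrite mulr0 phi0 mulr0.
have := @phi_div r (c * r) r0 (ler_peMl (ltW r0) c1).
rewrite ler_pdivrMr ?exprn_gt0 ?mulr_gt0//; move/le_trans; apply.
rewrite exprMn le_eqVlt; apply/orP; left; apply/eqP.
by field; rewrite gt_eqF ?exprn_gt0.
Qed.

Lemma J_gt0 (s : R) : 0 < s -> 0 < Jfun n A phi s.
Proof. by move=> s0; rewrite mulr_gt0// Binv_gt0// divr_gt0 ?phi_gt0// exprn_gt0. Qed.

(** States that [J / phi^(1/n)] is nondecreasing, the property through which constant factors pass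
    from [J] to [phi]. *)
Lemma J_ratio (r s : R) : 0 < r -> r <= s ->
  Jfun n A phi r * (phi s / phi r) `^ (n%:R^-1) <= Jfun n A phi s.
Proof.
move=> r0 rs; have s0 : 0 < s by exact: lt_le_trans rs.
have pr := phi_gt0 r0; have ps := phi_gt0 s0.
set k := _ `^ _.
have k0 : 0 < k by rewrite powR_gt0// divr_gt0.
have kn : k ^+ n = phi s / phi r.
  by rewrite -powR_mulrn ?ltW// -powRrM mulVf ?pnatr_eq0 -?lt0n// powRr1// divr_ge0// ltW.
(* Because [phi r / r^n] is non-increasing, the scale [k r] at which [phi s / (k r)^n] equals
   [phi r / r^n] does not exceed [s]. *)
have krs : k * r <= s.
  rewrite -(@ler_pXn2r _ n) ?nnegrE ?mulr_ge0 ?(ltW k0) ?(ltW r0) ?(ltW s0)// exprMn kn.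
  have := phi_div r0 rs; rewrite ler_pdivrMr ?exprn_gt0// => h.
  rewrite mulrAC ler_pdivrMr//; apply: (@le_trans _ _ ((phi r / r ^+ n * s ^+ n) * r ^+ n)).
    by rewrite ler_wpM2r// exprn_ge0// ltW.
  rewrite le_eqVlt; apply/orP; left; apply/eqP.
  by field; rewrite gt_eqF ?exprn_gt0.
have -> : Jfun n A phi r * k = (k * r) * Binv n A (phi s / (k * r) ^+ n).
  rewrite /Jfun mulrAC [r * k]mulrC; congr (_ * Binv _ _ _).
  rewrite exprMn kn; field.
  by rewrite !gt_eqF ?exprn_gt0.
by apply: Binv_scale => //; rewrite mulr_gt0.
Qed.

Lemma Jinv_ge0 (r : R) : 0 <= Jinv n A phi r.
Proof.
rewrite /Jinv; set S := [set s | _].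
have [->|/set0P S0] := eqVneq S set0; first by rewrite inf0.
by apply: lb_le_inf => // x [].
Qed.

Lemma psi_ge0 (r : R) : 0 <= psi n A phi r. Proof. exact/phi_ge0/Jinv_ge0. Qed.

(** Below [t = Jinv r] one has [J x < r <= C * J s], so [J_ratio] gives [phi x <= C^n * phi s] for
    [s <= x < t]. Continuity of [phi] carries the bound to [t]. *)
Lemma psi_le_scale (C r s : R) : 1 <= C -> 0 < s -> r <= C * Jfun n A phi s ->
  psi n A phi r <= C ^+ n * phi s.
Proof.
move=> C1 s0 rs; have C0 : 0 < C by exact: lt_le_trans C1.
have ps := phi_gt0 s0.
have C1n : 1 <= C ^+ n by rewrite exprn_ege1.
rewrite /psi /Jinv; set S := [set _ | _].
(* The infimum of the empty set is [0] by convention, and then [psi] takes the value [0]. *)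
have [->|/set0P S0] := eqVneq S set0; first by rewrite inf0 phi0 mulr_ge0 ?exprn_ge0 ?ltW.
have lbS : has_lbound S by exists 0 => x [].
set t := inf S.
have [ts|st] := leP t s.
  apply: (@le_trans _ _ (phi s)); last by rewrite ler_peMl// ltW.
  by apply: phi_le => //; apply: lb_le_inf => // x [].
have below (x : R) : s <= x -> x < t -> phi x <= C ^+ n * phi s.
  move=> sx xt; have x0 : 0 < x by exact: lt_le_trans sx.
  have xS : Jfun n A phi x < r.
    rewrite ltNge; apply/negP => h; move: xt; rewrite ltNge => /negP; apply.
    by apply: ge_inf => //; split => //; exact: ltW.
  have := le_lt_trans (J_ratio s0 sx) (lt_le_trans xS rs).
  rewrite mulrC ltr_pM2r ?J_gt0// => /ltW h.
  have px := phi_gt0 x0.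
  rewrite -ler_pdivrMr//.
  have -> : phi x / phi s = ((phi x / phi s) `^ n%:R^-1) ^+ n.
    by rewrite -powR_mulrn ?powR_ge0// -powRrM mulVf ?pnatr_eq0 -?lt0n// powRr1// divr_ge0// ltW.
  by rewrite lerXn2r ?nnegrE ?powR_ge0// ltW.
rewrite leNgt; apply/negP => h.
have t0 : 0 < t by exact: lt_trans st.
have ct : {for t, continuous phi}.
  have t1 : 0 < t + 1 by rewrite addr_gt0.
  apply: (within_continuous_continuous t1); last by rewrite in_itv/= t0 ltrDl ltr01.
  case: gphi => _ _ _ + _; apply: continuous_subspaceW => x /=.
  by rewrite !in_itv/= andbT => /andP[].
have e0 : 0 < phi t - C ^+ n * phi s by rewrite subr_gt0.
move/cvgrPdist_lt : ct => /(_ _ e0)/nbhs_ballP[d /= d0 dP].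
(* A point of [[s, t)] close enough to [t] to contradict a strict excess of [phi t]. *)
pose x := Num.max s (t - d / 2).
have xt : x < t by rewrite gt_max st /= ltrBlDr ltrDl divr_gt0.
have sx : s <= x by rewrite le_max lexx.
have := dP x; rewrite /ball/= => /(_ _)/wrap[].
  rewrite gtr0_norm ?subr_gt0// ltrBlDr -ltrBlDl.
  apply: lt_le_trans (_ : t - d / 2 <= x); last by rewrite le_max lexx orbT.
  by rewrite ltrD2l ltrN2 ltr_pdivrMr// ltr_pMr// ltr1n.
have := below x sx xt; rewrite ltr_norml => h1 /andP[_ h2]; lra.
Qed.

(** [J_ratio] against the scale [1]. It bounds diameters by a power of [phi], which is how covers of
    the image become fine. *)
Lemma J_small (s : R) : 0 < s -> s <= 1 ->
  Jfun n A phi s <= Jfun n A phi 1 * (phi s / phi 1) `^ (n%:R^-1).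
Proof.
move=> s0 s1; have := J_ratio s0 s1.
have ps := phi_gt0 s0; have p1 := phi_gt0 ltr01.
set x := phi s / phi 1; set y := phi 1 / phi s => h.
have x0 : 0 <= x by rewrite divr_ge0// ltW.
have y0 : 0 <= y by rewrite divr_ge0// ltW.
have xy : y `^ n%:R^-1 * x `^ n%:R^-1 = 1.
  rewrite -powRM// (_ : y * x = 1) ?powR1// /x /y.
  by field; rewrite !gt_eqF.
by rewrite -[leLHS]mulr1 -[X in _ * X <= _]xy mulrA ler_wpM2r// powR_ge0.
Qed.

(** Provides the scale whose gauge is the larger of the gauge of the cube and its energy [M]; the
    bound on [M] keeps it at most [1]. *)
Lemma gauge_IVT (r M : R) : 0 < r -> r <= 1 -> M <= phi 1 ->
  exists s : R, [/\ r <= s, s <= 1 & phi s = Num.max (phi r) M].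
Proof.
move=> r0 r1 M1.
have cphi : {within `[r, 1]%classic, continuous phi}.
  case: gphi => _ _ _ + _; apply: continuous_subspaceW => x /=.
  by rewrite !in_itv/= andbT => /andP[/(le_trans (ltW r0))].
have h : Num.min (phi r) (phi 1) <= Num.max (phi r) M <= Num.max (phi r) (phi 1).
  by rewrite ge_min le_max lexx/= ge_max !le_max lexx M1 orbT.
have [s] := IVT r1 cphi h.
by rewrite in_itv/= => /andP[rs s1] <-; exists s.
Qed.
End gauge_theory.

(** * Young functions *)

Section young_theory.
Context {R : realType} {A : R -> \bar R}.
Hypotheses (yA : young A) (c2 : C2 A).

Lemma young0 : A 0 = 0%E. Proof. by case: yA. Qed.

Lemma young_ge0 (t : R) : 0 <= t -> (0 <= A t)%E. Proof. by case: yA => _ h _ _ _; exact: h. Qed.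

Lemma young_fin (t : R) : 0 <= t -> A t \is a fin_num.
Proof.
rewrite le_eqVlt => /orP[/eqP <-|t0]; first by rewrite young0.
by have [? ?] := c2 t0; rewrite ge0_fin_numE// young_ge0// ltW.
Qed.

Lemma young_scale (c t : R) : 0 <= c -> c <= 1 -> 0 <= t -> (A (c * t)%R <= c%:E * A t)%E.
Proof.
move=> c0 c1 t0; case: yA => A0 _ cv _ _.
have := @cv t 0 c t0 (lexx 0); rewrite c0 c1 => /(_ isT).
by rewrite mulr0 addr0 A0 mule0 adde0.
Qed.

Lemma young_le (x y : R) : 0 <= x -> x <= y -> (A x <= A y)%E.
Proof.
move=> x0 xy; have y0 := le_trans x0 xy.
have [yE|yN] := eqVneq y 0.
  by have -> : x = y by apply/eqP; rewrite eq_le xy yE x0.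
have {}y0 : 0 < y by rewrite lt_neqAle eq_sym yN.
have c1 : x / y <= 1 by rewrite ler_pdivrMr// mul1r.
have c0 : 0 <= x / y by rewrite divr_ge0// ltW.
have := young_scale c0 c1 (ltW y0); rewrite divfK// => /le_trans; apply.
by rewrite gee_pMl ?young_fin ?young_ge0 ?lee_fin// ltW.
Qed.

Lemma young_fine_gt0 (t : R) : 0 < t -> 0 < fine (A t).
Proof. by move=> t0; have [h1 h2] := c2 t0; rewrite fine_gt0// h1. Qed.

Lemma youngE (t : R) : 0 <= t -> A t = (fine (A t))%:E.
Proof. by move=> t0; rewrite fineK// young_fin. Qed.

(** In dimension one [B = A], and all three properties follow from [A (c t) <= c A t], applied to
    [t], to [1/t] times [t], and to multiples of [1]. *)
Lemma good_B1 : good_B 1 A.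
Proof.
have a0 := young_fine_gt0 ltr01.
rewrite /good_B /Bfun eqxx; split.
- by move=> c t c0 c1 t0; rewrite expr1; apply: young_scale => //; exact: ltW.
- move=> y; exists (Num.max 1 (y / fine (A 1))) => t [t0 ty]; rewrite le_max.
  have [//|t1] := leP t 1; apply/orP; right.
  have tp : 0 < t by exact: lt_trans t1.
  have := @young_scale t^-1 t; rewrite mulVf ?gt_eqF// => /(_ _ _ t0) h.
  rewrite ler_pdivlMr// -ler_pdivlMl//.
  rewrite -lee_fin -youngE//; apply: (le_trans (h _ _)).
  + by rewrite invr_ge0.
  + by rewrite invf_le1// ltW.
  + by rewrite EFinM; apply: lee_wpmul2l => //; rewrite lee_fin invr_ge0.
- move=> y y0; pose c := Num.min 1 (y / fine (A 1)).
  have c0 : 0 < c by rewrite lt_min ltr01 divr_gt0.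
  exists c => //; have := @young_scale c 1 (ltW c0); rewrite mulr1 => /(_ _ ler01) h.
  apply: (le_trans (h _)); first by rewrite ge_min lexx.
  by rewrite youngE// -EFinM lee_fin -ler_pdivlMr// ge_min lexx orbT.
Qed.

Local Notation tA := (young_conj A).

Lemma conj_ge0 (t : R) : (0 <= tA t)%E.
Proof.
by apply: ereal_sup_ubound; exists 0 => //=; rewrite mul0r young0 sube0.
Qed.

Lemma conj_ge (s t : R) : 0 <= s -> ((s * t)%:E - A s <= tA t)%E.
Proof. by move=> s0; apply: ereal_sup_ubound; exists s. Qed.

Lemma conj_young (s t : R) : 0 <= s -> ((s * t)%:E <= A s + tA t)%E.
Proof.
move=> s0; have := conj_ge t s0; by rewrite youngE// leeBlDr// addeC.
Qed.

Lemma conj_le (s t : R) : s <= t -> (tA s <= tA t)%E.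
Proof.
move=> st; apply: ge_ereal_sup => _ [x /= x0 <-]; apply: le_trans (conj_ge t x0).
by rewrite leeB// lee_fin ler_wpM2l.
Qed.

(** The superlevel sets of a monotone function are intervals. *)
Lemma nd_emeasurable (f : R -> \bar R) (D : set R) : {homo f : x y / x <= y >-> (x <= y)%E} ->
  measurable_fun D f.
Proof.
move=> nd; apply: measurable_funTS; apply: (measurability _ (ErealGenOInfty.measurableE R)).
move=> _ [_ [a ->] <-]; rewrite setTI; apply: is_interval_measurable => x y /=.
rewrite !in_itv/= !andbT => fx fy z /andP[xz zy].
by rewrite in_itv/= andbT; apply: (lt_le_trans fx); exact: nd.
Qed.

Lemma measurable_conj (D : set R) : measurable_fun D tA.
Proof. by apply: nd_emeasurable => x y; exact: conj_le. Qed.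

Variable n : nat.
Hypothesis n2 : (2 <= n)%N.
Local Notation np := (nprime R n).
Local Notation En := (Efun n A).

Lemma nprime_gt1 : 1 < np.
Proof.
have n1 : 1 < n%:R :> R by rewrite ltr1n.
by rewrite /nprime ltr_pdivlMr ?subr_gt0// mul1r ltrBlDr ltrDl.
Qed.

Lemma nprimeE : np - 1 = n.-1%:R^-1.
Proof.
have n1 : 1 < n%:R :> R by rewrite ltr1n.
have -> : n.-1%:R = n%:R - 1 :> R by rewrite -[n in RHS]prednK ?(ltn_trans _ n2)// -natr1 addrK.
by rewrite /nprime; field; rewrite subr_eq0 gt_eqF.
Qed.

(** The identity [(n-1) n' = n], which matches the growth of the coefficients with the decay of the
    volumes. *)
Lemma powR_nprime (c : R) : 0 <= c -> (c ^+ n.-1) `^ np = c ^+ n.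
Proof.
move=> c0; rewrite -powR_mulrn// -powRrM -powR_mulrn//; congr (_ `^ _).
have n1 : 1 < n%:R :> R by rewrite ltr1n.
have -> : n.-1%:R = n%:R - 1 :> R by rewrite -[n in RHS]prednK ?(ltn_trans _ n2)// -natr1 addrK.
by rewrite /nprime; field; rewrite subr_eq0 gt_eqF.
Qed.

Definition Eint (s : R) : \bar R := (tA s * (s `^ (- 1 - np))%R%:E)%E.

Lemma Eint_ge0 s : (0 <= Eint s)%E.
Proof. by rewrite mule_ge0 ?conj_ge0// lee_fin powR_ge0. Qed.

Lemma measurable_Eint D : measurable_fun D Eint.
Proof.
apply: emeasurable_funM; first exact: measurable_conj.
by apply/measurable_EFinP; apply: measurable_funTS; exact: measurable_powR.
Qed.

Lemma EfunE t : En t = ((t `^ np)%:E * \int[lebesgue_measure]_(s in `]t, +oo[%classic) Eint s)%E.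
Proof.
rewrite /Efun (_ : [set s : R | _] = `]t, +oo[%classic)//.
by apply/seteqP; split => s /=; rewrite in_itv/= andbT.
Qed.

Lemma Efun_ge0 t : (0 <= En t)%E.
Proof. by rewrite EfunE mule_ge0 ?lee_fin ?powR_ge0//; apply: integral_ge0 => s _; exact: Eint_ge0. Qed.

Lemma Efun_scale (c t : R) : 0 < c -> c <= 1 -> 0 <= t -> ((c `^ np)%:E * En t <= En (c * t)%R)%E.
Proof.
move=> c0 c1 t0; rewrite !EfunE (powRM _ (ltW c0) t0) muleA -EFinM; apply: lee_wpmul2l.
  by rewrite lee_fin mulr_ge0 ?powR_ge0.
apply: ge0_subset_integral => //.
- exact: measurable_Eint.
- by move=> s _; exact: Eint_ge0.
- move=> s /=; rewrite !in_itv/= !andbT; apply: le_lt_trans.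
  by rewrite ler_piMl.
Qed.

Local Notation q := ((2 : R) ^+ n.-1).
Local Notation G t := (\int[lebesgue_measure]_(s in `]t, +oo[%classic) Eint s)%E.

(** On []t, q t]] the conjugate is at least its value at [t], the power is at least its value at
    [q t], and the length [(q - 1) t] is at least [t] because [q >= 2]. *)
Lemma Eint_step (t : R) : 0 < t ->
  (tA t * (q `^ (- 1 - np) * t `^ (- np))%:E + G (q * t)%R <= G t)%E.
Proof.
move=> t0; have q2 : 2 <= q by rewrite -{1}[2]expr1 ler_weXn2l ?ler1n// -ltnS prednK// ltnW.
have q0 : 0 < q by rewrite exprn_gt0.
have tqt : t < q * t by rewrite ltr_pMl// (lt_le_trans _ q2)// ltr1n.
have -> : (`]t, +oo[ = `]t, (q * t)] `|` `](q * t)%R, +oo[)%classic.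
  by rewrite -itv_bndbnd_setU// bnd_simp// ltW.
rewrite ge0_integral_setU//=; last 3 first.
- exact: measurable_Eint.
- by move=> s _; exact: Eint_ge0.
- by apply/disj_setPS => s /= [] ; rewrite !in_itv/= andbT => /andP[_ h1]; rewrite ltNge h1.
apply: leeD => //.
have qt0 : 0 < q * t by rewrite mulr_gt0.
apply: (@le_trans _ _ (\int[lebesgue_measure]_(s in `]t, (q * t)%R]%classic) (tA t * ((q * t) `^ (- 1 - np))%R%:E))%E).
  rewrite integral_cst//= lebesgue_measure_itv/= lte_fin tqt -muleA; apply: lee_wpmul2l; first exact: conj_ge0.
  rewrite -EFinB -EFinM lee_fin powRM ?(ltW q0) ?(ltW t0)// -mulrA ler_wpM2l ?powR_ge0//.
  have -> : t `^ (- np) = t `^ (- 1 - np) * t.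
    rewrite -{3}[t]powRr1 ?ltW// -powRD; last by rewrite (gt_eqF t0) implybT.
    by congr (_ `^ _); lra.
  rewrite ler_wpM2l ?powR_ge0// lerBrDr; have := ler_wpM2r (ltW t0) q2.
  by rewrite mulr_natl mulr2n.
apply: ge0_le_integral => //=.
- by move=> s _; rewrite mule_ge0 ?conj_ge0// lee_fin powR_ge0.
- exact: measurable_Eint.
- move=> s; rewrite in_itv/= => /andP[ts sqt]; apply: lee_pmul.
  + exact: conj_ge0.
  + by rewrite lee_fin powR_ge0.
  + by apply: conj_le; exact: ltW.
  + rewrite lee_fin -opprD !powRN lef_pV2 ?posrE ?powR_gt0//; last exact: lt_trans ts.
    have s0 : 0 < s by exact: lt_trans ts.
    have h : 0 <= 1 + np by rewrite addr_ge0// ltW// (lt_trans _ nprime_gt1).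
    by apply: (ge0_ler_powR h); rewrite ?nnegrE// ltW.
Qed.

(** Lower Riemann sums of the integral in [Efun] on the grid [t q^k]; the factors [(q^k)^(-n')]
    equal [2^(-kn)]. *)
Lemma conj_sum_le (t : R) K : 0 < t ->
  (\sum_(k < K) ((2^-1 ^+ (k * n))%:E * tA (t * 2 ^+ (k * n.-1))%R) <= (q `^ (1 + np))%:E * En t)%E.
Proof.
move=> t0; have q0 : 0 < q by rewrite exprn_gt0.
pose c k : R := q `^ (- 1 - np) * (t * q ^+ k) `^ (- np).
have tk k : 0 < t * q ^+ k by rewrite mulr_gt0// exprn_gt0.
have H : (\sum_(k < K) (tA (t * q ^+ k)%R * (c k)%:E) + G (t * q ^+ K)%R <= G t)%E.
  elim: K => [|K IH]; first by rewrite big_ord0 add0e expr0 mulr1.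
  apply: le_trans IH; rewrite big_ord_recr/= -addeA; apply: leeD => //.
  by have := Eint_step (tk K); rewrite mulrCA -exprS.
have {}H : (\sum_(k < K) (tA (t * q ^+ k)%R * (c k)%:E) <= G t)%E.
  apply: le_trans H; rewrite leeDl//; apply: integral_ge0 => s _; exact: Eint_ge0.
rewrite EfunE muleA -EFinM.
have w0 : 0 <= q `^ (1 + np) * t `^ np by rewrite mulr_ge0 ?powR_ge0.
apply: (@le_trans _ _ ((q `^ (1 + np) * t `^ np)%:E * (\sum_(k < K) (tA (t * q ^+ k)%R * (c k)%:E)))%E); last first.
  by apply: lee_wpmul2l => //; rewrite lee_fin.
rewrite ge0_sume_distrr; last by move=> k _; rewrite mule_ge0 ?conj_ge0// lee_fin mulr_ge0 ?powR_ge0.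
rewrite le_eqVlt; apply/orP; left; apply/eqP; apply: eq_bigr => k _.
rewrite -exprM [(k * n.-1)%N]mulnC muleCA muleC -EFinM; congr (_ * (_)%:E)%E.
rewrite /c.
have -> : q `^ (1 + np) * t `^ np * (q `^ (- 1 - np) * (t * q ^+ k) `^ (- np)) =
  (q `^ (1 + np) * q `^ (- 1 - np)) * (t `^ np * t `^ (- np)) * (q ^+ k) `^ (- np).
  by rewrite powRM ?(ltW t0) ?exprn_ge0// ?(ltW q0)//; ring.
rewrite -opprD !powRN !divff ?gt_eqF ?powR_gt0// !mul1r exprAC.
rewrite powR_nprime ?exprn_ge0// exprVn -exprM//.
Qed.

Lemma powR_cvgy0 (p : R) : 0 < p -> x `^ (- p) @[x --> +oo] --> (0 : R).
Proof.
move=> p0; apply/cvgr0Pnorm_lt => e e0; near=> x.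
have x0 : 0 < x by near: x; exact: nbhs_pinfty_gt.
rewrite ger0_norm ?powR_ge0// powRN -[ltRHS]invrK ltf_pV2 ?posrE ?powR_gt0 ?invr_gt0//.
have -> : e^-1 = (e^-1 `^ p^-1) `^ p by rewrite -powRrM mulVf ?gt_eqF// powRr1// invr_ge0 ltW.
apply: gt0_ltr_powR => //; rewrite ?nnegrE ?powR_ge0 ?ltW//.
Unshelve. all: by end_near. Qed.

Lemma integral_powR_tail (c p : R) : 0 < c -> 0 < p ->
  (\int[lebesgue_measure]_(x in `[c, +oo[) (x `^ (- p - 1))%:E = (p^-1 * c `^ (- p))%:E)%E.
Proof.
move=> c0 p0.
pose F (x : R) : R := - p^-1 * x `^ (- p).
have dF (x : R) : 0 < x -> is_derive x 1 F (x `^ (- p - 1)).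
  move=> x0; have h := is_deriveZ (- p^-1) (is_derive1_powR (- p) x0).
  by apply: (is_derive_eq h); rewrite /GRing.scale/= mulrA mulrNN mulVf ?gt_eqF// mul1r.
have cF (x : R) : 0 < x -> {for x, continuous F}.
  move=> x0; apply: differentiable_continuous; apply/derivable1_diffP.
  by have [] := dF _ x0.
rewrite (@ge0_continuous_FTC2y R (fun x => x `^ (- p - 1)) F c 0).
- by rewrite /F sub0e mulNr EFinN oppeK.
- by move=> x _; exact: powR_ge0.
- apply: continuous_in_subspaceT => x; rewrite inE/= in_itv/= andbT => cx.
  have x0 := lt_le_trans c0 cx.
  apply: differentiable_continuous; apply/derivable1_diffP.
  by have [] := is_derive1_powR (- p - 1) x0.
- rewrite -[X in _ --> X](mulr0 (- p^-1)); apply: cvgMr; exact: powR_cvgy0.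
- by move=> x cx; have [] := dF _ (lt_trans c0 cx).
- by apply: cvg_at_right_filter; exact: cF.
- move=> x; rewrite in_itv/= andbT => cx; rewrite derive1E.
  by have [] := dF _ (lt_trans c0 cx).
Qed.

(** Truncating the argument gives a finite nondecreasing function on the whole line, whereas [A] is
    unconstrained at negative arguments. *)
Local Notation gA := (fun t : R => fine (A (Num.max 0 t))).

Lemma measurable_young_max D : measurable_fun D gA.
Proof.
apply: measurable_funTS; apply: nondecreasing_measurable => // x y xy.
have m0 z : 0 <= Num.max 0 z :> R by rewrite le_max lexx.
rewrite fine_le ?young_fin//; apply: young_le => //.
by rewrite ge_max m0/= le_max xy orbT.
Qed.

Lemma measurable_le_fst_snd (T : R) : measurable [set z : R * R | [/\ T < z.1, 0 < z.2 & gA z.2 <= z.1 * z.2]].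
Proof.
rewrite (_ : [set _ | _] = (fst @^-1` `]T, +oo[%classic) `&` (snd @^-1` `]0, +oo[%classic) `&`
   ((fun z : R * R => z.1 * z.2 - gA z.2) @^-1` `[0, +oo[%classic)).
  apply: measurableI; first apply: measurableI.
  - by rewrite -[X in measurable X]setTI; exact: measurable_fst.
  - by rewrite -[X in measurable X]setTI; exact: measurable_snd.
  - rewrite -[X in measurable X]setTI.
    suff : measurable_fun setT (fun z : R * R => z.1 * z.2 - gA z.2) by apply.
    apply: measurable_funB; first by apply: measurable_funM; [exact: measurable_fst|exact: measurable_snd].
    have mg : measurable_fun (setT : set R) gA by exact: measurable_young_max.
    exact: (measurableT_comp mg measurable_snd).
apply/seteqP; split => z /=; rewrite !in_itv/= !andbT subr_ge0; first by case.
by case=> -[].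
Qed.

(** A point [t] contributing a positive value to the supremum satisfies [A t <= s t]. By convexity
    all of []0, t]] does, so [t] is at most the measure of the set. *)
Lemma conj_le_measure (s : R) : 0 < s ->
  (tA s <= s%:E * lebesgue_measure [set t : R | (0 < t)%R /\ (gA t <= s * t)%R])%E.
Proof.
move=> s0; set X := [set t : R | _].
have X0 : (0 <= s%:E * lebesgue_measure X)%E by rewrite mule_ge0// lee_fin ltW.
apply: ge_ereal_sup => _ [t /= t0 <-].
rewrite youngE// -EFinB.
have [ts|ts] := ltP (t * s) (fine (A t)).
  by apply: le_trans X0; rewrite lee_fin subr_le0 ltW.
apply: (@le_trans _ _ (s%:E * lebesgue_measure (`]0%R, t]%classic : set R))%E).
  rewrite lebesgue_measure_itv/= lte_fin; case: ltP => h.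
    by rewrite oppr0 adde0 -EFinM lee_fin mulrC lerBlDr lerDl fine_ge0// young_ge0.
  by rewrite mule0 lee_fin subr_le0 (_ : t = 0) ?mul0r ?young0//; apply/eqP; rewrite eq_le h t0.
apply: lee_wpmul2l; first by rewrite lee_fin ltW.
apply: le_measure; rewrite ?inE//.
- rewrite (_ : X = `]0, +oo[%classic `&` ((fun t : R => s * t - gA t) @^-1` `[0, +oo[%classic)).
    apply: measurableI => //; rewrite -[X in measurable X]setTI.
    suff : measurable_fun setT (fun t : R => s * t - gA t) by apply.
    by apply: measurable_funB; [apply: measurable_funM|exact: measurable_young_max].
  by apply/seteqP; split => z /=; rewrite !in_itv/= !andbT subr_ge0.
- move=> x /=; rewrite in_itv/= => /andP[x0 xt]; split => //.
  have tp : 0 < t by exact: lt_le_trans xt.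
  have -> : Num.max 0 x = x by apply/max_idPr; exact: ltW.
  have c1 : x / t <= 1 by rewrite ler_pdivrMr// mul1r.
  have c0 : 0 <= x / t by rewrite divr_ge0// ltW.
  have := young_scale c0 c1 t0; rewrite divfK ?gt_eqF// youngE ?(ltW x0)// [A t]youngE// -EFinM lee_fin.
  move/le_trans; apply; rewrite mulrAC ler_pdivrMr//.
  by rewrite [s * x]mulrC -mulrA ler_wpM2l ?(ltW x0)// mulrC.
Qed.

(** By [conj_le_measure] the integral in [Efun] is at most a double integral of [s^(-n')] over
    [A t <= s t]. Integrating first in [s] leaves a power of [t / A t], whose exponent
    [n' - 1 = 1 / (n-1)] is the one in (C1). *)
Lemma Efun1_lty : C1 n A -> (En 1 < +oo)%E.
Proof.
move=> [_ /(_ n2)[T [T0 Tfin]]].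
have p0 : 0 < np - 1 by rewrite subr_gt0 nprime_gt1.
rewrite EfunE powR1 mul1e.
pose X := [set z : R * R | [/\ 1 < z.1, 0 < z.2 & gA z.2 <= z.1 * z.2]].
pose f (z : R * R) : \bar R := (\1_X z * z.1 `^ (- np))%:E.
have f0 z : (0 <= f z)%E by rewrite lee_fin mulr_ge0 ?powR_ge0// indicE ler0n.
have mf : measurable_fun setT f.
  apply/measurable_EFinP; apply: measurable_funM.
    by apply: measurable_indic; exact: measurable_le_fst_snd.
  exact: (measurableT_comp (measurable_powR (- np)) measurable_fst).
apply: (@le_lt_trans _ _ (\int[lebesgue_measure]_s \int[lebesgue_measure]_t f (s, t))%E).
  rewrite integral_mkcond; apply: ge0_le_integral => //.
  - by move=> s _; rewrite patchE; case: ifP => // _; exact: Eint_ge0.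
  - by apply/(measurable_restrictT Eint (measurable_itv `]1%R, +oo[)); exact: measurable_Eint.
  - exact: measurable_fun_fubini_tonelli_F.
  - move=> s _; rewrite patchE; case: ifPn => [|_]; last by apply: integral_ge0 => t _.
    rewrite inE/= in_itv/= andbT => s1; have s0 : 0 < s by exact: lt_trans s1.
    rewrite /Eint; apply: (@le_trans _ _ ((s%:E * lebesgue_measure [set t : R | (0 < t)%R /\ (gA t <= s * t)%R]) * (s `^ (-1 - np))%:E)%E).
      by apply: lee_wpmul2r; [rewrite lee_fin powR_ge0|exact: conj_le_measure].
    set Y := [set t : R | _].
    have mY : measurable Y.
      have -> : Y = xsection X s.
        by apply/seteqP; split => t; rewrite /xsection/= inE/=; [move=> []|move=> []].
      by apply: measurable_xsection; exact: measurable_le_fst_snd.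
    rewrite (_ : (\int[_]_t _)%E = \int[lebesgue_measure]_t ((s `^ (- np))%:E * (\1_Y t)%:E))%E; last first.
      apply: eq_integral => t _; rewrite /f/= -EFinM mulrC; congr (_ * _)%:E.
      rewrite !indicE; congr (_%:R); congr nat_of_bool.
      by apply/idP/idP; rewrite !inE /X /Y/= => -[].
    rewrite ge0_integralZl_EFin ?powR_ge0//; last first.
      by apply/measurable_EFinP; exact: measurable_indic.
    rewrite integral_indic// setIT [X in (X * _)%E]muleC -muleA muleC -EFinM.
    have -> // : s * s `^ (-1 - np) = s `^ (- np).
    rewrite -{1}[s]powRr1 ?ltW// -powRD; last by rewrite (gt_eqF s0) implybT.
    by congr (_ `^ _); lra.
rewrite fubini_tonelli//.
(* Bound for the inner integral: a constant on [[0, T]] and the integrand of (C1) beyond [T]. *)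
pose g (t : R) : \bar R := ((np - 1)^-1%:E * ((\1_(`[0%R, T]%classic) t)%:E +
   ((fun t => (ratioA A t `^ n.-1%:R^-1)%:E) \_ [set t : R | (T <= t)%R]) t))%E.
have mr : measurable_fun [set t : R | T <= t] (fun t => (ratioA A t `^ n.-1%:R^-1)%:E).
  apply/measurable_EFinP; apply: (measurableT_comp (measurable_powR _)).
  have mg : measurable_fun (setT : set R) gA by exact: measurable_young_max.
  have h := measurable_funM (@measurable_id _ R setT) (measurableT_comp (measurable_powR (-1)) mg).
  apply: (eq_measurable_fun _ _ (measurable_funTS h)) => t; rewrite inE/= => Tt.
  have t0 : 0 < t by exact: lt_le_trans Tt.
  by rewrite /ratioA (_ : Num.max 0 t = t) ?powR_inv1 ?ltW ?young_fine_gt0//; apply/max_idPr; exact: ltW.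
have mT : measurable [set t : R | T <= t].
  rewrite (_ : [set _ | _] = `[T, +oo[%classic)//.
  by apply/seteqP; split => t /=; rewrite in_itv/= andbT.
have mrT := (measurable_restrictT _ mT).1 mr.
have mi : measurable_fun setT (fun t : R => (\1_(`[0%R, T]%classic) t)%:E : \bar R).
  by apply/measurable_EFinP; exact: measurable_indic.
have r0 (t : R) : (0 <= ((fun t => (ratioA A t `^ n.-1%:R^-1)%:E) \_ [set t : R | (T <= t)%R]) t)%E.
  by rewrite patchE; case: ifP => // _; rewrite lee_fin powR_ge0.
apply: (@le_lt_trans _ _ (\int[lebesgue_measure]_t g t)%E).
  apply: ge0_le_integral => //.
  - by move=> t _; apply: integral_ge0 => s _.
  - exact: measurable_fun_fubini_tonelli_G.
  - by apply: emeasurable_funM; [exact: measurable_cst|exact: emeasurable_funD].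
  move=> t _; have [t0|t0] := leP t 0.
    rewrite integral0_eq; last first.
      move=> s _; rewrite /f indicE memNset ?mul0r// => -[_ /= + _].
      by rewrite ltNge t0.
    by rewrite mule_ge0 ?adde_ge0// lee_fin ?invr_ge0 ?ltW// indicE ler0n.
  (* For fixed [t], every [s] with [(s, t)] in [X] is at least [c]. *)
  pose c := Num.max 1 (fine (A t) / t).
  have c1 : 1 <= c by rewrite le_max lexx.
  have c0 : 0 < c by exact: lt_le_trans c1.
  have at0 := young_fine_gt0 t0.
  apply: (@le_trans _ _ (\int[lebesgue_measure]_s ((fun s => (s `^ (- (np - 1) - 1))%:E) \_ `[c, +oo[%classic) s)%E).
    have e : - (np - 1) - 1 = - np by lra.
    apply: ge0_le_integral => //.
    - exact: (measurableT_comp mf (measurable_pair2 t)).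
    - apply/(measurable_restrictT _ (measurable_itv `[c, +oo[)).
      by apply/measurable_EFinP; apply: measurable_funTS; exact: measurable_powR.
    - move=> s _; rewrite patchE e /f indicE/=.
      case: (boolP ((s, t) \in X)) => [|_]; last first.
        by rewrite mul0r; case: ifP => // _; rewrite lee_fin powR_ge0.
      rewrite inE => -[/= s1 _]; rewrite (_ : Num.max 0 t = t); last by apply/max_idPr; exact: ltW.
      move=> h; rewrite mul1r mem_set//= in_itv/= andbT ge_max (ltW s1)/=.
      by rewrite ler_pdivrMr.
  rewrite -integral_mkcond integral_powR_tail// /g EFinM; apply: lee_wpmul2l.
    by rewrite lee_fin invr_ge0 ltW.
  have [tT|tT] := leP t T.
    apply: (@le_trans _ _ 1%:E); last first.
      by rewrite indicE mem_set ?leeDl//= in_itv/= (ltW t0).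
    rewrite lee_fin powRN invf_le1 ?powR_gt0//.
    have h := ge0_ler_powR (ltW p0) (_ : 1 \in Num.nneg) (_ : c \in Num.nneg) c1.
    by rewrite powR1 in h; apply: h; rewrite nnegrE// ltW.
  apply: (@le_trans _ _ (ratioA A t `^ n.-1%:R^-1)%:E); last first.
    by rewrite patchE mem_set; [rewrite leeDr// lee_fin indicE ler0n|exact: ltW].
  have b0 : 0 < fine (A t) / t by rewrite divr_gt0.
  rewrite lee_fin /ratioA -[t / _]invf_div -nprimeE -powR_inv1 ?(ltW b0)// -powRrM mulN1r !powRN.
  rewrite lef_pV2 ?posrE ?powR_gt0//.
  by apply: (ge0_ler_powR (ltW p0)); rewrite ?nnegrE ?(ltW b0) ?(ltW c0)// le_max lexx orbT.
rewrite /g ge0_integralZl_EFin//; last 3 first.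
- by move=> t _; rewrite adde_ge0// lee_fin indicE ler0n.
- exact: emeasurable_funD.
- by rewrite invr_ge0 ltW.
rewrite ge0_integralD// -integral_mkcond.
have i1 : (\int[lebesgue_measure]_t ((\1_(`[0%R, T]%classic) t)%:E : \bar R) < +oo)%E.
  rewrite integral_indic//; apply: (@le_lt_trans _ _ (lebesgue_measure (`[0%R, T]%classic : set R))).
    by apply: le_measure; rewrite ?inE// setIT.
  by rewrite lebesgue_measure_itv/= lte_fin T0 oppr0 adde0 ltry.
apply: lte_mul_pinfty => //; first by rewrite lee_fin invr_ge0 ltW.
exact: lte_add_pinfty.
Qed.

(** Scaling follows from [E (c^(n-1) y) >= c^n E y] after substituting [x = c^(n-1) y] in the
    supremum. Boundedness follows from [B t >= t - E 1], finite by (C1). Small values follow from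
    the lower bound of [E] by a multiple of [young_conj A]. *)
Lemma good_B2 : C1 n A -> good_B n A.
Proof.
move=> /Efun1_lty E1; have n1 : (n == 1%N) = false by rewrite gtn_eqF.
have q0 : 0 < q `^ (1 + np) by rewrite powR_gt0// exprn_gt0.
have n0 : (0 < n)%N by exact: ltn_trans n2.
rewrite /good_B /Bfun n1; split.
- move=> c t c0 c1 t0; apply: ge_ereal_sup => _ [x /= x0 <-].
  have cn0 : 0 < c ^+ n.-1 by rewrite exprn_gt0.
  have cnn0 : 0 < c ^+ n by rewrite exprn_gt0.
  pose y := x / c ^+ n.-1.
  have y0 : 0 <= y by rewrite divr_ge0// ltW.
  have xE : x = c ^+ n.-1 * y by rewrite mulrC divfK// gt_eqF.
  have h := Efun_scale cn0 (exprn_ile1 _ (ltW c0) c1) y0; rewrite -xE powR_nprime ?(ltW c0)// in h.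
  have hB : ((y * t)%:E - En y <= young_conj En t)%E by apply: ereal_sup_ubound; exists y.
  apply: (@le_trans _ _ ((c ^+ n)%:E * ((y * t)%:E - En y))%E); last first.
    by apply: lee_wpmul2l => //; rewrite lee_fin ltW.
  have e : x * (c * t) = c ^+ n * (y * t).
    by rewrite xE -[in c ^+ n](prednK n0) exprS; ring.
  move: (Efun_ge0 y) h; case: (En y) => [w| |//] _ h.
    by rewrite muleBr// -EFinM -e leeB.
  (* If [E y] is infinite, so is [E x], and the term of the supremum is minus infinity. *)
  rewrite gt0_muley ?lte_fin// leye_eq in h; move/eqP: h => ->.
  by rewrite leNye.
- move=> y; exists ((y + fine (En 1)) / 1) => t [t0 ty].
  rewrite divr1.
  have h : ((1 * t)%:E - En 1 <= young_conj En t)%E by apply: ereal_sup_ubound; exists 1 => //=.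
  have Ef : En 1 \is a fin_num by rewrite ge0_fin_numE ?Efun_ge0.
  have := le_trans h ty; rewrite mul1r -[En 1]fineK// leeBlDr// -EFinD lee_fin.
- move=> y y0.
  pose d := Num.min 1 (y / fine (A 1)).
  have a0 := young_fine_gt0 ltr01.
  have d0 : 0 < d by rewrite lt_min ltr01 divr_gt0.
  have d1 : d <= 1 by rewrite ge_min lexx.
  have Ad : fine (A d) <= y.
    rewrite -lee_fin -youngE ?(ltW d0)//; have := young_scale (ltW d0) d1 ler01; rewrite mulr1.
    move/le_trans; apply; rewrite youngE// -EFinM lee_fin -ler_pdivlMr// ge_min lexx orbT//.
  set C := q `^ (1 + np) in q0.
  have C1 : 1 <= C.
    have q1 : 1 <= q by rewrite exprn_ege1// ler1n.
    have h : 0 <= 1 + np by rewrite addr_ge0// ltW// (lt_trans _ nprime_gt1).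
    have := ge0_ler_powR h (_ : 1 \in Num.nneg) (_ : q \in Num.nneg) q1.
    by rewrite powR1; apply; rewrite nnegrE// exprn_ge0.
  exists (d / C); first by rewrite divr_gt0.
  apply: ge_ereal_sup => _ [x /= x0 <-].
  have [->|xN] := eqVneq x 0.
    by rewrite mul0r sub0e; apply: (@le_trans _ _ 0%E); [rewrite oppe_le0 Efun_ge0|rewrite lee_fin ltW].
  have {}x0 : 0 < x by rewrite lt_neqAle eq_sym xN.
  (* The single term [k = 0] gives [young_conj A x <= C * E x], hence [d x - A d <= C * E x]. *)
  have := conj_sum_le 1 x0; rewrite big_ord1 mul0n !expr0 mul1e mulr1 -/C => h.
  have := le_trans (conj_ge x (ltW d0)) h; rewrite youngE ?(ltW d0)//.
  move: (Efun_ge0 x); case: (En x) => [w| |//] _; last by rewrite leNye.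
  rewrite -EFinB -!EFinM -EFinB !lee_fin => h2.
  have -> : x * (d / C) - w = (d * x - C * w) / C by field; rewrite gt_eqF.
  rewrite ler_pdivrMr//; apply: (@le_trans _ _ (fine (A d))); first lra.
  by apply: (le_trans Ad); rewrite ler_peMr// ltW.
Qed.
End young_theory.

(** * Oscillation on a cube *)

Lemma dist_triangle (R : realType) (p q s : R) : `|p - q| <= `|s - q| + `|s - p|.
Proof. by rewrite [leRHS]addrC [`|s - p|]distrC; apply: le_trans (ler_normD _ _); rewrite addrA subrK. Qed.

Section morrey.
Context {R : realType} {n : nat} {A : R -> \bar R}.
Local Notation mu := (@lebesgue_n R n).
Local Notation bm := (@bmass R n).
Hypotheses (n0 : (0 < n)%N) (yA : young A) (c2 : C2 A).
Variables (D : set 'rV[R]_n) (v h : 'rV[R]_n -> R) (g : 'I_n -> 'rV[R]_n -> R) (L : R).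
Hypotheses (oD : open D) (wv : weak1 D v g) (L0 : 0 < L).
Hypotheses (mh : lmeasurable_fun D h) (h0 : forall z, 0 <= h z).
Hypothesis gh : forall z, \sum_(j < n) `|g j z| <= L * h z.

(** Corner of the cube contracted towards [x] by the factor [c]; the contracted cube need not be
    centred at [x]. *)
Definition shrink (a x : 'rV[R]_n) (c : R) : 'rV[R]_n := x + c *: (a - x).

Lemma shrinkP a x (c r : R) z : cube (shrink a x c) (c * r) z <->
  forall i, x ord0 i + c * (a ord0 i - x ord0 i) <= z ord0 i <= x ord0 i + c * (a ord0 i + r - x ord0 i).
Proof.
split => [/cubeP H i|H]; last (apply/cubeP => i); have := H i; rewrite !mxE.
  suff -> : x ord0 i + c * (a ord0 i + r - x ord0 i) = x ord0 i + c * (a ord0 i - x ord0 i) + c * r by [].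
  ring.
suff -> : x ord0 i + c * (a ord0 i + r - x ord0 i) = x ord0 i + c * (a ord0 i - x ord0 i) + c * r by [].
ring.
Qed.

Lemma shrink_sub a x (c d r : R) : cube a r x -> c <= d ->
  cube (shrink a x c) (c * r) `<=` cube (shrink a x d) (d * r).
Proof.
move=> /cubeP ax cd z /shrinkP cz; apply/shrinkP => i; have /andP[h1 h2] := cz i.
have /andP[x1 x2] := ax i; apply/andP; split.
  apply: le_trans h1; rewrite lerD2l -subr_ge0 -mulrBl mulr_le0// ?subr_le0//.
by apply: (le_trans h2); rewrite lerD2l ler_wpM2r// subr_ge0.
Qed.

Lemma shrink1 a x (r : R) : cube (shrink a x 1) (1 * r) = cube a r.
Proof. by rewrite mul1r /shrink scale1r addrC subrK. Qed.

Lemma shrink_sub1 a x (c r : R) : cube a r x -> c <= 1 -> cube (shrink a x c) (c * r) `<=` cube a r.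
Proof. by move=> ax c1; rewrite -(shrink1 a x r); exact: shrink_sub. Qed.

Lemma bavg_fin a r : cube a r `<=` D -> 0 < r -> bavg D v a r \is a fin_num.
Proof.
move=> aD r0; case: wv => lv _ _.
exact: integrable_lint (measurable_open oD) (integrable_bump oD lv aD r0).
Qed.

Lemma bavg_cvg a r x : cube a r `<=` D -> 0 < r -> cube a r x -> {for x, continuous v} ->
  forall e : R, 0 < e -> exists2 c : R, 0 < c & forall d : R, 0 < d -> d <= c -> d <= 1 ->
    `| fine (bavg D v (shrink a x d) (d * r)) - bm * v x | <= e.
Proof.
move=> aD r0 ax cv e e0; case: wv => lv _ _.
have b0 := @bmass_gt0 R n n0.
have eb0 : 0 < e / bm by rewrite divr_gt0.
move/cvgrPdist_lt : cv => /(_ _ eb0)/nbhs_ballP[t /= t0 tP].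
exists (t / 2 / r); first by rewrite !divr_gt0.
move=> d d0 dt d1.
have dr0 : 0 < d * r by rewrite mulr_gt0.
have sD : cube (shrink a x d) (d * r) `<=` D by apply: subset_trans aD; exact: shrink_sub1.
rewrite -lee_fin; apply: le_trans (_ : (e / bm * bm)%:E <= _)%E; last by rewrite divfK// gt_eqF.
have := bavg_close oD lv sD dr0 (x := x) (e := e / bm).
rewrite -[bavg _ _ _ _]fineK ?bavg_fin// -EFinB; apply => z /shrinkP xz.
rewrite distrC ltW//; apply: tP; split => // i j; rewrite (ord1 i).
have /cubeP/(_ j)/andP[x1 x2] := ax; have /andP[z1 z2] := xz j.
rewrite /ball/=; apply: (@le_lt_trans _ _ (d * r)); last first.
  apply: (@le_lt_trans _ _ (t / 2)); first by rewrite -ler_pdivlMr.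
  by rewrite ltr_pdivrMr// ltr_pMr// ltr1n.
rewrite distrC ler_norml; apply/andP; split.
  rewrite lerBrDr addrC; apply: le_trans z1; rewrite lerD2l -mulrN ler_wpM2l ?(ltW d0)//.
  by rewrite lerNl opprB lerBlDr addrC.
rewrite lerBlDr addrC; apply: (le_trans z2); rewrite lerD2l ler_wpM2l ?(ltW d0)//.
by rewrite lerBlDr addrC lerD2l.
Qed.

Variable H : R.
Hypotheses (H1 : 1 <= H) (hH : forall x : R, stepH x <= H).

Local Notation beta a r x c := (fine (bavg D v (shrink a x c) (c * r))).

Lemma beta_step a r x (c d : R) : cube a r `<=` D -> 0 < r -> cube a r x -> 0 < c -> c <= d -> d <= 1 ->
  ((`| beta a r x c - beta a r x d |)%:E <=
   lint D (fun z => ((H / (c * r)) ^+ n.-1 * \1_(cube (shrink a x d) (d * r)) z * \sum_(j < n) `|g j z|)%:E))%E.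
Proof.
move=> aD r0 ax c0 cd d1.
have d0 : 0 < d by exact: lt_le_trans cd.
have dD : cube (shrink a x d) (d * r) `<=` D by apply: subset_trans aD; exact: shrink_sub1.
have cdS := @shrink_sub a x c d r ax cd.
have := bavg_step oD wv H1 hH (mulr_gt0 c0 r0) (_ : c * r <= d * r) cdS dD.
rewrite ler_wpM2r ?(ltW r0)// => /(_ isT).
rewrite -[bavg D v (shrink a x c) _]fineK; last by apply: bavg_fin; [exact: subset_trans dD|exact: mulr_gt0].
by rewrite -[bavg D v (shrink a x d) _]fineK; last by apply: bavg_fin; [|exact: mulr_gt0].
Qed.

Local Notation hf k := (2^-1 ^+ k : R).

(** The weight that [K] successive uses of [beta_step] put on the gradient. *)
Definition wsum a r x K (z : 'rV[R]_n) : R :=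
  \sum_(k < K) (H / (hf k.+1 * r)) ^+ n.-1 * \1_(cube (shrink a x (hf k)) (hf k * r)) z.

Lemma hf_gt0 k : 0 < hf k. Proof. by rewrite exprn_gt0// invr_gt0. Qed.

Lemma hf_le1 k : hf k <= 1. Proof. by rewrite exprn_ile1// ?invr_ge0// invf_le1// ler1n. Qed.

Lemma H_gt0 : 0 < H. Proof. exact: lt_le_trans H1. Qed.

Lemma measurable_gsum : @measurable_fun _ _ (Leb R n) R D (fun z => \sum_(j < n) `|g j z|).
Proof.
case: wv => _ lg _; apply: measurable_sum => j; apply: (measurableT_comp (@normr_measurable R setT)).
by case: (lg j).
Qed.

Lemma measurable_wsum a r x K : @measurable_fun _ _ (Leb R n) R D (wsum a r x K).
Proof.
apply: measurable_sum => k; apply: measurable_funM; first exact: measurable_cst.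
by apply: measurable_indic; exact: measurable_cbox.
Qed.

Lemma wsum_ge0 a r x K z : 0 < r -> 0 <= wsum a r x K z.
Proof.
move=> r0; apply: sumr_ge0 => k _; rewrite mulr_ge0// ?indicE ?ler0n// exprn_ge0//.
by rewrite divr_ge0 ?(ltW H_gt0)// mulr_ge0 ?(ltW r0)// ltW// hf_gt0.
Qed.

Lemma beta_chain a r x K : cube a r `<=` D -> 0 < r -> cube a r x ->
  ((`| beta a r x (hf K) - beta a r x 1 |)%:E <=
   lint D (fun z => (wsum a r x K z * \sum_(j < n) `|g j z|)%:E))%E.
Proof.
move=> aD r0 ax; have mD := measurable_open oD.
elim: K => [|K IH].
  by rewrite expr0 subrr normr0; apply: integral_ge0 => z _; rewrite lee_fin mulr_ge0 ?wsum_ge0// sumr_ge0.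
have hK : hf K.+1 <= hf K.
  by rewrite exprS ger_pMl ?hf_gt0// invf_le1// ler1n.
have st := beta_step aD r0 ax (hf_gt0 K.+1) hK (hf_le1 K).
apply: (@le_trans _ _ ((`|beta a r x (hf K.+1) - beta a r x (hf K)|)%:E + (`|beta a r x (hf K) - beta a r x 1|)%:E)%E).
  rewrite -EFinD lee_fin; apply: le_trans (ler_normD _ _).
  by rewrite addrA subrK.
apply: (le_trans (leeD st IH)).
have t0 z : 0 <= (H / (hf K.+1 * r)) ^+ n.-1 * \1_(cube (shrink a x (hf K)) (hf K * r)) z.
  rewrite mulr_ge0// ?indicE ?ler0n// exprn_ge0//.
  by rewrite divr_ge0 ?(ltW H_gt0)// mulr_ge0 ?(ltW r0)// ltW// hf_gt0.
have S0 z : 0 <= \sum_(j < n) `|g j z| by rewrite sumr_ge0.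
have -> : (fun z => (wsum a r x K.+1 z * \sum_(j < n) `|g j z|)%:E) =
  (fun z => ((H / (hf K.+1 * r)) ^+ n.-1 * \1_(cube (shrink a x (hf K)) (hf K * r)) z * \sum_(j < n) `|g j z|)%:E +
    (wsum a r x K z * \sum_(j < n) `|g j z|)%:E)%E.
  by apply/funext => z; rewrite -EFinD -mulrDl {1}/wsum big_ord_recr/= addrC.
rewrite /lint (ge0_integralD mu mD).
- exact: lexx.
- by move=> z _; rewrite lee_fin mulr_ge0.
- apply/measurable_EFinP; apply: measurable_funM; last exact: measurable_gsum.
  apply: measurable_funM; first exact: measurable_cst.
  by apply: measurable_indic; exact: measurable_cbox.
- by move=> z _; rewrite lee_fin mulr_ge0// wsum_ge0.
- by apply/measurable_EFinP; apply: measurable_funM; [exact: measurable_wsum|exact: measurable_gsum].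
Qed.

Local Notation tA := (young_conj A).
Local Notation coeff r k := ((2 * H / r) ^+ n.-1 * 2 ^+ (k * n.-1)).

Lemma coeffE (r : R) k : 0 < r -> (H / (hf k.+1 * r)) ^+ n.-1 = coeff r k.
Proof.
move=> r0; rewrite exprM -exprMn; congr (_ ^+ _).
rewrite exprS exprVn; field.
by rewrite !gt_eqF ?exprn_gt0.
Qed.

Lemma coeff_gt0 (r : R) k : 0 < r -> 0 < coeff r k.
Proof. by move=> r0; rewrite mulr_gt0 ?exprn_gt0// divr_gt0// mulr_gt0// H_gt0. Qed.

(** The coefficients grow geometrically with ratio [2^(n-1) >= 2], so the last one dominates the
    sum. *)
Lemma coeff_sum (r : R) K : (2 <= n)%N -> 0 < r -> \sum_(k < K.+1) coeff r k <= 2 * coeff r K.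
Proof.
move=> n2 r0; elim: K => [|K IH].
  by rewrite big_ord1 ler_peMl ?ler1n// ltW// coeff_gt0.
rewrite big_ord_recr/=; apply: (@le_trans _ _ (coeff r K.+1 + coeff r K.+1)); last by rewrite [leRHS]mulr_natl mulr2n.
rewrite lerD2r; apply: (le_trans IH).
rewrite mulrCA ler_wpM2l//; first by rewrite exprn_ge0// divr_ge0 ?(ltW r0)// mulr_ge0// ltW// H_gt0.
rewrite mulSn exprD ler_wpM2r ?exprn_ge0//.
by rewrite -{1}[2]expr1 ler_weXn2l ?ler1n// -ltnS prednK// ltnW.
Qed.

Lemma wsum_conj a r x K z (th : R) : (2 <= n)%N -> 0 < r -> 0 <= th ->
  (tA (th * wsum a r x K z)%R <=
   \sum_(k < K) (tA (th * (2 * coeff r k))%R * (\1_(cube (shrink a x (hf k)) (hf k * r)) z)%:E))%E.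
Proof.
move=> n2 r0 th0; elim: K => [|K IH].
  rewrite /wsum !big_ord0 mulr0; apply: ge_ereal_sup => _ [s /= s0 <-].
  by rewrite mulr0 sub0e oppe_le0 young_ge0.
rewrite big_ord_recr/= {1}/wsum big_ord_recr/= -/(wsum a r x K z).
rewrite indicE; case: (boolP (z \in _)) => zQ; last by rewrite mulr0 addr0 mule0 adde0.
rewrite mulr1 mule1; apply: le_trans (_ : tA (th * (2 * coeff r K)) <= _)%E; last first.
  by rewrite leeDr// sume_ge0// => k _; rewrite mule_ge0 ?conj_ge0// lee_fin indicE ler0n.
apply: conj_le => //; rewrite ler_wpM2l//; apply: le_trans (coeff_sum K n2 r0).
rewrite big_ord_recr/= coeffE// lerD2r; apply: ler_sum => k _; rewrite coeffE//.
by rewrite ler_piMr ?(ltW (coeff_gt0 _ _))// indicE; case: (_ \in _).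
Qed.

Lemma measurable_young_comp : @measurable_fun _ _ (Leb R n) (\bar R) D (fun z => A (h z)).
Proof.
have -> : (fun z => A (h z)) = (fun z => (fine (A (Num.max 0 (h z))))%:E).
  by apply/funext => z; rewrite (_ : Num.max 0 (h z) = h z) -?youngE//; apply/max_idPr.
apply/measurable_EFinP.
have mg : measurable_fun (setT : set R) (fun t : R => fine (A (Num.max 0 t))) by exact: measurable_young_max.
exact: (measurableT_comp mg mh).
Qed.

(** Young's inequality is applied pointwise to [h z] and the weight. The [k]-th cube has volume
    [2^(-kn) r^n], so integrating the conjugate terms gives the sum estimated by [conj_sum_le]. *)
Lemma beta_young a r x K (t M : R) : (2 <= n)%N -> cube a r `<=` D -> 0 < r -> cube a r x -> 0 < t ->
  (lint (cube a r) (fun z => A (h z)) <= M%:E)%E ->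
  ((t / (2 * L * (2 * H / r) ^+ n.-1) * `| beta a r x (hf K) - beta a r x 1 |)%:E <=
   M%:E + (r ^+ n * (2 ^+ n.-1) `^ (1 + nprime R n))%:E * Efun n A t)%E.
Proof.
move=> n2 aD r0 ax t0 hM; have mD := measurable_open oD.
have Hr0 : 0 < (2 * H / r) ^+ n.-1 by rewrite exprn_gt0// divr_gt0// mulr_gt0// H_gt0.
(* Normalised so that the conjugate is evaluated exactly at the grid points [t 2^(k(n-1))]. *)
set th := t / _.
have th0 : 0 < th by rewrite divr_gt0// mulr_gt0// mulr_gt0.
have thL k : th * L * (2 * coeff r k) = t * 2 ^+ (k * n.-1).
  by rewrite /th; field; rewrite !gt_eqF.
have mK : @measurable _ (Leb R n) (cube a r) by exact: measurable_cbox.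
have mQ k : @measurable _ (Leb R n) (cube (shrink a x (hf k)) (hf k * r)) by exact: measurable_cbox.
pose F1 := (fun z : Leb R n => A (h z)) \_ (cube a r : set (Leb R n)).
pose T k (z : Leb R n) := (tA (t * 2 ^+ (k * n.-1))%R * (\1_(cube (shrink a x (hf k)) (hf k * r)) z)%:E)%E.
have T0 k z : (0 <= T k z)%E by rewrite mule_ge0 ?conj_ge0// lee_fin indicE ler0n.
have mT k : measurable_fun (D : set (Leb R n)) (T k).
  apply: emeasurable_funM; first exact: measurable_cst.
  by apply/measurable_EFinP; apply: measurable_indic; exact: mQ.
have F10 z : (0 <= F1 z)%E by rewrite /F1 patchE; case: ifP => // _; exact: young_ge0.
have mF1 : measurable_fun (D : set (Leb R n)) F1.
  apply/(measurable_restrict _ mK mD).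
  have sD : D `&` cube a r `<=` D by move=> z [].
  exact: (measurable_funS mD sD measurable_young_comp).
have mTs : measurable_fun (D : set (Leb R n)) (fun z => \sum_(k < K) T k z).
  exact: (emeasurable_sum _ (fun k : 'I_K => mT k)).
have bc := beta_chain K aD r0 ax.
apply: (@le_trans _ _ (th%:E * lint D (fun z => (wsum a r x K z * \sum_(j < n) `|g j z|)%:E))%E).
  by rewrite EFinM; apply: lee_wpmul2l => //; rewrite lee_fin ltW.
rewrite /lint -(ge0_integralZl_EFin _ mD _ _ (ltW th0)); first last.
- by apply/measurable_EFinP; apply: measurable_funM; [exact: measurable_wsum|exact: measurable_gsum].
- by move=> z _; rewrite lee_fin mulr_ge0 ?wsum_ge0// sumr_ge0.
apply: (@le_trans _ _ (\int[mu]_(z in (D : set (Leb R n))) (F1 z + \sum_(k < K) T k z))%E).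
  apply: (ge0_le_integral _ mD).
  - by move=> z _; rewrite -EFinM lee_fin mulr_ge0 ?(ltW th0)// mulr_ge0 ?wsum_ge0// sumr_ge0.
  - apply: emeasurable_funM; first exact: measurable_cst.
    by apply/measurable_EFinP; apply: measurable_funM; [exact: measurable_wsum|exact: measurable_gsum].
  - exact: (emeasurable_funD mF1 mTs).
  - move=> z _; rewrite /F1 patchE; case: ifPn => zQ; last first.
      rewrite (_ : wsum a r x K z = 0) ?mul0r ?mule0 ?add0e ?sume_ge0//.
      rewrite /wsum big1// => k _; rewrite indicE memNset ?mulr0// => zk.
      by move/negP: zQ; apply; rewrite inE; apply: shrink_sub1 zk => //; exact: hf_le1.
    apply: (@le_trans _ _ (h z * (th * L * wsum a r x K z))%:E).
      rewrite -EFinM lee_fin; apply: (@le_trans _ _ (th * (wsum a r x K z * (L * h z)))).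
        by rewrite ler_wpM2l ?(ltW th0)// ler_wpM2l ?wsum_ge0.
      by rewrite le_eqVlt; apply/orP; left; apply/eqP; ring.
    apply: (le_trans (conj_young yA c2 (th * L * wsum a r x K z) (h0 z))); apply: leeD2l.
    apply: (le_trans (wsum_conj a x K z n2 r0 (mulr_ge0 (ltW th0) (ltW L0)))).
    by apply: lee_sum => k _; rewrite thL.
rewrite (ge0_integralD mu mD); first last.
- exact: mTs.
- by move=> z _; exact: sume_ge0.
- exact: mF1.
- by move=> z _; exact: F10.
apply: leeD.
  rewrite /F1 -integral_mkcondr (_ : _ `&` _ = cube a r)//.
  by apply/seteqP; split => [z []//|z Qz]; split => //; exact: aD.
rewrite (ge0_integral_sum mu mD (fun k : 'I_K => mT k) (fun (k : 'I_K) z _ => T0 k z)).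
apply: (@le_trans _ _ (\sum_(k < K) (r ^+ n)%:E * ((2^-1 ^+ (k * n))%:E * tA (t * 2 ^+ (k * n.-1))%R))%E).
  apply: lee_sum => k _.
  have mi : measurable_fun (D : set (Leb R n))
      (fun z : Leb R n => (\1_(cube (shrink a x (hf k)) (hf k * r)) z)%:E : \bar R).
    by apply/measurable_EFinP; apply: measurable_indic; exact: mQ.
  rewrite /T (ge0_integralZl mu mD mi); first last.
  - exact: conj_ge0.
  - by move=> z _; rewrite lee_fin indicE ler0n.
  rewrite (integral_indic mu mD (mQ k)) muleC [leRHS]muleA; apply: lee_wpmul2r; first exact: conj_ge0.
  apply: (@le_trans _ _ (mu (cube (shrink a x (hf k)) (hf k * r)))).
    by apply: (le_outer_measure (@leb_outer R n)) => z [].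
  apply: (le_trans (leb_cube_le _ _)); first by rewrite mulr_ge0 ?(ltW r0)// ltW// hf_gt0.
  by rewrite -EFinM lee_fin exprMn -exprM mulrC.
rewrite -ge0_sume_distrr; last by move=> k _; rewrite mule_ge0 ?conj_ge0// lee_fin exprn_ge0// invr_ge0.
rewrite EFinM -muleA; apply: lee_wpmul2l; first by rewrite lee_fin exprn_ge0// ltW.
exact: conj_sum_le.
Qed.

Lemma beta_limit a r x (th Z : R) : cube a r `<=` D -> 0 < r -> cube a r x -> {for x, continuous v} ->
  0 <= th -> (forall K, th * `| beta a r x (hf K) - beta a r x 1 | <= Z) ->
  th * `| bm * v x - fine (bavg D v a r) | <= Z.
Proof.
move=> aD r0 ax cv th0 hK; apply/ler_addgt0Pr => e e0.
have e1 : 0 < e / (th + 1) by rewrite divr_gt0// ltr_pwDr.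
have [c c0 hc] := bavg_cvg aD r0 ax cv e1.
have [K Kc] := dside_small c0.
have {hc} := hc (hf K) (hf_gt0 K); rewrite exprVn (ltW Kc) -exprVn hf_le1 => /(_ isT isT) h1.
have -> : fine (bavg D v a r) = beta a r x 1 by rewrite mul1r /shrink scale1r addrC subrK.
apply: (@le_trans _ _ (th * (`| beta a r x (hf K) - beta a r x 1 | + e / (th + 1)))).
  apply: ler_wpM2l; first exact: th0.
  by apply: (le_trans (dist_triangle _ _ (beta a r x (hf K)))); rewrite lerD2l.
rewrite mulrDr; apply: lerD; first exact: hK.
by rewrite mulrCA ger_pMr// ler_pdivrMr ?mul1r ?lerDl// ltr_pwDr.
Qed.

(** The contracted cubes of [x] and of [y] both start from the full cube, so the two chains share
    their first average and a triangle inequality compares [v x] with [v y]. *)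
Lemma dist_limit a r x y (th Z : R) : cube a r `<=` D -> 0 < r -> cube a r x -> cube a r y ->
  {for x, continuous v} -> {for y, continuous v} -> 0 <= th ->
  (forall K, th * `| beta a r x (hf K) - beta a r x 1 | <= Z) ->
  (forall K, th * `| beta a r y (hf K) - beta a r y 1 | <= Z) ->
  th * (bm * `|v x - v y|) <= Z *+ 2.
Proof.
move=> aD r0 ax ay cx cy th0 hx hy.
have h1 := beta_limit aD r0 ax cx th0 hx; have h2 := beta_limit aD r0 ay cy th0 hy.
rewrite -[X in th * (X * _)]gtr0_norm ?bmass_gt0// -normrM mulrBr.
apply: (@le_trans _ _ (th * (`|bm * v x - fine (bavg D v a r)| + `|bm * v y - fine (bavg D v a r)|))).
  apply: ler_wpM2l; first exact: th0.
  apply: (le_trans (dist_triangle _ _ (fine (bavg D v a r)))).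
  by rewrite [leLHS]addrC; apply: lerD; rewrite distrC lexx.
by rewrite mulrDr mulr2n; exact: lerD h1 h2.
Qed.

Local Notation CE := ((2 ^+ n.-1 : R) `^ (1 + nprime R n)).

Lemma lint_ge0_young a r (M : R) : (lint (cube a r) (fun z => A (h z)) <= M%:E)%E -> 0 <= M.
Proof.
by move=> hM; rewrite -lee_fin; apply: le_trans hM; apply: integral_ge0 => z _; exact: young_ge0.
Qed.

(** For every [t] the chain bounds [t] times the scaled oscillation minus [E t] by [M / r^n]; the
    supremum over [t] is [B]. *)
Lemma morrey_ge2 a r x y (M : R) : (2 <= n)%N -> cube a r `<=` D -> 0 < r -> cube a r x -> cube a r y ->
  {for x, continuous v} -> {for y, continuous v} ->
  (lint (cube a r) (fun z => A (h z)) <= M%:E)%E ->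
  (Bfun n A (bm / (4 * L * (2 * H) ^+ n.-1 * CE) * (`|v x - v y| / r))%R <= (M / r ^+ n)%:E)%E.
Proof.
move=> n2 aD r0 ax ay cx cy hM.
have M0 := lint_ge0_young hM.
(* Needed to absorb the term [M], which carries no factor [CE]. *)
have C1 : 1 <= CE.
  have q1 : 1 <= (2 : R) ^+ n.-1 by rewrite exprn_ege1// ler1n.
  have h1 : 0 <= 1 + nprime R n by rewrite addr_ge0// ltW// (lt_trans _ (nprime_gt1 n2)).
  have := ge0_ler_powR h1 (_ : 1 \in Num.nneg) (_ : 2 ^+ n.-1 \in Num.nneg) q1.
  by rewrite powR1; apply; rewrite nnegrE// exprn_ge0.
set C := CE in C1 *; have C0 : 0 < C by exact: lt_le_trans C1.
have b0 := @bmass_gt0 R n n0.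
have HH0 : 0 < (2 * H) ^+ n.-1 by rewrite exprn_gt0// mulr_gt0// H_gt0.
have rn0 : 0 < r ^+ n by rewrite exprn_gt0.
rewrite /Bfun gtn_eqF//; apply: ge_ereal_sup => _ [t /= t0 <-].
have [->|tN] := eqVneq t 0.
  rewrite mul0r sub0e; apply: (@le_trans _ _ 0%E); first by rewrite oppe_le0 Efun_ge0.
  by rewrite lee_fin divr_ge0// ltW.
have {}t0 : 0 < t by rewrite lt_neqAle eq_sym tN.
have Hy (z : 'rV[R]_n) K : cube a r z ->
    ((t / (2 * L * (2 * H / r) ^+ n.-1) * `| beta a r z (hf K) - beta a r z 1 |)%:E <=
     M%:E + (r ^+ n * C)%:E * Efun n A t)%E.
  by move=> az; exact: beta_young.
move: (Efun_ge0 yA n t) Hy.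
case: (Efun n A t) => [w| |//] w0 Hy; last by rewrite leNye.
rewrite lee_fin in w0.
set th := t / (2 * L * (2 * H / r) ^+ n.-1) in Hy.
have th0 : 0 < th by rewrite divr_gt0// !mulr_gt0// exprn_gt0// divr_gt0// mulr_gt0// H_gt0.
have hx K : th * `| beta a r x (hf K) - beta a r x 1 | <= M + r ^+ n * C * w.
  by rewrite -lee_fin; exact: Hy.
have hy K : th * `| beta a r y (hf K) - beta a r y 1 | <= M + r ^+ n * C * w.
  by rewrite -lee_fin; exact: Hy.
have := dist_limit aD r0 ax ay cx cy (ltW th0) hx hy.
set d := `|v x - v y| => hd.
rewrite -EFinB lee_fin lerBlDr.
(* The constant [4] combines the factor [2] of the geometric sum with the [2] from comparing two
   points. *)
have -> : t * (bm / (4 * L * (2 * H) ^+ n.-1 * C) * (d / r)) = (th * (bm * d)) / (2 * C * r ^+ n).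
  rewrite /th [(2 * H / r) ^+ n.-1]exprMn exprVn -[in r ^+ n](prednK n0) exprS; field.
  by rewrite !gt_eqF ?exprn_gt0 ?mulr_gt0 ?H_gt0.
rewrite ler_pdivrMr ?mulr_gt0//; apply: (le_trans hd).
have -> : (M / r ^+ n + w) * (2 * C * r ^+ n) = (M * C + r ^+ n * C * w) *+ 2.
  by rewrite mulr2n; field; rewrite gt_eqF.
by rewrite lerMn2r/= lerD2r ler_peMr.
Qed.

Lemma morrey_eq1 a r x y (M : R) : n = 1%N -> cube a r `<=` D -> 0 < r -> cube a r x -> cube a r y ->
  {for x, continuous v} -> {for y, continuous v} ->
  (lint (cube a r) (fun z => A (h z)) <= M%:E)%E ->
  (Bfun n A (bm / (4 * L) * (`|v x - v y| / r))%R <= (M / r ^+ n)%:E)%E.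
Proof.
move=> n1 aD r0 ax ay cx cy hM.
have M0 := lint_ge0_young hM.
have mD := measurable_open oD.
have b0 := @bmass_gt0 R n n0.
have mK : @measurable _ (Leb R n) (cube a r) by exact: measurable_cbox.
have n10 : n.-1 = 0%N by rewrite n1.
have -> : Bfun n A = A by rewrite /Bfun n1 eqxx.
have -> : r ^+ n = r by rewrite [in LHS]n1 expr1.
set s := bm / _ * _.
have s0 : 0 <= s by rewrite mulr_ge0// divr_ge0// ?(ltW b0)// ?(ltW r0)// mulr_ge0// ltW.
have [->|sN] := eqVneq s 0; first by rewrite young0// lee_fin divr_ge0// ltW.
have {}s0 : 0 < s by rewrite lt_neqAle eq_sym sN.
have As0 := young_fine_gt0 c2 s0.
pose p := fine (A s) / s.
have p0 : 0 < p by rewrite divr_gt0.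
(* For [t <= s] the line is below [A s]; beyond [s] it is below [A t] because [A t / t] is
   nondecreasing. *)
have hp (t : R) : 0 <= t -> ((p * t)%:E <= (fine (A s))%:E + A t)%E.
  move=> t0; have [ts|st] := leP t s.
    rewrite (youngE yA c2 t0) -EFinD lee_fin ler_wpDr ?fine_ge0 ?(young_ge0 yA)//.
    by rewrite /p mulrAC ler_pdivrMr// ler_wpM2l// ltW.
  have tp : 0 < t by exact: lt_trans st.
  apply: (@le_trans _ _ (A t)); last by rewrite leeDr// lee_fin ltW.
  have := young_scale yA (c := s / t) (t := t).
  rewrite divfK ?gt_eqF// divr_ge0 ?(ltW s0)// ler_pdivrMr// mul1r (ltW st) t0 => /(_ isT isT isT).
  rewrite (youngE yA c2 (ltW s0)) (youngE yA c2 t0) -EFinM !lee_fin.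
  rewrite mulrAC ler_pdivlMr// => hst.
  by rewrite /p mulrAC ler_pdivrMr// [leRHS]mulrC.
have Z (z : 'rV[R]_n) K : cube a r z ->
    p * `| beta a r z (hf K) - beta a r z 1 | <= L * (fine (A s) * r + M).
  move=> az; rewrite -lee_fin.
  have := beta_step aD r0 az (hf_gt0 K) (hf_le1 K) (lexx 1); rewrite n10 expr0 shrink1 => st.
  apply: (@le_trans _ _ (p%:E * lint D (fun z => (1 * \1_(cube a r) z * \sum_(j < n) `|g j z|)%:E))%E).
    by rewrite EFinM; apply: lee_wpmul2l => //; rewrite lee_fin ltW.
  have mi : @measurable_fun _ _ (Leb R n) R D (fun z => 1 * \1_(cube a r) z * \sum_(j < n) `|g j z|).
    apply: measurable_funM; last exact: measurable_gsum.
    by apply: measurable_funM; [exact: measurable_cst|exact: measurable_indic].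
  have i0 z' : 0 <= 1 * \1_(cube a r) z' * \sum_(j < n) `|g j z'|.
    by rewrite mul1r mulr_ge0 ?sumr_ge0// indicE ler0n.
  rewrite /lint -(ge0_integralZl_EFin _ mD _ _ (ltW p0)); first last.
  - by apply/measurable_EFinP; exact: mi.
  - by move=> z' _; rewrite lee_fin.
  pose F := (fun z : Leb R n => (L%:E * ((fine (A s))%:E + A (h z)))%E) \_ (cube a r : set (Leb R n)).
  have sD : D `&` cube a r `<=` D by move=> z' [].
  have mFD : measurable_fun (D `&` cube a r : set (Leb R n)) (fun z => (fine (A s))%:E + A (h z))%E.
    apply: emeasurable_funD; first exact: measurable_cst.
    exact: (measurable_funS mD sD measurable_young_comp).
  have mF : measurable_fun (D : set (Leb R n)) F.
    apply/(measurable_restrict _ mK mD).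
    by apply: emeasurable_funM; [exact: measurable_cst|exact: mFD].
  apply: (@le_trans _ _ (\int[mu]_(z in (D : set (Leb R n))) F z)%E).
    apply: (ge0_le_integral _ mD).
    - by move=> z' _; rewrite -EFinM lee_fin mulr_ge0// ltW.
    - apply: emeasurable_funM; first exact: measurable_cst.
      by apply/measurable_EFinP; exact: mi.
    - exact: mF.
    - move=> z' _; rewrite /F patchE indicE; case: (boolP (z' \in _)) => zQ; last by rewrite mulr0 mul0r mule0.
      apply: (@le_trans _ _ (L%:E * (p * h z')%:E)%E).
        rewrite -!EFinM lee_fin !mul1r mulrCA ler_wpM2l ?(ltW p0)//.
      by apply: lee_wpmul2l; [rewrite lee_fin ltW|exact: hp].
  rewrite /F -integral_mkcondr.
  have -> : (D : set (Leb R n)) `&` cube a r = cube a r.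
    by apply/seteqP; split => [z' []//|z' Qz]; split => //; exact: aD.
  have DQ : D `&` cube a r = cube a r.
    by apply/seteqP; split => [z' []//|z' Qz]; split => //; exact: aD.
  rewrite DQ in mFD.
  have mh' : measurable_fun (cube a r : set (Leb R n)) (fun z => A (h z)).
    exact: (measurable_funS mD aD measurable_young_comp).
  rewrite (ge0_integralZl_EFin _ mK _ mFD (ltW L0)); last first.
    by move=> z' _; apply: adde_ge0; [rewrite lee_fin; exact: ltW|exact: (young_ge0 yA)].
  rewrite EFinM; apply: lee_wpmul2l; first by rewrite lee_fin ltW.
  rewrite (ge0_integralD mu mK); first last.
  - exact: mh'.
  - by move=> z' _; exact: young_ge0.
  - exact: measurable_cst.
  - by move=> z' _; rewrite lee_fin ltW.
  rewrite EFinD; apply: leeD; last exact: hM.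
  rewrite (integral_cst mu mK) EFinM; apply: lee_wpmul2l; first by rewrite lee_fin ltW.
  by apply: (le_trans (leb_cube_le _ (ltW r0))); rewrite n1 expr1.
have := dist_limit aD r0 ax ay cx cy (ltW p0) (fun K => Z x K ax) (fun K => Z y K ay).
have -> : bm * `|v x - v y| = 4 * L * r * s.
  by rewrite /s; field; rewrite !gt_eqF.
have -> : p * (4 * L * r * s) = 4 * L * r * fine (A s).
  by rewrite /p; field; rewrite gt_eqF.
move=> hZ; rewrite (youngE yA c2 (ltW s0)) lee_fin ler_pdivlMr//.
have : L * (fine (A s) * r) <= L * M by move: hZ; rewrite mulr2n; set q := fine (A s); nra.
by rewrite ler_pM2l.
Qed.
End morrey.

(** * From components to the diameter of the image of a cube *)

Lemma enorm_le_sum (R : realType) (m : nat) (x : 'rV[R]_m) : enorm x <= \sum_(i < m) `|x ord0 i|.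
Proof.
have s0 : 0 <= \sum_(i < m) `|x ord0 i| by rewrite sumr_ge0.
rewrite /enorm -(ger0_norm s0) -sqrtr_sqr; apply: ler_wsqrtr.
rewrite expr2 mulr_suml; apply: ler_sum => i _.
rewrite -real_normK ?num_real// expr2 ler_wpM2l// (bigD1 i)//= lerDl sumr_ge0//.
Qed.

Lemma diam_le (R : realType) (m : nat) (E : set 'rV[R]_m) (d : R) : 0 <= d ->
  (forall x y, E x -> E y -> enorm (x - y) <= d) -> (diam E <= d%:E)%E.
Proof.
move=> d0 h; apply: ge_ereal_sup => _ [->|[x Ex [y Ey <-]]]; first by rewrite lee_fin.
by rewrite lee_fin; exact: h.
Qed.

Lemma diam_ge0 (R : realType) (m : nat) (E : set 'rV[R]_m) : (0 <= diam E)%E.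
Proof. by apply: ereal_sup_ubound; left. Qed.

Lemma enorm_le_diam (R : realType) (m : nat) (E : set 'rV[R]_m) x y : (diam E < +oo)%E ->
  E x -> E y -> enorm (x - y) <= fine (diam E).
Proof.
move=> fE Ex Ey; rewrite -lee_fin fineK ?ge0_fin_numE ?diam_ge0//.
by apply: ereal_sup_ubound; right; exists x => //; exists y.
Qed.

Lemma coord_le_enorm (R : realType) (m : nat) (x : 'rV[R]_m) i : `|x ord0 i| <= enorm x.
Proof.
rewrite -sqrtr_sqr; apply: ler_wsqrtr; rewrite (bigD1 i)//= lerDl.
by apply: sumr_ge0 => j _; exact: sqr_ge0.
Qed.

Definition gradnorm (R : realType) (n m : nat) (g : 'I_m -> 'I_n -> 'rV[R]_n -> R) (x : 'rV[R]_n) : R :=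
  Num.sqrt (\sum_(i < m) \sum_(j < n) g i j x ^+ 2).

Lemma gradnorm_ge (R : realType) (n m : nat) (g : 'I_m -> 'I_n -> 'rV[R]_n -> R) x i j :
  `|g i j x| <= gradnorm g x.
Proof.
rewrite -sqrtr_sqr; apply: ler_wsqrtr; rewrite (bigD1 i)//= (bigD1 j)//= -addrA lerDl.
rewrite addr_ge0//; first by apply: sumr_ge0 => k _; exact: sqr_ge0.
by apply: sumr_ge0 => k _; apply: sumr_ge0 => l _; exact: sqr_ge0.
Qed.

Section cube_estimate.
Context {R : realType} {n m : nat} {A : R -> \bar R} {phi : R -> R}.
Hypotheses (n0 : (0 < n)%N) (yA : young A) (c1 : C1 n A) (c2 : C2 A) (gphi : gauge n phi).
Variables (D : set 'rV[R]_n) (u : 'rV[R]_n -> 'rV[R]_m).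
Variables (g : 'I_m -> 'I_n -> 'rV[R]_n -> R) (l : R).
Hypotheses (oD : open D) (l0 : 0 < l).
Hypothesis lu : forall i, locint D (fun x => u x ord0 i).
Hypothesis wu : weak_grad D u g.
Hypothesis mg : lmeasurable_fun D (gradnorm g).
Hypothesis cu : forall x, D x -> {for x, continuous u}.

Lemma good_B_of : good_B n A.
Proof.
have [n1|n1] := leqP 2 n; first exact: good_B2.
have -> : n = 1%N by apply/eqP; rewrite eqn_leq -ltnS n1.
exact: good_B1.
Qed.

Local Notation h := (fun z => gradnorm g z / l).

Lemma osc_component : exists2 k : R, 0 < k & forall i a (r M : R) x y, cube a r `<=` D -> 0 < r ->
  cube a r x -> cube a r y -> (lint (cube a r) (fun z => A (h z)) <= M%:E)%E ->
  (Bfun n A (k * (`|u x ord0 i - u y ord0 i| / r))%R <= (M / r ^+ n)%:E)%E.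
Proof.
have [H H1 hH] := stepH_bounded (R := R).
have nl0 : 0 < n%:R * l by rewrite mulr_gt0// ltr0n.
have b0 := @bmass_gt0 R n n0.
have HH0 : 0 < (2 * H) ^+ n.-1 by rewrite exprn_gt0// mulr_gt0// (lt_le_trans _ H1).
have w1 i : weak1 D (fun x => u x ord0 i) (g i).
  case: wu => lg wf; split => // f tf j; exact: wf.
have mh : lmeasurable_fun D h.
  by apply: measurable_funM; [exact: mg|exact: measurable_cst].
have h0 z : 0 <= h z by rewrite divr_ge0 ?sqrtr_ge0// ltW.
have gh i z : \sum_(j < n) `|g i j z| <= (n%:R * l) * h z.
  apply: (@le_trans _ _ (\sum_(j < n) gradnorm g z)); first by apply: ler_sum => j _; exact: gradnorm_ge.
  rewrite sumr_const card_ord -mulr_natl le_eqVlt; apply/orP; left; apply/eqP.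
  by field; rewrite gt_eqF.
have ci i x : D x -> {for x, continuous (fun x => u x ord0 i)}.
  move=> Dx; apply: (@continuous_comp _ _ _ u (fun M : 'rV[R]_m => M ord0 i)); first exact: cu.
  exact: coord_continuous.
have [n2|n2] := leqP 2 n.
  exists (@bmass R n / (4 * (n%:R * l) * (2 * H) ^+ n.-1 * (2 ^+ n.-1 : R) `^ (1 + nprime R n))).
    apply: divr_gt0 => //; apply: mulr_gt0; last by rewrite powR_gt0// exprn_gt0.
    by apply: mulr_gt0 => //; apply: mulr_gt0.
  move=> i a r M x y aD r0 ax ay hM.
  exact: (morrey_ge2 n0 yA c2 oD (w1 i) nl0 mh h0 (gh i) H1 hH n2 aD r0 ax ay (ci i _ (aD _ ax)) (ci i _ (aD _ ay)) hM).
have n1 : n = 1%N by apply/eqP; rewrite eqn_leq -ltnS n2.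
exists (@bmass R n / (4 * (n%:R * l))); first by rewrite divr_gt0// mulr_gt0.
move=> i a r M x y aD r0 ax ay hM.
exact: (morrey_eq1 n0 yA c2 oD (w1 i) nl0 mh h0 (gh i) H1 hH n1 aD r0 ax ay (ci i _ (aD _ ax)) (ci i _ (aD _ ay)) hM).
Qed.

(** With [phi s = max (phi r) M], each component oscillates by a multiple of [r B^-1(phi s / r^n)],
    at most [J s] by [Binv_scale]. The bound on [psi] is the quantity to be summed; the bound on the
    diameter itself serves covers of prescribed fineness. *)
Lemma osc_cube : exists2 C : R, 1 <= C & forall a (r M : R) (E : set 'rV[R]_n),
  0 < r -> r <= 1 -> cube a r `<=` D -> (lint (cube a r) (fun z => A (h z)) <= M%:E)%E -> 0 <= M -> M <= phi 1 ->
  E `<=` cube a r ->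
  [/\ (diam (u @` E) < +oo)%E, psi n A phi (fine (diam (u @` E))) <= C * (phi r + M) &
      fine (diam (u @` E)) <= C * (phi r + M) `^ n%:R^-1].
Proof.
have gB := good_B_of; have [k k0 hk] := osc_component.
(* [m / k] sums the components, and the [1] ensures [C0 >= 1] as [psi_le_scale] requires. *)
pose C0 := 1 + m%:R / k.
have C01 : 1 <= C0 by rewrite lerDl divr_ge0// ltW.
have C00 : 0 < C0 by exact: lt_le_trans C01.
pose C1 := C0 * (Jfun n A phi 1 * (phi 1)^-1 `^ n%:R^-1).
have J1 := J_gt0 gB gphi ltr01; have p1 := phi_gt0 gphi ltr01.
have C10 : 0 <= C1 by rewrite mulr_ge0 ?(ltW C00)// mulr_ge0 ?powR_ge0// ltW.
exists (C0 ^+ n + C1); first by apply: ler_wpDr => //; rewrite exprn_ege1.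
move=> a r M E r0 r1 aD hM M0 M1 Ea.
have [s [rs s1 ps]] := gauge_IVT gphi r0 r1 M1.
have s0 : 0 < s by exact: lt_le_trans rs.
have Js0 := J_gt0 gB gphi s0.
have psM : phi s <= phi r + M.
  by rewrite ps ge_max lerDl M0 lerDr (phi_ge0 gphi)// ltW.
have dE : (diam (u @` E) <= (C0 * Jfun n A phi s)%:E)%E.
  apply: diam_le; first by rewrite mulr_ge0// ltW.
  move=> _ _ [x Ex <-] [y Ey <-]; apply: (le_trans (enorm_le_sum _)).
  apply: (@le_trans _ _ (\sum_(i < m) (k^-1 * Jfun n A phi s))).
    apply: ler_sum => i _; rewrite !mxE ler_pdivlMl//.
    have := hk i a r M x y aD r0 (Ea _ Ex) (Ea _ Ey) hM; set d := `| _ | => hB.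
    have := Binv_scale gB (phi_gt0 gphi s0) r0 rs; rewrite -/(Jfun n A phi s); apply: le_trans.
    rewrite -ler_pdivrMl// mulrCA [r^-1 * d]mulrC; apply: (Binv_ge gB).
      apply: mulr_ge0; first exact: ltW.
      by apply: divr_ge0; [exact: normr_ge0|exact: ltW].
    apply: (le_trans hB); rewrite lee_fin ler_wpM2r ?invr_ge0 ?exprn_ge0// ?(ltW r0)//.
    by rewrite ps le_max lexx orbT.
  rewrite sumr_const card_ord -mulr_natl mulrA ler_wpM2r ?(ltW Js0)//.
  by rewrite /C0 lerDr.
have dfin : (diam (u @` E) < +oo)%E by apply: (le_lt_trans dE); exact: ltry.
have dEf : fine (diam (u @` E)) <= C0 * Jfun n A phi s.
  by rewrite -lee_fin fineK// ge0_fin_numE// diam_ge0.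
have pM0 : 0 <= phi r + M by rewrite addr_ge0// (phi_ge0 gphi)// ltW.
split => //.
  apply: (le_trans (psi_le_scale n0 gB gphi C01 s0 dEf)).
  by apply: ler_pM => //; rewrite ?exprn_ge0 ?(ltW C00)// ?(phi_ge0 gphi) ?(ltW s0)// lerDl.
apply: (le_trans dEf); apply: (@le_trans _ _ (C1 * (phi r + M) `^ n%:R^-1)); last first.
  by rewrite ler_wpM2r ?powR_ge0// lerDr exprn_ge0// ltW.
rewrite /C1 -mulrA ler_wpM2l ?(ltW C00)//; apply: (le_trans (J_small n0 gB gphi s0 s1)).
rewrite -[leRHS]mulrA; apply: ler_wpM2l; first exact: ltW.
rewrite -powRM ?invr_ge0 ?(ltW p1)//.
apply: ge0_ler_powR; rewrite ?invr_ge0 ?ler0n// ?nnegrE.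
- by rewrite divr_ge0 ?(ltW p1)// (phi_ge0 gphi)// ltW.
- by rewrite mulr_ge0// invr_ge0 ltW.
- by rewrite mulrC ler_wpM2l// invr_ge0 ltW.
Qed.
End cube_estimate.

(** * Dyadic covers *)

Section esum_lemmas.
Context {R : realType}.
Local Open Scope ereal_scope.

Lemma le_esum_subset (T : choiceType) (P Q : set T) (a : T -> \bar R) :
  (forall x, 0 <= a x) -> P `<=` Q -> \esum_(i in P) a i <= \esum_(i in Q) a i.
Proof.
move=> a0 PQ; rewrite esum_mkcond [leRHS]esum_mkcond; apply: le_esum => i _.
case: ifPn => [/[!inE] /PQ Qi|_]; first by rewrite mem_set.
by case: ifP.
Qed.

(** A section of [e] identifies the image with a subset of [P]. *)
Lemma esum_image_le (T T' : choiceType) (P : set T) (e : T -> T') (a : T' -> \bar R) :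
  (forall x, 0 <= a x) -> \esum_(j in e @` P) a j <= \esum_(i in P) a (e i).
Proof.
move=> a0.
have [P0|/set0P[p0 Pp0]] := eqVneq P set0; first by rewrite P0 image_set0 !esum_set0.
have /choice[s hs] : forall j, exists i, (e @` P) j -> P i /\ e i = j.
  move=> j; have [[i Pi eij]|nj] := pselect ((e @` P) j); first by exists i.
  by exists p0 => /nj.
rewrite (eq_esum (b := fun j => a (e (s j)))); last by move=> j /hs[_ ->].
rewrite -(@esum_image _ _ _ (e @` P) s (fun i => a (e i))).
  by apply: le_esum_subset => // _ [j /hs[+ _] <-].
by move=> j1 j2 /[!inE] /hs[_ h1] /hs[_ h2] s12; rewrite -h1 -h2 s12.
Qed.

Lemma esum_term_le (T : choiceType) (P : set T) (a : T -> \bar R) x :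
  (forall x, 0 <= a x) -> P x -> a x <= \esum_(i in P) a i.
Proof.
move=> a0 Px; rewrite -(esum_set1 (a0 x)); apply: le_esum_subset => //.
by move=> _ ->.
Qed.

Definition pick_fun (T : countType) (Y : Type) (P : set T) (f : T -> Y) (y0 : Y) (i : nat) : Y :=
  if (pickle_inv i : option T) is Some q then (if q \in P then f q else y0) else y0.

Lemma esum_pickle (T : countType) (P : set T) (f : T -> \bar R) : (forall x, 0 <= f x) ->
  \esum_(q in P) f q = \sum_(i <oo) pick_fun P f 0 i.
Proof.
move=> f0; rewrite nneseries_esumT; last first.
  by move=> i; rewrite /pick_fun; case: pickle_inv => // q; case: ifP.
rewrite (esum_mkcond P) -(eq_esum (a := fun q : T => pick_fun P f 0 (pickle q))); last first.
  by move=> q _; rewrite /pick_fun pickleK_inv.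
rewrite -(esum_image setT (@pickle T) (pick_fun P f 0)); last first.
  by move=> x y _ _ /(congr1 (@pickle_inv T)); rewrite !pickleK_inv => -[].
rewrite [LHS]esum_mkcond; apply: eq_esum => i _; case: ifPn => // /negP ni.
rewrite /pick_fun; case E : (pickle_inv i) => [q|//]; exfalso; apply: ni; rewrite inE.
exists q => //; have := @pickle_invK T i; rewrite /ocancel E/=; exact.
Qed.
End esum_lemmas.

Lemma pick_fun_cover (T : countType) (Y : Type) (P : set T) (f : T -> set Y) (X : set Y) :
  (X `<=` \bigcup_(q in P) f q) -> X `<=` \bigcup_i pick_fun P f set0 i.
Proof.
move=> Xf x /Xf[q Pq fqx]; exists (pickle q) => //.
by rewrite /pick_fun pickleK_inv mem_set.
Qed.

Section dmax.
Context {R : realType} {n : nat}.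
Implicit Types Q : set (nat * 'rV[int]_n).

(** By nestedness these are the maximal cubes of [Q]; levels are natural numbers, so every cube lies
    in one. *)
Definition dmax Q : set (nat * 'rV[int]_n) :=
  [set q | Q q /\ forall q', Q q' -> (q'.1 < q.1)%N -> @dcube R n q `&` dcube q' = set0].

Lemma dmax_sub Q : dmax Q `<=` Q. Proof. by move=> q []. Qed.

Lemma dcube_eq (q q' : nat * 'rV[int]_n) (x : 'rV[R]_n) : q.1 = q'.1 -> dcube q x -> dcube q' x -> q = q'.
Proof.
case: q => l i; case: q' => l' i' /= -> qx q'x; congr (_, _).
by apply/rowP => k; rewrite -(qx k) -(q'x k).
Qed.

Lemma dmax_trivIset Q : trivIset (dmax Q) (@dcube R n).
Proof.
move=> q q' [Qq mq] [Qq' mq'] [x [qx q'x]].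
have [|qq'|qq'] := ltngtP q.1 q'.1; last exact: (dcube_eq qq' qx q'x).
  by move=> /(mq' _ Qq) /seteqP[/(_ x) + _] => /(_ (conj q'x qx)).
by move: qq' => /(mq _ Qq') /seteqP[/(_ x) + _] => /(_ (conj qx q'x)).
Qed.

Lemma dmax_cover Q : \bigcup_(q in Q) @dcube R n q `<=` \bigcup_(q in dmax Q) dcube q.
Proof.
move=> x [q0 Qq0 q0x].
pose P l := `[< exists q, [/\ Q q, q.1 = l & dcube q x] >].
have exP : exists l, P l by exists q0.1; apply/asboolP; exists q0.
(* Take the coarsest cube of [Q] containing [x]: a still coarser one meeting it would contain it,
   hence contain [x]. *)
have := ex_minnP exP => -[l /asboolP[q [Qq ql qx]] lmin].
exists q => //; split => // q' Qq' q'q; rewrite -subset0 => y [qy q'y].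
have := dcube_nested (ltnW q'q) q'y qy qx => q'x.
have : P q'.1 by apply/asboolP; exists q'.
by move=> /lmin; rewrite leqNgt -ql q'q.
Qed.
End dmax.

Lemma level_exists (R : realType) (d : R) (N : nat) : 0 < d -> d <= 2^-1 ^+ N ->
  exists l, [/\ (N <= l)%N, d <= 2^-1 ^+ l & 2^-1 ^+ l < 2 * d].
Proof.
move=> d0 dN.
(* For the least such [l], either [l = N] or failure at [l - 1] yields the bound [d <= 2^-l]. *)
pose P l := (N <= l)%N && (2^-1 ^+ l.+1 < d).
have exP : exists l, P l.
  have [k kd] := dside_small d0; exists (maxn N k); rewrite /P leq_maxl/=.
  apply: le_lt_trans kd; rewrite -exprVn; apply: ler_wiXn2l; rewrite ?invr_ge0 ?invf_le1 ?ler1n//.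
  by rewrite (leq_trans (leq_maxr N k)).
have := ex_minnP exP => -[l /andP[Nl ld] lmin]; exists l; split => //; last first.
  by rewrite -ltr_pdivrMl// -exprS.
move: Nl; rewrite leq_eqVlt => /orP[/eqP <-//|Nl].
rewrite leNgt; apply/negP => h.
have : P l.-1 by rewrite /P prednK ?(leq_ltn_trans _ Nl)// h andbT -ltnS prednK// (leq_ltn_trans _ Nl).
by move=> /lmin; rewrite leqNgt prednK ?leqnn// (leq_ltn_trans _ Nl).
Qed.

Section gauge_zero.
Context {R : realType} {n : nat} {A : R -> \bar R} {phi : R -> R}.
Hypothesis gphi : gauge n phi.

Lemma psi0 : psi n A phi 0 = 0.
Proof.
rewrite /psi -[RHS](phi0 gphi); congr phi; apply/eqP; rewrite eq_le Jinv_ge0 andbT.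
apply: ge_inf; first by exists 0 => x [].
by split => //; rewrite /Jfun mul0r.
Qed.

Lemma phi_small (e : R) : 0 < e -> exists2 t : R, 0 < t & forall s, 0 <= s -> s <= t -> phi s < e.
Proof.
move=> e0; have cphi : {within `[(0:R), 1]%classic, continuous phi}.
  case: gphi => _ _ _ + _; apply: continuous_subspaceW => x /=.
  by rewrite !in_itv/= andbT => /andP[].
have [_ + _] := (continuous_within_itvP phi (@ltr01 R)).1 cphi.
rewrite (phi0 gphi) => /cvgrPdist_lt/(_ _ e0).
rewrite near_withinE => /nbhs_ballP[d /= d0 dP].
exists (d / 2); first by rewrite divr_gt0.
move=> s s0 sd; have d2 : 0 < d / 2 by rewrite divr_gt0.
have := dP (d / 2); rewrite /ball/= => /(_ _ d2)/wrap[].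
  by rewrite sub0r normrN gtr0_norm// ltr_pdivrMr// ltr_pMr// ltr1n.
rewrite sub0r normrN => h; apply: le_lt_trans (phi_le gphi s0 sd) _.
exact: le_lt_trans (ler_norm _) h.
Qed.

(* The additive error is only needed for covering sets of zero diameter. *)
Lemma cover_level (d e : R) (N : nat) : 0 <= d -> 0 < e -> d <= 2^-1 ^+ N ->
  exists l, [/\ (N <= l)%N, d <= 2^-1 ^+ l & phi (2^-1 ^+ l) <= 2 ^+ n * phi d + e].
Proof.
rewrite le_eqVlt => /orP[/eqP <-|d0] e0 dN.
  have [t t0 ht] := phi_small e0; have [k kt] := dside_small t0.
  exists (maxn N k); rewrite leq_maxl exprn_ge0//; split => //.
  rewrite (phi0 gphi) mulr0 add0r; apply/ltW/ht; first by rewrite exprn_ge0.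
  apply: le_trans (ltW kt); rewrite -exprVn.
  by apply: ler_wiXn2l; rewrite ?invr_ge0 ?invf_le1 ?ler1n ?leq_maxr.
have [l [Nl dl ld]] := level_exists d0 dN; exists l; split => //.
apply: (@le_trans _ _ (phi (2 * d))).
  by apply: (phi_le gphi) (ltW ld); rewrite exprn_ge0.
apply: le_trans (phi_scale gphi _ (ltW d0)) _; first by rewrite ler1n.
by rewrite lerDl ltW.
Qed.
End gauge_zero.

Section dyadic_cover.
Context {R : realType} {n : nat} {phi : R -> R}.
Hypothesis gphi : gauge n phi.

(** The [3^n] cubes of level [l] that are equal or adjacent to the one containing [x]; the shifts
    [0, 1, 2] stand for [-1, 0, 1]. *)
Definition dneigh (l : nat) (x : 'rV[R]_n) (s : 'rV['I_3]_n) : nat * 'rV[int]_n :=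
  (l, \row_k (Num.floor (x ord0 k * 2 ^+ l) + (s ord0 k)%:Z - 1)).

Lemma floor_near (a b : R) : `|a - b| <= 1 -> exists s : 'I_3, Num.floor b = Num.floor a + s%:Z - 1.
Proof.
rewrite ler_norml => /andP[h1 h2].
have /andP[a1 a2] := floor_itv a; have /andP[b1 b2] := floor_itv b.
set p := Num.floor a in a1 a2 *; set q := Num.floor b in b1 b2 *.
have pq : (p - 1 <= q)%R by rewrite -ltzD1 -(ltr_int R) !(intrD, rmorphN, rmorph1)/=; move: b2; rewrite intrD; lra.
have qp : (q <= p + 1)%R by rewrite -ltzD1 -(ltr_int R) !(intrD, rmorphN, rmorph1)/=; move: a2; rewrite intrD; lra.
have s0 : 0 <= q - p + 1 by lra.
have s3 : (absz (q - p + 1)%R < 3)%N by rewrite -ltz_nat gez0_abs//; lra.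
by exists (Ordinal s3) => /=; rewrite gez0_abs//; lra.
Qed.

Lemma dneigh_cover (l : nat) (x y : 'rV[R]_n) : (forall i, `|x ord0 i - y ord0 i| <= 2^-1 ^+ l) ->
  exists s, dcube (dneigh l x s) y.
Proof.
move=> xy.
have /choice[s hs] : forall i, exists s : 'I_3,
    Num.floor (y ord0 i * 2 ^+ l) = Num.floor (x ord0 i * 2 ^+ l) + s%:Z - 1.
  move=> i; apply: floor_near; rewrite -mulrBl normrM (ger0_norm (exprn_ge0 _ _))//.
  by rewrite -ler_pdivlMr ?exprn_gt0// div1r -exprVn.
by exists (\row_i s i) => i /=; rewrite !mxE hs.
Qed.

(** Number of neighbours, times [2^n] from rounding diameters up to dyadic sides, plus [1] for the
    additive errors of [cover_level]. *)
Definition cover_const : R := #|{: 'rV['I_3]_n}|%:R * (2 ^+ n + 1).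

Lemma cover_const_gt0 : 0 < cover_const.
Proof.
rewrite mulr_gt0// ?addr_gt0 ?exprn_gt0// ltr0n; apply/card_gt0P.
by exists (const_mx ord0).
Qed.

Lemma dyadic_cover (E : set 'rV[R]_n) (F : nat -> set 'rV[R]_n) (N : nat) (delta : R) : 0 < delta ->
  E `<=` \bigcup_i F i -> (forall i, (diam (F i) <= (2^-1 ^+ N)%:E)%E) ->
  (\sum_(i <oo) (phi (fine (diam (F i))))%:E <= delta%:E)%E ->
  exists Q : set (nat * 'rV[int]_n), [/\ E `<=` \bigcup_(q in Q) dcube q,
    forall q, Q q -> (N <= q.1)%N &
    (\esum_(q in Q) (phi (dside R q))%:E <= (cover_const * delta)%:E)%E].
Proof.
move=> de0 EF dF sF.
have fF i : (diam (F i) < +oo)%E by apply: le_lt_trans (dF i) (ltry _).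
have dF' i : fine (diam (F i)) <= 2^-1 ^+ N.
  by rewrite -lee_fin fineK ?ge0_fin_numE ?diam_ge0.
have d0 i : 0 <= fine (diam (F i)) by rewrite fine_ge0// diam_ge0.
have e0 i : 0 < delta / (2 ^ i.+1)%:R by rewrite divr_gt0// ltr0n expn_gt0.
have /choice[l hl] := fun i => cover_level gphi (d0 i) (e0 i) (dF' i).
(* A base point in each nonempty set; for an empty set any point will do. *)
have /choice[x hx] : forall i, exists x, forall y, F i y -> F i x.
  move=> i; have [->|/set0P[x Fx]] := eqVneq (F i) set0; first by exists 0.
  by exists x.
pose e (p : nat * 'rV['I_3]_n) := dneigh (l p.1) (x p.1) p.2.
exists (range e); split.
- move=> y /EF[i _ Fy]; have [_ dl _] := hl i.
  have [k|s hs] := @dneigh_cover (l i) (x i) y; last by exists (e (i, s)) => //; exists (i, s).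
  apply: le_trans dl; apply: le_trans (enorm_le_diam (fF i) (hx i y Fy) Fy).
  by apply: le_trans (coord_le_enorm _ k); rewrite !mxE.
- by move=> _ [[i s] _ <-] /=; have [] := hl i.
apply: le_trans (esum_image_le _ _ _) _.
  by move=> q; rewrite lee_fin (phi_ge0 gphi)// ltW// dside_gt0.
have -> : [set: nat * 'rV['I_3]_n] = [set: nat] `*`` (fun=> [set: 'rV['I_3]_n]).
  by apply/seteqP; split.
rewrite -(esum_esum (a := fun i s => (phi (dside R (e (i, s))))%:E)); last first.
  by move=> i s _ _; rewrite lee_fin (phi_ge0 gphi)// ltW// dside_gt0.
have c0 : 0 <= #|{: 'rV['I_3]_n}|%:R :> R by [].
apply: (@le_trans _ _ (\esum_(i in [set: nat])
    ((#|{: 'rV['I_3]_n}|%:R * 2 ^+ n)%:E * (phi (fine (diam (F i))))%:E +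
      (#|{: 'rV['I_3]_n}|%:R * delta / (2 ^ i.+1)%:R)%:E))%E).
  apply: le_esum => i _.
  rewrite esum_fset; [|exact: finite_finset|]; last first.
    by move=> s _; rewrite lee_fin (phi_ge0 gphi)// ltW// dside_gt0.
  have [_ _ pl] := hl i.
  rewrite (fsbigE (index_enum _)) ?index_enum_uniq//; last by move=> s _; rewrite mem_index_enum.
  rewrite (eq_bigl xpredT); last by move=> s; rewrite in_setT.
  apply: (@le_trans _ _ (\sum_(s : 'rV['I_3]_n) (2 ^+ n * phi (fine (diam (F i))) + delta / (2 ^ i.+1)%:R)%:E)%E).
    by apply: lee_sum => s _; rewrite lee_fin /dside/= -exprVn.
  by rewrite sumEFin sumr_const -EFinM -EFinD lee_fin -[leLHS]mulr_natl mulrDr !mulrA.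
rewrite -nneseries_esumT; last first.
  by move=> i; rewrite -EFinM -EFinD lee_fin addr_ge0// ?mulr_ge0 ?exprn_ge0 ?(phi_ge0 gphi)// ?invr_ge0// ltW.
apply: le_trans (epsilon_trick _ _ _) _.
- by move=> i; rewrite -EFinM lee_fin mulr_ge0 ?exprn_ge0 ?(phi_ge0 gphi)// mulr_ge0 ?exprn_ge0.
- by rewrite mulr_ge0// ltW.
rewrite nneseriesZl; last by move=> i _; rewrite lee_fin (phi_ge0 gphi).
apply: (@le_trans _ _ ((#|{: 'rV['I_3]_n}|%:R * 2 ^+ n)%:E * delta%:E + (#|{: 'rV['I_3]_n}|%:R * delta)%:E)%E).
  by rewrite leeD2r// lee_wpmul2l// lee_fin mulr_ge0 ?exprn_ge0.
by rewrite -EFinM -EFinD lee_fin /cover_const mulrDr mulrDl mulr1.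
Qed.
End dyadic_cover.

(** * Images of dyadic covers *)

Lemma pick_fun_comp (T : countType) (Y Z : Type) (P : set T) (f : T -> Y) (y0 : Y) (k : Y -> Z) i :
  k (pick_fun P f y0 i) = pick_fun P (k \o f) (k y0) i.
Proof. by rewrite /pick_fun; case: pickle_inv => // q; case: ifP. Qed.

Lemma pick_funP (T : countType) (Y : Type) (P : set T) (f : T -> Y) (y0 : Y) (C : Y -> Prop) i :
  C y0 -> (forall q, P q -> C (f q)) -> C (pick_fun P f y0 i).
Proof.
move=> C0 CP; rewrite /pick_fun; case: pickle_inv => // q.
by case: ifPn => // /[!inE]; exact: CP.
Qed.

Lemma esumZl (R : realType) (T : countType) (P : set T) (a : T -> \bar R) (c : R) :
  0 <= c -> (forall x, 0 <= a x)%E -> (\esum_(i in P) (c%:E * a i) = c%:E * \esum_(i in P) a i)%E.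
Proof.
move=> c0 a0; rewrite !esum_pickle//; last by move=> x; rewrite mule_ge0.
rewrite -nneseriesZl; last by move=> i _; exact: (pick_funP (C := fun y => 0 <= y)%E).
by apply: eq_eseriesr => i _; rewrite (pick_fun_comp _ _ _ (fun y => c%:E * y)%E) mule0.
Qed.

Lemma bigcup_pick_fun (T : countType) (Y : Type) (P : set T) (f : T -> set Y) :
  \bigcup_(q in P) f q = \bigcup_i pick_fun P f set0 i.
Proof.
apply/seteqP; split; first exact: pick_fun_cover.
move=> x [i _]; apply: (pick_funP (C := fun S => S x -> (\bigcup_(q in P) f q) x)) => // q Pq fx.
by exists q.
Qed.

Lemma trivIset_pick_fun (T : countType) (Y : Type) (P : set T) (f : T -> set Y) :
  trivIset P f -> trivIset setT (pick_fun P f set0).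
Proof.
move=> tf i j _ _ [x []]; rewrite /pick_fun.
case Ei : (pickle_inv i) => [q|//]; case: ifPn => // /[!inE] Pq fqx.
case Ej : (pickle_inv j) => [q'|//]; case: ifPn => // /[!inE] Pq' fqx'.
have qq' : q = q' by apply: tf => //; exists x.
have := @pickle_invK T i; have := @pickle_invK T j; rewrite /ocancel Ei Ej/= => <- <-.
by rewrite qq'.
Qed.

Section dyadic_measure.
Context {R : realType} {n : nat}.
Implicit Types (q : nat * 'rV[int]_n) (P : set (nat * 'rV[int]_n)).
Local Notation mu := (@lebesgue_n R n).

Lemma dcube_corner q : dcube q (dcorner R q).
Proof. by apply/dcubeP => i; rewrite lexx ltrDl dside_gt0. Qed.

Lemma cube_sub_of_dcube q q' : @dcube R n q `<=` dcube q' ->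
  cube (dcorner R q) (dside R q) `<=` cube (dcorner R q') (dside R q').
Proof.
move=> qq' x /cubeP qx; apply/cubeP => i.
have /dcubeP/(_ i)/andP[h1 h2] := qq' _ (dcube_corner q).
have /andP[h3 h4] := qx i; rewrite (le_trans h1 h3)/= (le_trans h4)// leNgt; apply/negP => h5.
(* If the closed cube stuck out in direction [i], this point of [dcube q] would lie on the excluded
   upper face of [dcube q']. *)
pose y : 'rV[R]_n := \row_k if k == i then dcorner R q' ord0 i + dside R q' else dcorner R q ord0 k.
have : dcube q y.
  apply/dcubeP => k; rewrite /y !mxE; case: eqP => [->|_]; last by have /dcubeP/(_ k) := dcube_corner q; rewrite !mxE.
  by move: h2 h5; rewrite !mxE => /ltW-> ->.
move/qq' => /dcubeP/(_ i)/andP[_].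
by rewrite [y ord0 i]mxE eqxx ltxx.
Qed.

Lemma bigcup_dcube_measurable P : @measurable _ (Leb R n) (\bigcup_(q in P) dcube q).
Proof.
rewrite bigcup_pick_fun; apply: (@bigcupT_measurable _ (Leb R n)) => i.
apply: (pick_funP (C := fun S => @measurable _ (Leb R n) S)); first exact: (@measurable0 _ (Leb R n)).
by move=> q _; exact: measurable_dcube.
Qed.

Lemma leb_bigcup_dcube_le P :
  (mu (\bigcup_(q in P) dcube q) <= \esum_(q in P) (dside R q ^+ n)%:E)%E.
Proof.
rewrite bigcup_pick_fun; apply: (le_trans (outer_measure_sigma_subadditive (@leb_outer R n) _)).
rewrite esum_pickle; last by move=> q; rewrite lee_fin exprn_ge0// ltW// dside_gt0.
apply: lee_nneseries => [i *|i *]; first exact: (outer_measure_ge0 (@leb_outer R n)).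
rewrite /pick_fun; case: pickle_inv => [q|]; last by rewrite outer_measure0.
case: ifP => _; last by rewrite outer_measure0.
apply: (@le_trans _ _ (mu (cube (dcorner R q) (dside R q)))).
  by apply: le_outer_measure; exact: dcube_sub_cube.
exact/leb_cube_le/ltW/dside_gt0.
Qed.

(** The difference is contained in the [n] upper faces, which are boxes with one side of length
    [0]. *)
Lemma dcube_boundary0 q : mu (cube (dcorner R q) (dside R q) `\` dcube q) = 0%E.
Proof.
set a := dcorner R q; set r := dside R q.
pose face (i : 'I_n) := cbox (\row_k (if k == i then a ord0 k + r else a ord0 k)) (\row_k (a ord0 k + r)).
have face0 i : leb_outer (face i : set (rvall R n)) = 0%E.
  apply/eqP; rewrite eq_le outer_measure_ge0 andbT.
  apply: le_trans (leb_outer_cbox_le _) _.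
    by move=> k; rewrite !mxE; case: eqP => // _; rewrite lerDl ltW// dside_gt0.
  by rewrite (bigD1 i)//= !mxE eqxx subrr mul0r.
apply/eqP; rewrite eq_le measure_ge0 andbT.
pose F (k : nat) : set (rvall R n) := if insub k is Some i then face i else set0.
apply: (@le_trans _ _ (leb_outer (\bigcup_k F k))).
  apply: le_outer_measure => x [/cubeP ax /dcubeP/existsNP[i hi]].
  exists (val i) => //; rewrite /F valK => k; have /andP[h1 h2] := ax k.
  rewrite !mxE; case: eqP => [->|_]; last by move: h1 h2; rewrite !mxE => -> ->.
  have /andP[h3 h4] := ax i; have {}hi : a ord0 i + r <= x ord0 i.
    by rewrite leNgt; apply/negP => h; apply: hi; rewrite h h3.
  by move: hi h4; rewrite !mxE => -> ->.
apply: (le_trans (outer_measure_sigma_subadditive (@leb_outer R n) _)).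
rewrite eseries0// => i _ _; rewrite /F; case: insubP => [k _ _|_]; first exact: face0.
exact: outer_measure0.
Qed.

Section nonneg_density.
Variables (D : set 'rV[R]_n) (f : 'rV[R]_n -> \bar R).
Hypotheses (mD : @measurable _ (Leb R n) D) (mf : @measurable_fun _ _ (Leb R n) (\bar R) D f).
Hypothesis f0 : forall z, (0 <= f z)%E.

(** The oscillation estimate lives on closed cubes, while additivity over disjoint cubes needs
    half-open ones. *)
Lemma lint_cube_dcube q : cube (dcorner R q) (dside R q) `<=` D ->
  lint (cube (dcorner R q) (dside R q)) f = lint (dcube q) f.
Proof.
move=> qD.
have mc : @measurable _ (Leb R n) (cube (dcorner R q) (dside R q)) by exact: measurable_cbox.
have md := @measurable_dcube R n q.
have mB : @measurable _ (Leb R n) (cube (dcorner R q) (dside R q) `\` dcube q).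
  exact: (@measurableD _ (Leb R n)).
have mfc : @measurable_fun _ _ (Leb R n) (\bar R) (cube (dcorner R q) (dside R q)) f.
  exact: (measurable_funS mD qD mf).
rewrite /lint (ge0_negligible_integral mB mc mfc (fun z _ => f0 z) (dcube_boundary0 q)).
by rewrite setDD setIidr//; exact: dcube_sub_cube.
Qed.

Lemma lint_bigcup_dcube P : trivIset P (@dcube R n) -> \bigcup_(q in P) dcube q `<=` D ->
  lint (\bigcup_(q in P) dcube q) f = (\esum_(q in P) lint (dcube q) f)%E.
Proof.
move=> tP PD; rewrite esum_pickle; last by move=> q; exact: integral_ge0.
rewrite bigcup_pick_fun in PD *.
have mF i : @measurable _ (Leb R n) (pick_fun P (@dcube R n) set0 i).
  apply: (pick_funP (C := fun S => @measurable _ (Leb R n) S)); first exact: (@measurable0 _ (Leb R n)).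
  by move=> q _; exact: measurable_dcube.
have mfP : @measurable_fun _ _ (Leb R n) (\bar R) (\bigcup_i pick_fun P (@dcube R n) set0 i) f.
  exact: (measurable_funS mD PD mf).
rewrite /lint (ge0_integral_bigcup mu mF mfP (fun z _ => f0 z) (trivIset_pick_fun tP)).
apply: eq_eseriesr => i _; rewrite -[LHS]/(lint (pick_fun P (@dcube R n) set0 i) f).
by rewrite (pick_fun_comp _ _ _ (fun S => lint S f)) {2}/lint integral_set0.
Qed.

Lemma lint_le_sub (S S' : set 'rV[R]_n) : @measurable _ (Leb R n) S -> @measurable _ (Leb R n) S' ->
  S `<=` S' -> S' `<=` D -> (lint S f <= lint S' f)%E.
Proof.
move=> mS mS' SS' S'D; apply: (ge0_subset_integral mu mS mS' _ _ SS').
  exact: (measurable_funS mD S'D mf).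
by move=> z _; exact: f0.
Qed.
End nonneg_density.

Lemma lint_abs_continuous (D : set 'rV[R]_n) (f : 'rV[R]_n -> R) : @measurable _ (Leb R n) D ->
  lmeasurable_fun D f -> (forall z, 0 <= f z) -> (lint D (EFin \o f) < +oo)%E ->
  forall e : R, 0 < e -> exists2 d : R, 0 < d & forall S, @measurable _ (Leb R n) S -> S `<=` D ->
    (mu S < d%:E)%E -> (lint S (EFin \o f) <= e%:E)%E.
Proof.
move=> mD mf f0 fi e e0.
have iD : mu.-integrable (D : set (Leb R n)) (EFin \o f).
  apply/integrableP; split; first exact/measurable_EFinP.
  rewrite [X in (X < _)%E](_ : _ = lint D (EFin \o f))//.
  by apply: eq_integral => z _ /=; rewrite ger0_norm.
have iF : mu.-integrable (setT : set (Leb R n)) (EFin \o (f \_ D)).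
  by rewrite -restrict_EFin; apply/(integrable_mkcond _ mD).
have [d [d0 dP]] := integral_normr_continuous iF e0.
exists d => // S mS SD Sd.
have e1 : lint S (EFin \o f) = (\int[mu]_(x in (S : set (Leb R n))) (`|(f \_ D) x|%R)%:E)%E.
  apply: eq_integral => z; rewrite inE => /SD Dz /=.
  by rewrite patchE mem_set// ger0_norm.
have fS : lint S (EFin \o f) \is a fin_num.
  rewrite ge0_fin_numE; last by apply: integral_ge0 => z _; rewrite /= lee_fin.
  apply: le_lt_trans fi; apply: (lint_le_sub mD _ _ mS mD SD (fun _ => id)).
    exact/measurable_EFinP.
  by move=> z; rewrite /= lee_fin.
by have := dP S mS Sd; rewrite /Rintegral -e1 => /ltW; rewrite -lee_fin fineK.
Qed.
End dyadic_measure.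

Section image_content.
Context {R : realType} {n m : nat} {A : R -> \bar R} {phi : R -> R}.
Hypotheses (n0 : (0 < n)%N) (yA : young A) (c1 : C1 n A) (c2 : C2 A) (gphi : gauge n phi).
Variables (D : set 'rV[R]_n) (u : 'rV[R]_n -> 'rV[R]_m).
Variables (g : 'I_m -> 'I_n -> 'rV[R]_n -> R) (l : R).
Hypotheses (oD : open D) (l0 : 0 < l).
Hypothesis lu : forall i, locint D (fun x => u x ord0 i).
Hypothesis wu : weak_grad D u g.
Hypothesis mg : lmeasurable_fun D (gradnorm g).
Hypothesis cu : forall x, D x -> {for x, continuous u}.
Local Notation Ah := (fun z => A (gradnorm g z / l)).

Lemma Ah_ge0 z : (0 <= Ah z)%E.
Proof. by apply: (young_ge0 yA); rewrite divr_ge0 ?sqrtr_ge0// ltW. Qed.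

Lemma measurable_Ah : @measurable_fun _ _ (Leb R n) (\bar R) D Ah.
Proof.
apply: (@measurable_young_comp R n A yA c2 D (fun z => gradnorm g z / l)).
  by apply: measurable_funM; [exact: mg|exact: measurable_cst].
by move=> z; rewrite divr_ge0 ?sqrtr_ge0// ltW.
Qed.

Lemma diam_set0 : diam (@set0 'rV[R]_m) = 0%E.
Proof. by apply/eqP; rewrite eq_le diam_ge0 andbT; apply: diam_le. Qed.

(** The image is covered by the images of the maximal cubes of [Q], whose disjointness lets the
    energies add up to the integral over the union. The bound [e'] on single cubes controls the
    diameters, hence the fineness [sigma]. *)
Lemma hsigma_image : exists2 C : R, 1 <= C & forall (Q : set (nat * 'rV[int]_n)) (E : set 'rV[R]_n)
    (sigma : \bar R) (c e e' : R),
  (E `<=` \bigcup_(q in Q) dcube q) -> (forall q, Q q -> cube (dcorner R q) (dside R q) `<=` D) ->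
  (\esum_(q in Q) (phi (dside R q))%:E <= c%:E)%E ->
  (lint (\bigcup_(q in Q) dcube q) Ah <= e%:E)%E -> e <= phi 1 -> (0 <= sigma)%E ->
  (forall q, Q q -> (lint (dcube q) Ah <= e'%:E)%E) ->
  (forall q, Q q -> ((C * (phi (dside R q) + e') `^ n%:R^-1)%:E <= sigma)%E) ->
  (Hsigma (psi n A phi) sigma (u @` E) <= (C * (c + e))%:E)%E.
Proof.
have [C C1 hC] := osc_cube n0 yA c1 c2 gphi oD l0 lu wu mg cu.
exists C => // Q E sigma c e e' EQ QD Qc Qe e1 s0 Qe' Qs.
have C0 : 0 <= C by exact: le_trans C1.
have mD := measurable_open oD.
pose P := @dmax R n Q.
have PQ q : P q -> Q q by move=> /dmax_sub.
have QUD : \bigcup_(q in Q) dcube q `<=` D.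
  by move=> x [q /QD qD qx]; apply: qD; exact: dcube_sub_cube.
have PUQ : \bigcup_(q in P) @dcube R n q `<=` \bigcup_(q in Q) dcube q.
  by move=> x [q /PQ Qq qx]; exists q.
pose M q := fine (lint (dcube q) Ah).
have lq0 q : (0 <= lint (dcube q) Ah)%E by apply: integral_ge0 => z _; exact: Ah_ge0.
have M0 q : 0 <= M q by rewrite fine_ge0.
have lqe q : P q -> (lint (dcube q) Ah <= e%:E)%E.
  move=> Pq; apply: le_trans Qe.
  apply: (lint_le_sub mD measurable_Ah Ah_ge0 (measurable_dcube q) (bigcup_dcube_measurable Q) _ QUD).
  by move=> x qx; exists q => //; exact: PQ.
have MF q : P q -> (M q)%:E = lint (dcube q) Ah.
  by move=> Pq; rewrite fineK// ge0_fin_numE// (le_lt_trans (lqe q Pq))// ltry.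
have Me q : P q -> M q <= e by move=> Pq; rewrite -lee_fin MF//; exact: lqe.
have Me' q : P q -> M q <= e' by move=> Pq; rewrite -lee_fin MF//; exact/Qe'/PQ.
have e'0 q : P q -> 0 <= e' by move=> /Me'; exact: le_trans.
have r0 q : 0 < dside R q := dside_gt0 R q.
have r1 q : dside R q <= 1 by rewrite invf_le1 ?exprn_gt0// exprn_ege1// ler1n.
have pr0 q : 0 <= phi (dside R q) by apply: (phi_ge0 gphi); exact: ltW.
pose X q := u @` (E `&` dcube q).
have hX q : P q -> [/\ (diam (X q) < +oo)%E, psi n A phi (fine (diam (X q))) <= C * (phi (dside R q) + M q) &
    fine (diam (X q)) <= C * (phi (dside R q) + M q) `^ n%:R^-1].
  move=> Pq; apply: (hC (dcorner R q)) => //.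
  - exact/QD/PQ.
  - by rewrite (lint_cube_dcube mD measurable_Ah Ah_ge0) ?MF//; exact/QD/PQ.
  - exact: le_trans (Me q Pq) e1.
  - by move=> x [_ /dcube_sub_cube].
pose F := pick_fun P X set0.
apply: (@le_trans _ _ (\sum_(i <oo) (psi n A phi (fine (diam (F i))))%:E)%E).
  apply: ereal_inf_lbound; exists F => //; split.
    move=> i; apply: (pick_funP (C := fun S => (diam S < +oo)%E /\ (diam S <= sigma)%E)).
      by rewrite diam_set0.
    move=> q Pq; have [d1 _ d2] := hX q Pq; split => //.
    apply: le_trans (Qs q (PQ q Pq)).
    rewrite -[leLHS]fineK ?ge0_fin_numE ?diam_ge0// lee_fin (le_trans d2)//.
    rewrite (ler_wpM2l C0)// ge0_ler_powR ?nnegrE ?invr_ge0 ?addr_ge0 ?(e'0 q Pq)//.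
    by rewrite lerD2l; exact: Me'.
  apply: pick_fun_cover => _ [x Ex <-].
  have [q Pq qx] := dmax_cover (EQ x Ex); exists q => //.
  by exists x.
under eq_eseriesr => i _ do rewrite /F (pick_fun_comp _ _ _ (fun S => (psi n A phi (fine (diam S)))%:E)).
rewrite diam_set0 /= (psi0 gphi) -esum_pickle; last by move=> q; rewrite lee_fin (psi_ge0 gphi).
apply: (@le_trans _ _ (\esum_(q in P) (C%:E * ((phi (dside R q))%:E + (M q)%:E)))%E).
  by apply: le_esum => q Pq /=; rewrite -EFinD -EFinM lee_fin; have [] := hX q Pq.
rewrite esumZl//; last by move=> q; rewrite -EFinD lee_fin addr_ge0.
rewrite EFinM lee_wpmul2l// esumD//; last 2 first.
- by move=> q _; rewrite lee_fin.
- by move=> q _; rewrite lee_fin.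
rewrite EFinD leeD//.
  apply: le_trans Qc; apply: le_esum_subset; last exact: PQ.
  by move=> q; rewrite lee_fin.
rewrite (eq_esum (b := fun q => lint (dcube q) Ah)); last by move=> q Pq; exact: MF.
rewrite -(lint_bigcup_dcube mD measurable_Ah Ah_ge0 (@dmax_trivIset R n Q)); last exact: subset_trans PUQ QUD.
apply: le_trans Qe.
exact: (lint_le_sub mD measurable_Ah Ah_ge0 (bigcup_dcube_measurable P) (bigcup_dcube_measurable Q) PUQ QUD).
Qed.
End image_content.

(** * Hausdorff measures as suprema over scales *)

Section hausdorff.
Context {R : realType} {k : nat}.
Variable phi : R -> R.
Implicit Types E : set 'rV[R]_k.

Lemma Hsigma_le (s t : \bar R) E : (s <= t)%E -> (Hsigma phi t E <= Hsigma phi s E)%E.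
Proof.
move=> st; apply: ereal_inf_le_tmp => _ [F [hF EF] <-]; exists F => //; split => // i.
by have [h1 h2] := hF i; split => //; exact: le_trans st.
Qed.

Lemma HmeasureE E : Hmeasure phi E = ereal_sup [set Hsigma phi s%:E E | s in [set s : R | 0 < s]].
Proof.
apply: cvg_lim => //.
rewrite (_ : [set s : R | 0 < s] = [set` Interval (BRight 0) +oo%O]).
  by apply: nonincreasing_at_right_cvge => // s t _ _ st; apply: Hsigma_le; rewrite lee_fin.
by apply/seteqP; split => s /=; rewrite in_itv/= andbT.
Qed.

Lemma Hsigma_le_Hmeasure (s : R) E : 0 < s -> (Hsigma phi s%:E E <= Hmeasure phi E)%E.
Proof. by move=> s0; rewrite HmeasureE; apply: ereal_sup_ubound; exists s. Qed.

Lemma Hmeasure_le (c : \bar R) E : (forall s : R, 0 < s -> (Hsigma phi s%:E E <= c)%E) ->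
  (Hmeasure phi E <= c)%E.
Proof. by move=> h; rewrite HmeasureE; apply: ge_ereal_sup => _ [s s0 <-]; exact: h. Qed.
End hausdorff.

Section image_small.
Context {R : realType} {n m : nat} {A : R -> \bar R} {phi : R -> R}.
Hypotheses (n0 : (0 < n)%N) (yA : young A) (c1 : C1 n A) (c2 : C2 A) (gphi : gauge n phi).
Variables (D : set 'rV[R]_n) (u : 'rV[R]_n -> 'rV[R]_m).
Hypotheses (oD : open D) (vu : V1A A D u) (cu : forall x, D x -> {for x, continuous u}).

Definition small_cover (Q : set (nat * 'rV[int]_n)) (E : set 'rV[R]_n) (eta : R) :=
  [/\ E `<=` \bigcup_(q in Q) dcube q, forall q, Q q -> cube (dcorner R q) (dside R q) `<=` D &
      (\esum_(q in Q) (phi (dside R q))%:E <= eta%:E)%E].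

(** [phi r / r^n] is non-increasing, so it is at least [phi 1] for [r <= 1]; hence small dyadic
    content forces small Lebesgue measure. *)
Lemma dside_expn_le (q : nat * 'rV[int]_n) : phi 1 * dside R q ^+ n <= phi (dside R q).
Proof.
have r0 := dside_gt0 R q.
have r1 : dside R q <= 1 by rewrite invf_le1 ?exprn_gt0// exprn_ege1// ler1n.
have := phi_div gphi r0 r1; rewrite expr1n divr1 ler_pdivlMr ?exprn_gt0//.
Qed.

Lemma leb_cover_le (Q : set (nat * 'rV[int]_n)) (c : R) : 0 <= c ->
  (\esum_(q in Q) (phi (dside R q))%:E <= c%:E)%E ->
  ((@lebesgue_n R n) (\bigcup_(q in Q) dcube q) <= (c / phi 1)%:E)%E.
Proof.
move=> c0 Qc; have p1 := phi_gt0 gphi ltr01.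
apply: le_trans (leb_bigcup_dcube_le Q) _.
apply: (@le_trans _ _ (\esum_(q in Q) ((phi 1)^-1%:E * (phi (dside R q))%:E))%E).
  by apply: le_esum => q _; rewrite -EFinM lee_fin ler_pdivlMl// dside_expn_le.
rewrite esumZl ?invr_ge0 ?(ltW p1)//; last by move=> q; rewrite lee_fin (phi_ge0 gphi)// ltW// dside_gt0.
by rewrite mulrC EFinM lee_wpmul2l// lee_fin invr_ge0 ltW.
Qed.

Lemma image_small : exists2 C : R, 1 <= C & forall e : R, 0 < e -> e <= phi 1 ->
  exists2 eta : R, 0 < eta &
  (forall Q E, small_cover Q E eta -> (Hcontent (psi n A phi) (u @` E) <= (2 * C * e)%:E)%E) /\
  (forall s : R, 0 < s -> exists N : nat, forall Q E, small_cover Q E eta ->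
     (forall q, Q q -> (N <= q.1)%N) -> (Hsigma (psi n A phi) s%:E (u @` E) <= (2 * C * e)%:E)%E).
Proof.
(* A finite Luxemburg norm yields some [l] for which [A (|grad u| / l)] has integral at most [1];
   the constants below may depend on it. *)
case: vu => lu [g [wu [mg /ereal_inf_lt[_ [l [l0 lA] <-] _]]]].
rewrite -/(gradnorm g) in mg.
pose Ah z := A (gradnorm g z / l).
have {}lA : (lint D Ah <= 1)%E.
  move: lA; congr (lint D _ <= _)%E; apply/funext => z.
  by rewrite ger0_norm ?sqrtr_ge0.
have h0 z : 0 <= gradnorm g z / l by rewrite divr_ge0 ?sqrtr_ge0// ltW.
have AhE : Ah = EFin \o (fine \o Ah) by apply/funext => z; exact: (youngE yA c2 (h0 z)).
have [C C1 hC] := hsigma_image n0 yA c1 c2 gphi oD l0 lu wu mg cu.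
have C0 : 0 < C by exact: lt_le_trans C1.
have p1 := phi_gt0 gphi ltr01.
have mD := measurable_open oD.
have ac : forall e : R, 0 < e -> exists2 d : R, 0 < d & forall S, @measurable _ (Leb R n) S -> S `<=` D ->
    ((@lebesgue_n R n) S < d%:E)%E -> (lint S Ah <= e%:E)%E.
  rewrite AhE; apply: (lint_abs_continuous mD).
  - apply/measurable_EFinP; rewrite -AhE; exact: measurable_Ah.
  - by move=> z; rewrite /= fine_ge0// (young_ge0 yA).
  - by rewrite -AhE (le_lt_trans lA)// ltry.
exists C => // e e0 e1; have [d d0 hd] := ac e e0.
(* The second entry makes the measure of the covered set less than [d], so its energy is at most
   [e]. *)
pose eta := Num.min e (d * phi 1 / 2).
have eta0 : 0 < eta by rewrite lt_min e0 divr_gt0// mulr_gt0.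
exists eta => //.
have common Q E : small_cover Q E eta -> (lint (\bigcup_(q in Q) dcube q) Ah <= e%:E)%E.
  move=> [_ QD Qeta]; apply: hd; first exact: bigcup_dcube_measurable.
    by move=> x [q /QD qD qx]; apply: qD; exact: dcube_sub_cube.
  apply: le_lt_trans (leb_cover_le (ltW eta0) Qeta) _.
  rewrite lte_fin ltr_pdivrMr//; apply: (@le_lt_trans _ _ (d * phi 1 / 2)); first by rewrite ge_min lexx orbT.
  by rewrite ltr_pdivrMr// ltr_pMr ?mulr_gt0// ltr1n.
have final : C * (eta + e) <= 2 * C * e.
  rewrite mulrAC [leRHS]mulrC ler_wpM2l ?(ltW C0)//.
  have : eta <= e by rewrite ge_min lexx.
  lra.
split.
  move=> Q E QE; have [EQ QD Qeta] := QE.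
  apply: (le_trans _ (_ : (C * (eta + e))%:E <= _)%E); last by rewrite lee_fin.
  apply: (hC Q E _ _ _ e) => //; first exact: common QE; last by move=> q _; exact: leey.
  move=> q Qq; apply: le_trans (common Q E QE).
  apply: (lint_le_sub mD _ _ (measurable_dcube q) (bigcup_dcube_measurable Q)).
  - exact: measurable_Ah.
  - exact: Ah_ge0.
  - by move=> x qx; exists q.
  - by move=> x [q' /QD qD qx]; apply: qD; exact: dcube_sub_cube.
move=> s s0.
(* Chosen so that gauge and energy, each at most [e'], give the diameter bound
   [C (2 e')^(1/n) = s]. *)
pose e' := (s / C) ^+ n / 2.
have e'0 : 0 < e' by rewrite divr_gt0// exprn_gt0// divr_gt0.
have [d' d'0 hd'] := ac e' e'0.
have [t t0 ht] := phi_small gphi e'0.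
have [|N Nd] := @dside_small R (Num.min d' t); first by rewrite lt_min d'0.
move: Nd; rewrite lt_min => /andP[Nd Nt].
exists N => Q E QE QN; have [EQ QD Qeta] := QE.
have rN q : Q q -> dside R q <= (2 ^+ N)^-1.
  by move=> /QN Nq; rewrite lef_pV2 ?posrE ?exprn_gt0// ler_weXn2l// ler1n.
apply: (le_trans _ (_ : (C * (eta + e))%:E <= _)%E); last by rewrite lee_fin.
apply: (hC Q E _ _ _ e') => //; first exact: common QE.
- by rewrite lee_fin ltW.
- move=> q Qq; apply: hd'; first exact: measurable_dcube.
    by move=> x qx; apply: (QD q Qq); exact: dcube_sub_cube.
  apply: (@le_lt_trans _ _ ((@lebesgue_n R n) (cube (dcorner R q) (dside R q)))).
    by apply: (le_outer_measure (@leb_outer R n)); exact: dcube_sub_cube.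
  apply: le_lt_trans (leb_cube_le _ (ltW (dside_gt0 R q))) _.
  rewrite lte_fin; apply: le_lt_trans Nd; apply: le_trans (rN q Qq).
  rewrite -[leRHS]expr1; apply: ler_wiXn2l => //; first by rewrite ltW// dside_gt0.
  by rewrite invf_le1 ?exprn_gt0// exprn_ege1// ler1n.
- move=> q Qq; rewrite lee_fin -ler_pdivlMl// mulrC.
  have -> : s / C = ((s / C) ^+ n) `^ n%:R^-1.
    by rewrite -powR_mulrn ?divr_ge0 ?(ltW s0) ?(ltW C0)// -powRrM mulfV ?pnatr_eq0 -?lt0n// powRr1// divr_ge0 ?(ltW s0) ?(ltW C0).
  have ps : phi (dside R q) < e'.
    by apply: ht; [exact/ltW/dside_gt0|rewrite (le_trans (rN q Qq))// ltW].
  rewrite ge0_ler_powR ?nnegrE ?invr_ge0 ?exprn_ge0 ?divr_ge0 ?(ltW s0) ?(ltW C0)//.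
    by rewrite addr_ge0 ?(ltW e'0)// (phi_ge0 gphi)// ltW// dside_gt0.
  rewrite [leRHS](_ : _ = e' + e'); last by rewrite /e'; field.
  by rewrite lerD2r ltW.
Qed.
End image_small.

(** * Whitney layers *)

Section whitney.
Context {R : realType} {n : nat} {phi : R -> R}.
Hypothesis gphi : gauge n phi.
Variable D : set 'rV[R]_n.
Hypothesis oD : open D.
Implicit Types (q : nat * 'rV[int]_n) (Q : set (nat * 'rV[int]_n)) (E X : set 'rV[R]_n).

(** The closed cube is required to lie in [D], as in the oscillation estimate. *)
Definition dcube_in (l : nat) (x : 'rV[R]_n) :=
  cube (dcorner R (dindex l x)) (dside R (dindex l x)) `<=` D.

Definition layer (k : nat) : set 'rV[R]_n :=
  [set x | dcube_in k x /\ forall j, (j < k)%N -> ~ dcube_in j x].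

Lemma layer_cover : D `<=` \bigcup_k layer k.
Proof.
move=> x Dx; have [e e0 eD] := open_coord oD Dx; have [l le] := dside_small e0.
have exP : exists l, `[< dcube_in l x >].
  exists l; apply/asboolP => y /cubeP hy; apply: eD => i; apply: le_lt_trans le.
  have /dcubeP/(_ i) /andP[h1 h2] := dcube_dindex l x; have /andP[h3 h4] := hy i.
  by rewrite -[leRHS]/(dside R (dindex l x)) ler_norml; apply/andP; split; lra.
have := ex_minnP exP => -[k /asboolP kx kmin]; exists k => //; split => // j jk jx.
by have /asboolP/kmin := jx; rewrite leqNgt jk.
Qed.

Lemma layer_inj (k k' : nat) x : layer k x -> layer k' x -> k = k'.
Proof.
by move=> [kx mk] [k'x mk']; have [/mk'//|/mk//|//] := ltngtP k k'.
Qed.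

(** All points of a cube of level at least [k] have the same dyadic cubes at levels up to [k], and
    these alone decide membership in the layer. *)
Lemma layer_dcube (k : nat) q x : (k <= q.1)%N -> dcube q x -> layer k x -> dcube q `<=` layer k.
Proof.
move=> kq qx [kx mk] y qy.
have e j : (j <= k)%N -> dindex j y = dindex j x.
  move=> jk; apply: (dcube_eq (x := y)) => //; first exact: dcube_dindex.
  by apply: (dcube_nested _ (dcube_dindex j x) qx qy); exact: leq_trans kq.
split; first by rewrite /dcube_in e.
by move=> j jk; rewrite /dcube_in e ?(ltnW jk)//; exact: mk.
Qed.

Lemma layer_cube (k : nat) q : (k <= q.1)%N -> dcube q `<=` layer k ->
  cube (dcorner R q) (dside R q) `<=` D.
Proof.
move=> kq qk; have [kc _] := qk _ (dcube_corner q).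
apply: subset_trans kc; apply: cube_sub_of_dcube.
exact: (dcube_nested (q := dindex k (dcorner R q)) kq (dcube_dindex k _) (dcube_corner q)).
Qed.

Definition layered Q (k : nat) : set (nat * 'rV[int]_n) := Q `&` [set q | dcube q `<=` layer k].

Lemma layered_trivIset (Q : nat -> set (nat * 'rV[int]_n)) : trivIset setT (fun k => layered (Q k) k).
Proof.
by move=> k k' _ _ [q [[_ qk] [_ qk']]]; exact: (layer_inj (qk _ (dcube_corner q)) (qk' _ (dcube_corner q))).
Qed.

Lemma layered_cover Q E (k : nat) : (forall q, Q q -> (k <= q.1)%N) -> E `<=` \bigcup_(q in Q) dcube q ->
  E `&` layer k `<=` \bigcup_(q in layered Q k) dcube q.
Proof.
move=> Qk EQ x [/EQ[q Qq qx] kx]; exists q => //; split => //.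
exact: (layer_dcube (Qk q Qq) qx kx).
Qed.

Local Open Scope ereal_scope.

Definition dcontent (N : nat) E : \bar R :=
  ereal_inf [set \esum_(q in Q) (phi (dside R q))%:E
            | Q in [set Q | E `<=` \bigcup_(q in Q) dcube q /\ forall q, Q q -> (N <= q.1)%N]].

Lemma phi_dside_ge0 q : 0 <= (phi (dside R q))%:E.
Proof. by rewrite lee_fin (phi_ge0 gphi)// ltW// dside_gt0. Qed.

Lemma dcontent_ge0 (N : nat) E : 0 <= dcontent N E.
Proof. by apply: le_ereal_inf_tmp => _ [Q _ <-]; apply: esum_ge0 => q _; exact: phi_dside_ge0. Qed.

Lemma dcontent_le (N N' : nat) E E' : (N <= N')%N -> (E `<=` E')%classic -> dcontent N E <= dcontent N' E'.
Proof.
move=> NN' EE'; apply: ereal_inf_le_tmp => _ [Q [EQ QN] <-]; exists Q => //; split.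
  exact: subset_trans EQ.
by move=> q /QN; exact: leq_trans.
Qed.

(* A dyadic cube of level at least k is either contained in the k-th layer or disjoint from it. *)
Lemma dcontent_layers (K N : nat) E : (K <= N)%N ->
  \sum_(0 <= k < K) dcontent N (E `&` layer k) <= dcontent N E.
Proof.
move=> KN; apply: le_ereal_inf_tmp => _ [Q [EQ QN] <-].
apply: (@le_trans _ _ (\sum_(0 <= k < K) \esum_(q in layered Q k) (phi (dside R q))%:E)).
  rewrite big_nat [leRHS]big_nat; apply: lee_sum => k /andP[_ kK].
  apply: ereal_inf_lbound; exists (layered Q k) => //; split.
    by apply: layered_cover EQ => q /QN; apply: leq_trans; exact: leq_trans (ltnW kK) KN.
  by move=> q [/QN].
apply: (@le_trans _ _ (\sum_(0 <= k <oo) \esum_(q in layered Q k) (phi (dside R q))%:E)).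
  by apply: nneseries_lim_ge => k _ _; apply: esum_ge0 => q _; exact: phi_dside_ge0.
rewrite -nneseries_sum_bigcup; last exact: phi_dside_ge0.
  by apply: le_esum_subset => [|q [k _ []]//]; exact: phi_dside_ge0.
by move=> i j _ _; exact: (@layered_trivIset (fun=> Q)).
Qed.

(** Layer [k] is covered at levels at least [max k N0], so that its cubes stay inside [D].
    Superadditivity bounds the total cost, although these levels are unbounded over the layers. *)
Lemma whitney_cover E (c eta : R) (N0 : nat) : (E `<=` D)%classic -> (0 < eta)%R ->
  (forall N, dcontent N E <= c%:E) ->
  exists Q, [/\ (E `<=` \bigcup_(q in Q) dcube q)%classic,
    forall q, Q q -> (cube (dcorner R q) (dside R q) `<=` D)%classic,
    forall q, Q q -> (N0 <= q.1)%N &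
    \esum_(q in Q) (phi (dside R q))%:E <= (c + eta)%:E].
Proof.
move=> ED eta0 Ec.
pose L k := maxn k N0.
have /choice[Q hQ] : forall k, exists Q, [/\ (E `&` layer k `<=` \bigcup_(q in Q) dcube q)%classic,
    forall q, Q q -> (L k <= q.1)%N &
    \esum_(q in Q) (phi (dside R q))%:E <= dcontent (L k) (E `&` layer k) + (eta / (2 ^ k.+1)%:R)%:E].
  move=> k.
  have fin : dcontent (L k) (E `&` layer k) \is a fin_num.
    rewrite ge0_fin_numE ?dcontent_ge0// (le_lt_trans _ (ltry c))//.
    by apply: le_trans (Ec (L k)); apply: dcontent_le => // x [].
  have e0 : (0 < eta / (2 ^ k.+1)%:R)%R by rewrite divr_gt0// ltr0n expn_gt0.
  by have [_ [Q [EQ QN] <-] /ltW hQ] := lb_ereal_inf_adherent e0 fin; exists Q.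
exists (\bigcup_k layered (Q k) k); split.
- move=> x Ex; have [k _ kx] := layer_cover (ED x Ex).
  have [EQ QL _] := hQ k.
  have [q Lq qx] : (\bigcup_(q in layered (Q k) k) dcube q)%classic x.
    apply: (layered_cover _ EQ); last by [].
    by move=> q /QL; apply: leq_trans; exact: leq_maxl.
  by exists q => //; exists k.
- move=> q [k _ [Qq qk]]; apply: (layer_cube _ qk).
  by have [_ + _] := hQ k => /(_ q Qq); apply: leq_trans; exact: leq_maxl.
- by move=> q [k _ [Qq qk]]; have [_ + _] := hQ k => /(_ q Qq); apply: leq_trans; exact: leq_maxr.
rewrite nneseries_sum_bigcup; [|exact: layered_trivIset|exact: phi_dside_ge0].
apply: (@le_trans _ _ (\sum_(0 <= k <oo) (dcontent (L k) (E `&` layer k) + (eta / (2 ^ k.+1)%:R)%:E))).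
  apply: lee_nneseries => [k *|k *]; first by apply: esum_ge0 => q _; exact: phi_dside_ge0.
  have [_ _] := hQ k; apply: le_trans; apply: le_esum_subset => [|q []//]; exact: phi_dside_ge0.
apply: le_trans (epsilon_trick _ _ _) _; [by move=> k; exact: dcontent_ge0|exact: ltW|].
rewrite EFinD leeD2r//; apply: lime_le.
  by apply: is_cvg_nneseries => k _ _; exact: dcontent_ge0.
(* For a partial sum over [k < K] all levels are raised to the common value [max K N0], where the
   contents of the layers are superadditive and the bound [c] still holds. *)
apply: nearW => K; apply: le_trans (Ec (maxn K N0)).
apply: le_trans (dcontent_layers _ (leq_maxl K N0)).
rewrite big_nat [leRHS]big_nat; apply: lee_sum => k /andP[_ kK].
by apply: dcontent_le => //; rewrite geq_max leq_maxr (leq_trans (ltnW kK))// leq_maxl.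
Qed.
End whitney.

(** * Images of sets of small content and of small measure *)

Section hausdorff_image.
Context {R : realType} {n m : nat} {A : R -> \bar R} {phi : R -> R}.
Hypotheses (n0 : (0 < n)%N) (yA : young A) (c1 : C1 n A) (c2 : C2 A) (gphi : gauge n phi).

(** The bound is uniform in [N], because the Hausdorff measure dominates [Hsigma] at every scale
    [2^-N]. *)
Lemma dcontent_le_Hmeasure (E : set 'rV[R]_n) (delta : R) (N : nat) : 0 < delta ->
  (Hmeasure phi E < delta%:E)%E -> (@dcontent R n phi N E <= (@cover_const R n * delta)%:E)%E.
Proof.
move=> d0 Ed; have s0 : 0 < 2^-1 ^+ N :> R by rewrite exprn_gt0.
have := le_lt_trans (Hsigma_le_Hmeasure phi E s0) Ed.
move=> /ereal_inf_lt[_ [F [hF EF] <-] /ltW sF].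
have [Q [EQ QN sQ]] := dyadic_cover gphi d0 EF (fun i => (hF i).2) sF.
by apply: le_trans sQ; apply: ereal_inf_lbound; exists Q.
Qed.

Lemma content_image (u : 'rV[R]_n -> 'rV[R]_m) : V1A A setT u -> continuous u ->
  forall eps : R, 0 < eps -> exists2 delta : R, 0 < delta &
  forall E : set 'rV[R]_n, (Hcontent phi E < delta%:E)%E -> (Hcontent (psi n A phi) (u @` E) < eps%:E)%E.
Proof.
move=> vu cu eps eps0.
have [C C1 hC] := image_small n0 yA c1 c2 gphi openT vu (fun x _ => cu x).
have C0 : 0 < C by exact: lt_le_trans C1.
have p1 := phi_gt0 gphi ltr01.
pose e := Num.min (phi 1) (eps / (4 * C)).
have e0 : 0 < e by rewrite lt_min p1 divr_gt0// mulr_gt0.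
have [|eta eta0 [h _]] := hC e e0; first by rewrite ge_min lexx.
have cc := @cover_const_gt0 R n.
pose delta := Num.min (phi 1) (eta / @cover_const R n).
have d0 : 0 < delta by rewrite lt_min p1 divr_gt0.
exists delta => // E /ereal_inf_lt[_ [F [hF EF] <-] sF].
(* A content below [phi 1] excludes covering sets of diameter above [1], so cubes of nonnegative
   level suffice. *)
have F1 i : (diam (F i) <= (2^-1 ^+ 0)%:E)%E.
  have [di _] := hF i; rewrite expr0 -[leLHS]fineK ?ge0_fin_numE ?diam_ge0// lee_fin leNgt; apply/negP => h1.
  have : ((phi 1)%:E < (phi 1)%:E)%E; last by rewrite ltxx.
  apply: (@le_lt_trans _ _ (phi (fine (diam (F i))))%:E); first by rewrite lee_fin (phi_le gphi)// ltW.
  apply: (@lt_le_trans _ _ delta%:E); last by rewrite lee_fin ge_min lexx.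
  apply: le_lt_trans sF; rewrite nneseries_esumT.
    by apply: (esum_term_le (a := fun i => (phi (fine (diam (F i))))%:E)) => // j; rewrite lee_fin (phi_ge0 gphi)// fine_ge0// diam_ge0.
  by move=> j; rewrite lee_fin (phi_ge0 gphi)// fine_ge0// diam_ge0.
have [Q [EQ _ sQ]] := dyadic_cover gphi d0 EF F1 (ltW sF).
apply: (@le_lt_trans _ _ (2 * C * e)%:E).
  apply: (h Q); split => //; apply: le_trans sQ _; rewrite lee_fin mulrC -ler_pdivlMr//.
  by rewrite ge_min lexx orbT.
rewrite lte_fin; apply: (@le_lt_trans _ _ (2 * C * (eps / (4 * C)))).
  by rewrite ler_wpM2l ?mulr_ge0 ?(ltW C0)// ge_min lexx orbT.
have -> : 2 * C * (eps / (4 * C)) = eps / 2 by field; rewrite gt_eqF.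
by rewrite ltr_pdivrMr// ltr_pMr// ltr1n.
Qed.

Lemma measure_image (Omega : set 'rV[R]_n) (u : 'rV[R]_n -> 'rV[R]_m) : open Omega -> V1A A Omega u ->
  (forall x, Omega x -> {for x, continuous u}) ->
  forall eps : R, 0 < eps -> exists2 delta : R, 0 < delta &
  forall E : set 'rV[R]_n, E `<=` Omega -> (Hmeasure phi E < delta%:E)%E ->
    (Hmeasure (psi n A phi) (u @` E) < eps%:E)%E.
Proof.
move=> oO vu cu eps eps0.
have [C C1 hC] := image_small n0 yA c1 c2 gphi oO vu cu.
have C0 : 0 < C by exact: lt_le_trans C1.
have p1 := phi_gt0 gphi ltr01.
pose e := Num.min (phi 1) (eps / (4 * C)).
have e0 : 0 < e by rewrite lt_min p1 divr_gt0// mulr_gt0.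
have [|eta eta0 [_ h]] := hC e e0; first by rewrite ge_min lexx.
have cc := @cover_const_gt0 R n.
(* Half of [eta] pays for the dyadic contents, the other half for the error of [whitney_cover]. *)
pose delta := eta / 2 / @cover_const R n.
have d0 : 0 < delta by rewrite !divr_gt0.
exists delta => // E EO Ed.
apply: (@le_lt_trans _ _ (2 * C * e)%:E).
  apply: Hmeasure_le => s s0; have [N hN] := h s s0.
  have eta2 : 0 < eta / 2 by rewrite divr_gt0.
  have [Q [EQ QO QN sQ]] := whitney_cover gphi oO N EO eta2 (fun N => dcontent_le_Hmeasure N d0 Ed).
  apply: (hN Q) => //; split => //; apply: le_trans sQ _.
  by rewrite lee_fin /delta mulrCA divff ?gt_eqF// mulr1 -splitr.
rewrite lte_fin; apply: (@le_lt_trans _ _ (2 * C * (eps / (4 * C)))).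
  by rewrite ler_wpM2l ?mulr_ge0 ?(ltW C0)// ge_min lexx orbT.
have -> : 2 * C * (eps / (4 * C)) = eps / 2 by field; rewrite gt_eqF.
by rewrite ltr_pdivrMr// ltr_pMr// ltr1n.
Qed.
End hausdorff_image.

Unset Implicit Arguments.

Theorem theorem3p1 (R : realType) (n m : nat) (A : R -> \bar R) (phi : R -> R) :
  (1 <= n)%N -> young A -> C1 n A -> C2 A -> C3 n A -> gauge n phi ->
  (forall (Omega : set 'rV[R]_n) (u : 'rV[R]_n -> 'rV[R]_m),
     open Omega -> V1A A Omega u ->
     (forall x, Omega x -> {for x, continuous u}) ->
     forall eps : R, 0 < eps -> exists2 delta : R, 0 < delta &
       forall E : set 'rV[R]_n, E `<=` Omega ->
         (Hmeasure phi E < delta%:E)%E ->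
         (Hmeasure (psi n A phi) (u @` E) < eps%:E)%E) /\
  (forall u : 'rV[R]_n -> 'rV[R]_m,
     V1A A setT u -> continuous u ->
     forall eps : R, 0 < eps -> exists2 delta : R, 0 < delta &
       forall E : set 'rV[R]_n,
         (Hcontent phi E < delta%:E)%E ->
         (Hcontent (psi n A phi) (u @` E) < eps%:E)%E).
Proof.
move=> n0 yA c1 c2 _ gphi; split => [D u oD vu cu|u vu cu] eps eps0.
  exact: (measure_image n0 yA c1 c2 gphi oD vu cu eps0).
exact: (content_image n0 yA c1 c2 gphi vu cu eps0).
Qed.
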